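(* Let $0<\alpha<1$. For each $n\ge2$ let $p_n^*$ be an extremal polynomial, that is, a nonzero polynomial of degree at most $\alpha n$ with $$\frac{\|p_n^*\|_{[-1,1]}}{\|p_n^*\|_{E_n}} = \sup_{\deg p\le \alpha n}\frac{\|p\|_{[-1,1]}}{\|p\|_{E_n}} .$$ Then the sequence of normalized zero counting measures $$\nu_n = \frac1n \sum_{x:\,p_n^*(x)=0}\delta_x$$ tends in the weak$^*$ sense to the measure $\mu_\alpha$ as $n\to\infty$.
   Context: For an integer $n\ge 2$, $E_n = \{\frac{2k-n-1}{n-1} : k=1,\dots,n\}$ is the $n$-grid. For a set $K\subset\mathbb R$, $\|p\|_K = \sup_{x\in K}|p(x)|$. The supremum is over polynomials $p$ (complex coefficients) of degree at most $\alpha n$ that do not vanish identically. In $\nu_n$ each zero is counted according to its multiplicity (and the normalization is by $1/n$, not by the degree). Weak$^*$ convergence $\nu_n\to\mu_\alpha$ means $\int f\,d\nu_n\to\int f\,d\mu_\alpha$ for every continuous compactly supported function $f$. The measure $\mu_\alpha$ (the constrained equilibrium measure) is the measure on $[-1,1]$ with density with respect to Lebesgue measure $$\frac{d\mu_\alpha}{dx} = \begin{cases} \frac12, & x\in[-1,-r]\cup[r,1],\\[4pt] \frac1\pi\arctan\left(\frac{\alpha}{\sqrt{r^2-x^2}}\right), & x\in(-r,r),\end{cases}\qquad r=\sqrt{1-\alpha^2}.$$ It has total mass $\alpha$. *)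

(* Defs.v *)
From HB Require Import structures.
From mathcomp Require Import all_boot all_order all_algebra complex.
From mathcomp Require Import all_classical all_reals all_analysis.
From mathcomp Require Import measurable_realfun.

Set Implicit Arguments.
Unset Strict Implicit.
Unset Printing Implicit Defensive.
Import Order.TTheory GRing.Theory Num.Theory.
Import numFieldNormedType.Exports.
Local Open Scope classical_set_scope.
Local Open Scope ring_scope.
Local Open Scope complex_scope.

Section extremal_polynomials.
Context {R : realType}.

Definition grid (n : nat) : set R :=
  [set (2 * k%:R - n%:R - 1) / (n%:R - 1) | k in [set k | (1 <= k <= n)%N]].

Definition supnorm (K : set R) (p : {poly R[i]}) : R :=
  sup [set Normc.normc p.[x%:C] | x in K].

(* [size p] is one more than the degree of p. *)
Definition admissible (alpha : R) (n : nat) (p : {poly R[i]}) : Prop :=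
  p != 0 /\ (size p).-1%:R <= alpha * n%:R.

(* The denominator is nonzero for an admissible p when 0 < alpha < 1 and
   1 < n: p then has fewer roots than there are points in the grid. *)
Definition norm_ratio (n : nat) (p : {poly R[i]}) : R :=
  supnorm `[-1, 1] p / supnorm (grid n) p.

(* The supremum is taken in the extended reals, so that its finiteness is not
   presupposed. *)
Definition extremal (alpha : R) (n : nat) (p : {poly R[i]}) : Prop :=
  admissible alpha n p /\
  (norm_ratio n p)%:E =
    ereal_sup [set (norm_ratio n q)%:E | q in admissible alpha n].

End extremal_polynomials.

Section measures.
Context {R : realType}.

(* The complex plane with its Borel sigma-algebra; [R[i]^o] carries the
   topology of the modulus. *)
Definition borelC : measurableType (@open R[i]^o).-sigma :=
  g_sigma_algebraType (@open R[i]^o).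

(* The zeros of p repeated according to their multiplicities, when p != 0. *)
Definition zeros (p : {poly R[i]}) : seq R[i] :=
  sval (closed_field_poly_normal p).

Lemma zerosE (p : {poly R[i]}) :
  p = lead_coef p *: \prod_(z <- zeros p) ('X - z%:P).
Proof. exact: svalP (closed_field_poly_normal p). Qed.

Definition zero_counting (n : nat) (p : {poly R[i]}) :
    {measure set borelC -> \bar R} :=
  mscale (n%:R^-1)%:nng
    (msum (fun i => dirac ((zeros p)`_i : borelC)) (size (zeros p))).

Definition equilibrium_density (alpha x : R) : R :=
  let r := Num.sqrt (1 - alpha ^+ 2) in
  if (x \in `[-1, - r]) || (x \in `[r, 1]) then 2^-1
  else if x \in `]- r, r[ then atan (alpha / Num.sqrt (r ^+ 2 - x ^+ 2)) / pi
  else 0.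


Lemma measurable_equilibrium_density (alpha : R) :
  measurable_fun [set: measurableTypeR R] (equilibrium_density alpha).
Proof.
have measurable_mem (i : interval R) :
    measurable_fun [set: measurableTypeR R] (fun x : R => x \in i).
  apply: (measurable_fun_bool true); rewrite setTI.
  by rewrite (_ : _ @^-1` _ = [set` i])//; exact: measurable_itv.
rewrite /equilibrium_density; set r := Num.sqrt (1 - _).
apply: measurable_fun_if => //.
  by apply: measurable_or => //; exact: measurable_mem.
apply: measurable_funTS; apply: measurable_fun_if => //.
rewrite setTI (_ : _ @^-1` _ = [set` `]- r, r[])//.
apply: open_continuous_measurable_fun; first exact: interval_open.
move=> x; rewrite inE/= in_itv/= => /andP[rx xr].
have d_gt0 : 0 < r ^+ 2 - x ^+ 2.
  by rewrite subr_sqr mulr_gt0// ?subr_gt0// addrC -ltrBlDr sub0r.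
apply: cvgM; last exact: cvg_cst.
apply: continuous_comp; last exact: continuous_atan.
apply: cvgM; first exact: cvg_cst.
apply: cvgV; first by rewrite sqrtr_eq0 -ltNge.
apply: (@cvg_comp _ _ _ (fun y => r ^+ 2 - y ^+ 2) Num.sqrt); last first.
  exact: sqrt_continuous.
by apply: cvgB; [exact: cvg_cst|exact: exprn_continuous].
Qed.

Lemma equilibrium_density_ge0 (alpha x : R) :
  0 < alpha < 1 -> 0 <= equilibrium_density alpha x.
Proof.
move=> /andP[a0 _]; rewrite /equilibrium_density; case: ifP => // _.
case: ifP => // _; rewrite divr_ge0 ?pi_ge0//.
by rewrite -atan0 le_atan// divr_ge0 ?sqrtr_ge0// ltW.
Qed.

Lemma measurable_real_complex :
  measurable_fun [set: measurableTypeR R] (fun x : R => x%:C : borelC).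
Proof.
apply: (@measurability _ _ _ borelC _ _ (@open R[i]^o)) => // _ [U oU <-].
rewrite setTI; apply: open_measurable; rewrite openE => x /= Ux.
have /nbhs_ballP[e /= e0 eU] := open_nbhs_nbhs (conj oU Ux).
move: e e0 eU => [e e'] /andP[/eqP/= ie e0] eU; rewrite /= in ie e0.
apply/nbhs_ballP; exists e => //= y xy; apply: eU.
rewrite /ball /= -rmorphB /= normc_def /= expr0n addr0 sqrtr_sqr.
by rewrite ltcE /= ie eqxx.
Qed.

End measures.

Section equilibrium_measure.
Context {R : realType} (alpha : R).

(* As for [uniform_prob], the bounds on alpha are an argument so that the
   measure structure can be inferred: they make the density nonnegative. *)
Definition equilibrium_measure (alpha01 : 0 < alpha < 1) :
    set (measurableTypeR R) -> \bar R :=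
  fun A => (\int[lebesgue_measure]_(x in A) (equilibrium_density alpha x)%:E)%E.

Hypothesis alpha01 : 0 < alpha < 1.

Let equilibrium0 : equilibrium_measure alpha01 set0 = 0%E.
Proof. by rewrite /equilibrium_measure integral_set0. Qed.

Let equilibrium_ge0 A : (0 <= equilibrium_measure alpha01 A)%E.
Proof.
by apply: integral_ge0 => x _; rewrite lee_fin equilibrium_density_ge0.
Qed.

Let equilibrium_sigma_additive :
  semi_sigma_additive (equilibrium_measure alpha01).
Proof.
move=> /= F mF tF mUF; rewrite /equilibrium_measure; apply: cvg_toP.
  apply: ereal_nondecreasing_is_cvgn => m n mn.
  by apply: lee_sum_nneg_natr => // k _ _; exact: equilibrium_ge0.
rewrite ge0_integral_bigcup//=.
- apply: measurable_funTS; apply: measurableT_comp => //.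
  exact: measurable_equilibrium_density.
- by move=> x _; rewrite lee_fin equilibrium_density_ge0.
Qed.

HB.instance Definition _ := isMeasure.Build _ _ _
  (equilibrium_measure alpha01)
  equilibrium0 equilibrium_ge0 equilibrium_sigma_additive.

(* The same measure on the complex plane, where the zeros live. *)
Definition equilibrium_measureC (alpha01 : 0 < alpha < 1) :
    set borelC -> \bar R :=
  pushforward (equilibrium_measure alpha01) (fun x : R => x%:C : borelC).

Let mreal_complex := @measurable_real_complex R.

Let equilibriumC0 : equilibrium_measureC alpha01 set0 = 0%E.
Proof. by rewrite /equilibrium_measureC /pushforward preimage_set0 measure0. Qed.

Let equilibriumC_ge0 A : (0 <= equilibrium_measureC alpha01 A)%E.
Proof. exact: equilibrium_ge0. Qed.

Let equilibriumC_sigma_additive :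
  semi_sigma_additive (equilibrium_measureC alpha01).
Proof. exact: (@measure_semi_sigma_additive _ _ _
  (measure_function_pushforward__canonical__measure_function_Measure
     (equilibrium_measure alpha01) mreal_complex)). Qed.

HB.instance Definition _ := isMeasure.Build _ _ _
  (equilibrium_measureC alpha01)
  equilibriumC0 equilibriumC_ge0 equilibriumC_sigma_additive.

End equilibrium_measure.

Definition compactly_supported {R : realType} (f : R[i]^o -> R) : Prop :=
  compact (closure [set z | f z != 0]).

Definition weak_star_cvg {R : realType}
    (nu : nat -> {measure set (@borelC R) -> \bar R})
    (mu : {measure set (@borelC R) -> \bar R}) : Prop :=
  forall f : R[i]^o -> R, continuous f -> compactly_supported f ->
    (\int[nu n]_z (f z)%:E)%E @[n --> \oo] --> (\int[mu]_z (f z)%:E)%E.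

(* Main.v *)
Require Import Defs.
From mathcomp Require Import all_boot all_order all_algebra complex.
From mathcomp Require Import all_classical all_reals all_analysis.
From mathcomp Require Import measurable_realfun ring lra.

(* Perturbing an extremal polynomial p_n at its maximum point shows that it
   alternates on the grid; hence at least d - 1 of its zeros, d = floor(alpha n),
   lie in (-1, 1), and on one side of [-1, 1] it dominates, up to
   normalisation, every polynomial of degree < d bounded by 1 on the grid. The
   orthonormal polynomials of the grid (the discrete Chebyshev polynomials) are
   such competitors and, conversely, control all polynomials bounded by 1 on
   the grid up to powers of n. So on that side log |p_n| equals
   log P_d - (log ||P_d||^2) / 2 up to O(log n), where P_d is the monic
   discrete Chebyshev polynomial. Its recurrence coefficients tend to
   (1 - s^2) / 4 as k / n tends to s, and thus log (P_(k+1) / P_k)(z) to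
   log ((z + sqrt (z^2 - 1 + s^2)) / 2); expanding in powers of 1 / z and
   comparing the values at z and 2 z, which eliminates the norm, gives the
   limits of the moments of the zeros. They are the moments of mu_alpha, and
   Weierstrass approximation concludes. *)

Set Implicit Arguments.
Unset Strict Implicit.
Unset Printing Implicit Defensive.
Import Order.TTheory GRing.Theory Num.Theory.
Import numFieldNormedType.Exports.
Local Open Scope classical_set_scope.
Local Open Scope ring_scope.

(** * Discrete Chebyshev polynomials *)

(** All estimates are made at real z >= 2, where the P_k are positive and increase with k;
    recurrences for their ratios then suffice and no complex analysis enters. Domination can be had
    on one side only. With x0 the maximum point, it is u(x) (x - x0) that alternates at d + 1 nodes,
    so (x - x0) (u - lam q) keeps d zeros between the nodes but may have degree d + 1. If u fails to
    dominate q at z, then z can be made the remaining zero, and comparing signs at the last node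
    fixes the side on which z lies. The good side may change with n; the sign [eps] that records it
    disappears in the limit, since even moments do not see it and odd moments tend to 0. For the
    same reason one zero of p_n escapes. In the logarithm it leaves an affine factor, whose values
    at z and 2 z are comparable because this factor does not vanish on the good side; in the measure
    it weighs 1/n. *)

Section three_term_recurrence.
Context {R : realType} (c : nat -> R).

Fixpoint monic_op_pair (k : nat) : {poly R} * {poly R} :=
  if k is j.+1 then
    let: (p, q) := monic_op_pair j in ('X * p - c j *: q, p)
  else (1, 0).

Definition monic_op (k : nat) : {poly R} := (monic_op_pair k).1.

Lemma monic_op0 : monic_op 0 = 1. Proof. by []. Qed.

Lemma monic_op1 : monic_op 1 = 'X.
Proof. by rewrite /monic_op /= mulr1 scaler0 subr0. Qed.

Lemma monic_opSS k :
  monic_op k.+2 = 'X * monic_op k.+1 - c k.+1 *: monic_op k.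
Proof. by rewrite /monic_op /=; case: (monic_op_pair k). Qed.

Lemma horner_monic_opSS k x :
  (monic_op k.+2).[x] = x * (monic_op k.+1).[x] - c k.+1 * (monic_op k).[x].
Proof. by rewrite monic_opSS !hornerE. Qed.

Lemma monic_op_monic_size k :
  (monic_op k \is monic) && (size (monic_op k) == k.+1).
Proof.
elim/ltn_ind: k => -[|[|k]] IH.
- by rewrite monic_op0 monic1 size_poly1.
- by rewrite monic_op1 monicX size_polyX.
have /andP[m1 /eqP s1] := IH k.+1 (ltnSn _).
have /andP[m0 /eqP s0] := IH k (ltnW (ltnSn _)).
rewrite monic_opSS.
have sX : size ('X * monic_op k.+1) = k.+3.
  by rewrite mulrC size_mulX ?s1// -size_poly_gt0 s1.
have lt : (size (- (c k.+1 *: monic_op k)) < size ('X * monic_op k.+1)%R)%N.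
  by rewrite sX size_polyN; apply: leq_ltn_trans (size_scale_leq _ _) _; rewrite s0.
rewrite monicE lead_coefDl// lead_coefM lead_coefX (monicP m1) mulr1 eqxx.
by rewrite (size_polyDl lt) sX eqxx.
Qed.

Lemma size_monic_op k : size (monic_op k) = k.+1.
Proof. by have /andP[_ /eqP] := monic_op_monic_size k. Qed.

Lemma monic_op_monic k : monic_op k \is monic.
Proof. by have /andP[] := monic_op_monic_size k. Qed.

Lemma horner_monic_opN k x :
  (monic_op k).[- x] = (-1) ^+ k * (monic_op k).[x].
Proof.
elim/ltn_ind: k => -[|[|k]] IH.
- by rewrite monic_op0 !hornerE.
- by rewrite monic_op1 !hornerE; ring.
rewrite !horner_monic_opSS !IH ?ltnS// !exprS; ring.
Qed.

Lemma sum_monic_op (q : {poly R}) (d : nat) : (size q <= d)%N ->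
  exists b : nat -> R, q = \sum_(k < d) b k *: monic_op k.
Proof.
elim: d q => [|d IH] q sq.
  exists (fun=> 0); rewrite big_ord0; apply/eqP.
  by rewrite -size_poly_leq0.
have [|b qb] := IH (q - q`_d *: monic_op d).
  apply/leq_sizeP => j dj; rewrite !coefE.
  move: dj; rewrite leq_eqVlt => /orP[/eqP <-|dj].
    have := monic_op_monic d; rewrite monicE /lead_coef size_monic_op/= => /eqP->.
    by rewrite mulr1 subrr.
  rewrite [q`_j]nth_default ?(leq_trans sq)//.
  by rewrite [X in _ * X]nth_default ?size_monic_op// mulr0 subr0.
exists (fun k => if (k < d)%N then b k else q`_d).
rewrite big_ord_recr/= ltnn -[LHS](subrK (q`_d *: monic_op d)) qb.
by congr (_ + _); apply: eq_bigr => i _; rewrite ltn_ord.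
Qed.

End three_term_recurrence.

Section discrete_chebyshev.
Context {R : realType} (h T : R).

(** For h = 1 and T = n / 2 these are the classical coefficients k^2 (n^2 - k^2) / (4 (4 k^2 - 1))
    of the Gram polynomials on n equidistant points. *)
Definition hahn_coef (k : nat) : R :=
  k%:R ^+ 2 * (4 * T ^+ 2 - h ^+ 2 * k%:R ^+ 2) / (4 * (4 * k%:R ^+ 2 - 1)).

Local Notation P := (monic_op hahn_coef).

(** On nodes of step h running from - T + h / 2 to T - h / 2, [dn] vanishes at the first node and
    [up] at the last, so the difference operator never uses a value outside the grid. *)
Let up (x : R) := (x + h / 2) ^+ 2 - T ^+ 2.
Let dn (x : R) := (x - h / 2) ^+ 2 - T ^+ 2.

(* The difference operator of which the discrete Chebyshev polynomials are
   eigenfunctions. *)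
Definition hahn_op (f : R -> R) (x : R) : R :=
  up x * (f (x + h) - f x) - dn x * (f x - f (x - h)).

Let struct_op (f : R -> R) (x : R) : R :=
  up x * f (x + h) - dn x * f (x - h).

Let eig (k : nat) : R := h ^+ 2 * k%:R * (k%:R + 1).

(* The eigenvalue equation is proved together with the structure relation,
   since each feeds the induction step of the other. *)
Let hahn_eigen_struct k :
  (forall x, hahn_op (horner (P k)) x = eig k * (P k).[x]) /\
  (forall x, struct_op (horner (P k)) x =
    h * ((4 * k%:R + 2) * (P k.+1).[x] - 2 * k%:R * x * (P k).[x])).
Proof.
have hornerP0 x : (P 0).[x] = 1 by rewrite monic_op0 hornerC.
have hornerP1 x : (P 1).[x] = x by rewrite monic_op1 hornerX.
elim/ltn_ind: k => -[|[|k]] IH.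
- split => x; rewrite /hahn_op /struct_op /up /dn /eig !hornerP0 ?hornerP1.
    by rewrite mulr0n; ring.
  by rewrite mulr0n; field.
- split => x; rewrite /hahn_op /struct_op /up /dn /eig ?horner_monic_opSS;
    rewrite !hornerP1 ?hornerP0 ?mulr1n; first by field.
  by rewrite /hahn_coef ?mulr1n; field.
have [E0 D0] := IH k (ltnW (ltnSn _)).
have [E1 D1] := IH k.+1 (ltnSn _).
split => x.
  have := E0 x; have := E1 x; have := D1 x.
  rewrite /hahn_op /struct_op /eig !horner_monic_opSS.
  move: (P k).[x] (P k).[x + h] (P k).[x - h] (P k.+1).[x] (P k.+1).[x + h]
    (P k.+1).[x - h] (up x) (dn x) (hahn_coef k.+1) => a ap am b bp bm u v c.
  rewrite -!natr1 => D1x E1x E0x.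
  (* Commuting the operator with multiplication by x leaves h times the structure operator, which is
     why the eigenvalue equation at k + 2 needs the structure relation at k + 1. *)
  have -> : u * ((x + h) * bp - c * ap - (x * b - c * a)) -
    v * (x * b - c * a - ((x - h) * bm - c * am)) =
    x * (u * (bp - b) - v * (b - bm)) - c * (u * (ap - a) - v * (a - am)) +
    h * (u * bp - v * bm) by ring.
  rewrite E1x E0x D1x; ring.
have := D0 x; have := E1 x; have := D1 x.
rewrite /hahn_op /struct_op /eig (horner_monic_opSS _ k.+1) !horner_monic_opSS.
move: (P k).[x] (P k).[x + h] (P k).[x - h] (P k.+1).[x] (P k.+1).[x + h]
  (P k.+1).[x - h] => a ap am b bp bm.
move=> D1x E1x D0x.
have -> : up x * ((x + h) * bp - hahn_coef k.+1 * ap) -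
    dn x * ((x - h) * bm - hahn_coef k.+1 * am) =
    x * (up x * bp - dn x * bm) - hahn_coef k.+1 * (up x * ap - dn x * am) +
    h * ((up x * (bp - b) - dn x * (b - bm)) + (up x + dn x) * b) by ring.
rewrite E1x D0x D1x /hahn_coef /up /dn -!natr1.
have k0 : 0 <= k%:R :> R by [].
by field; apply/andP; split; apply: lt0r_neq0; nra.
Qed.

Lemma hahn_op_eigen k x : hahn_op (horner (P k)) x = eig k * (P k).[x].
Proof. exact: (hahn_eigen_struct k).1. Qed.

(** Summation by parts: since dn (x + h) = up x, the difference of the two summands telescopes into
    [W], a weighted discrete Wronskian that vanishes at both ends. *)
Lemma hahn_op_sym (f g : R -> R) (x : nat -> R) (n : nat) :
    (forall i, x i.+1 = x i + h) -> dn (x 0) = 0 -> up (x n - h) = 0 ->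
  \sum_(i < n) hahn_op f (x i) * g (x i) = \sum_(i < n) f (x i) * hahn_op g (x i).
Proof.
move=> xS x0 xn; apply/eqP; rewrite -subr_eq0 -sumrB; apply/eqP.
pose W i := dn (x i) * (f (x i) * g (x i - h) - f (x i - h) * g (x i)).
rewrite -(big_mkord xpredT (fun i => hahn_op f (x i) * g (x i) -
  f (x i) * hahn_op g (x i))).
rewrite (telescope_sumr_eq W)//.
- have updn y : dn y = up (y - h) by rewrite /up /dn; congr (_ ^+ 2 - _); field.
  by rewrite /W x0 updn xn !mul0r subrr.
- move=> i _; rewrite /W !xS addrK /hahn_op.
  by rewrite (_ : dn (x i + h) = up (x i)) ?/up ?/dn; field.
Qed.

Lemma monic_op_orthogonal j k (x : nat -> R) (n : nat) : h != 0 ->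
    (forall i, x i.+1 = x i + h) -> dn (x 0) = 0 -> up (x n - h) = 0 ->
  j != k -> \sum_(i < n) (P j).[x i] * (P k).[x i] = 0.
Proof.
move=> h0 xS x0 xn jk; set s := \sum_(i < n) _.
have : eig j * s = eig k * s.
  rewrite !mulr_sumr.
  transitivity (\sum_(i < n) (P j).[x i] * hahn_op (horner (P k)) (x i)).
    rewrite -hahn_op_sym//; apply: eq_bigr => i _; rewrite hahn_op_eigen; ring.
  by apply: eq_bigr => i _; rewrite hahn_op_eigen; ring.
move/eqP; rewrite -subr_eq0 -mulrBl mulf_eq0 => /orP[|/eqP//].
rewrite (_ : eig j - eig k = h ^+ 2 * (j%:R - k%:R) * (j%:R + k%:R + 1)).
  by rewrite !mulf_eq0 (negbTE h0) subr_eq0 eqr_nat (negbTE jk)/= -natrD natr1 pnatr_eq0.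
by rewrite /eig; ring.
Qed.

(** The recurrence and orthogonality give <P_(k+1), P_(k+1)> = <x P_(k+1), P_k> ([e1]), and
    orthogonality of P_(k+2) and P_k turns the latter into c_(k+1) <P_k, P_k>. *)
Lemma monic_op_norm k (x : nat -> R) (n : nat) : h != 0 ->
    (forall i, x i.+1 = x i + h) -> dn (x 0) = 0 -> up (x n - h) = 0 ->
  \sum_(i < n) (P k).[x i] ^+ 2 = n%:R * \prod_(i < k) hahn_coef i.+1.
Proof.
move=> h0 xS x0 xn.
have orth a b : a != b -> _ := monic_op_orthogonal h0 xS x0 xn.
elim: k => [|k IH].
  rewrite big_ord0 mulr1; under eq_bigr do rewrite monic_op0 hornerC expr1n.
  by rewrite sumr_const card_ord.
rewrite big_ord_recr/= mulrA -{}IH mulr_suml.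
have e1 : \sum_(i < n) (P k.+1).[x i] ^+ 2 =
          \sum_(i < n) x i * (P k.+1).[x i] * (P k).[x i].
  case: k => [|k].
    by apply: eq_bigr => i _; rewrite monic_op1 monic_op0 hornerX hornerC; ring.
  have e := @orth k.+2 k; rewrite neq_ltn ltnS leqnSn orbT in e.
  apply/subr0_eq; rewrite -sumrB.
  transitivity (- hahn_coef k.+1 * \sum_(i < n) (P k.+2).[x i] * (P k).[x i]).
    by rewrite mulr_sumr; apply: eq_bigr => i _; rewrite horner_monic_opSS; ring.
  by rewrite (e isT) mulr0.
have e2 := @orth k.+2 k; rewrite neq_ltn ltnS leqnSn orbT in e2.
apply/subr0_eq; rewrite e1 -sumrB; transitivity
  (\sum_(i < n) (P k.+2).[x i] * (P k).[x i]); last exact: e2.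
by apply: eq_bigr => i _; rewrite horner_monic_opSS; ring.
Qed.

End discrete_chebyshev.

Section monic_op_growth.
Context {R : realType} (c : nat -> R) (n : nat).
Hypothesis c01 : forall k, (k < n)%N -> 0 <= c k <= 1.

(** The threshold 2 closes the induction: z P_(k+1) - c P_k >= 2 P_(k+1) - P_(k+1) as soon as c <= 1
    and P_k <= P_(k+1). *)
Lemma monic_op_growth (z : R) k : 2 <= z -> (k < n)%N ->
  [/\ 0 < (monic_op c k).[z], (monic_op c k).[z] <= (monic_op c k.+1).[z]
    & (monic_op c k.+1).[z] <= z * (monic_op c k).[z]].
Proof.
move=> z2; elim: k => [|k IH] kn.
  by rewrite monic_op0 monic_op1 hornerC hornerX; split=> //; lra.
have [p0 p1 _] := IH (ltnW kn); have /andP[c0 c1] := c01 kn.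
rewrite horner_monic_opSS; split; nra.
Qed.

End monic_op_growth.

(** * Orthogonal polynomials of the n-grid and their growth off the interval *)

Section uniform_grid.
Context {R : realType} (n : nat).
Hypothesis n3 : (2 < n)%N.

Definition grid_point (i : nat) : R := -1 + 2 / (n%:R - 1) * i%:R.

(** Here h is the mesh and T = 1 + h / 2: the n cells of width h centred at the nodes fill
    [-T, T]. *)
Definition gram_coef (k : nat) : R :=
  hahn_coef (2 / (n%:R - 1)) (n%:R / (n%:R - 1)) k.

Definition gram_poly (k : nat) : {poly R} := monic_op gram_coef k.

Definition gram_norm (k : nat) : R := n%:R * \prod_(i < k) gram_coef i.+1.

Let n_ge3 : 3 <= n%:R :> R. Proof. by rewrite ler_nat. Qed.
Let n1_gt0 : 0 < n%:R - 1 :> R. Proof. by have := n_ge3; lra. Qed.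

Let step_neq0 : 2 / (n%:R - 1) != 0 :> R.
Proof. by rewrite mulf_neq0// invr_neq0// lt0r_neq0. Qed.

Let grid_pointS i : grid_point i.+1 = grid_point i + 2 / (n%:R - 1).
Proof. by rewrite /grid_point -natr1; ring. Qed.

Let bc0 : (grid_point 0 - 2 / (n%:R - 1) / 2) ^+ 2 - (n%:R / (n%:R - 1)) ^+ 2
  = 0.
Proof. rewrite /grid_point mulr0; field; exact: lt0r_neq0. Qed.

Let bcn : (grid_point n - 2 / (n%:R - 1) + 2 / (n%:R - 1) / 2) ^+ 2 -
  (n%:R / (n%:R - 1)) ^+ 2 = 0.
Proof. rewrite /grid_point; field; exact: lt0r_neq0. Qed.

Lemma gram_poly_orthogonal j k : j != k ->
  \sum_(i < n) (gram_poly j).[grid_point i] * (gram_poly k).[grid_point i] = 0.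
Proof. exact: monic_op_orthogonal. Qed.

Lemma gram_poly_norm k :
  \sum_(i < n) (gram_poly k).[grid_point i] ^+ 2 = gram_norm k.
Proof. exact: monic_op_norm. Qed.

Lemma gram_coefE k : gram_coef k =
  k%:R ^+ 2 / (4 * k%:R ^+ 2 - 1) * (n%:R ^+ 2 - k%:R ^+ 2) / (n%:R - 1) ^+ 2.
Proof.
rewrite /gram_coef /hahn_coef; field.
rewrite (lt0r_neq0 n1_gt0)/=; case: k => [|k]; first by rewrite expr0n/= mulr0 sub0r oppr_eq0.
have : 1 <= k.+1%:R :> R by rewrite ler1n.
by move=> k1; apply: lt0r_neq0; nra.
Qed.

Lemma gram_coef_gt0 k : (0 < k < n)%N -> 0 < gram_coef k.
Proof.
move=> /andP[k0 kn]; rewrite gram_coefE.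
have k1 : 1 <= k%:R :> R by rewrite ler1n.
have kn' : k%:R < n%:R :> R by rewrite ltr_nat.
rewrite divr_gt0 ?exprn_gt0// mulr_gt0 ?divr_gt0 ?exprn_gt0// ?ltr0n//; nra.
Qed.

Lemma gram_coef_le1 k : (k < n)%N -> gram_coef k <= 1.
Proof.
move=> kn; case: k kn => [|k] kn.
  by rewrite gram_coefE expr0n/= !mul0r.
rewrite gram_coefE ler_pdivrMr ?exprn_gt0// mul1r.
have k1 : 1 <= k.+1%:R :> R by rewrite ler1n.
have e : k.+1%:R ^+ 2 / (4 * k.+1%:R ^+ 2 - 1) <= 3^-1 :> R.
  have k2 : 1 <= k.+1%:R ^+ 2 :> R by rewrite exprn_ege1.
  by rewrite ler_pdivrMr; lra.
have kn' : k.+1%:R < n%:R :> R by rewrite ltr_nat.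
apply: le_trans (_ : 3^-1 * (n%:R ^+ 2 - k.+1%:R ^+ 2) <= _).
  by rewrite ler_wpM2r//; nra.
have := n_ge3; nra.
Qed.

(** Applied at k = d, this keeps the quotient of the squared norms of degrees d and d - 1 above (1 -
    alpha) / 4, uniformly in n. *)
Lemma gram_coef_ge k : (0 < k < n)%N ->
  4^-1 * (1 - k%:R / n%:R) <= gram_coef k.
Proof.
move=> /andP[k0 kn]; rewrite gram_coefE -mulrA.
have k1 : 1 <= k%:R :> R by rewrite ler1n.
have kn' : k%:R < n%:R :> R by rewrite ltr_nat.
have n3' := n_ge3.
apply: ler_pM => //.
- by rewrite subr_ge0 ler_pdivrMr ?mul1r; lra.
- by rewrite ler_pdivlMr; nra.
rewrite ler_pdivlMr ?exprn_gt0//.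
have -> : 1 - k%:R / n%:R = (n%:R - k%:R) / n%:R :> R by field; lra.
rewrite mulrAC ler_pdivrMr; last by lra.
rewrite subr_sqr -!mulrA ler_wpM2l//; first by lra.
by nra.
Qed.

Lemma gram_norm_gt0 k : (k < n)%N -> 0 < gram_norm k.
Proof.
move=> kn; rewrite mulr_gt0//; first by have := n_ge3; lra.
by apply: prodr_gt0 => i _; rewrite gram_coef_gt0//= (leq_ltn_trans _ kn).
Qed.

Lemma gram_normS k : gram_norm k.+1 = gram_norm k * gram_coef k.+1.
Proof. by rewrite /gram_norm big_ord_recr/= mulrA. Qed.

Lemma gram_poly_growth (z : R) k : 2 <= z -> (k < n)%N ->
  [/\ 0 < (gram_poly k).[z], (gram_poly k).[z] <= (gram_poly k.+1).[z]
    & (gram_poly k.+1).[z] <= z * (gram_poly k).[z]].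
Proof.
apply: monic_op_growth => -[|j] jn.
  by rewrite gram_coefE expr0n/= !mul0r lexx ler01.
by rewrite gram_coef_le1// ltW// gram_coef_gt0.
Qed.

(* The Christoffel function outside the interval is governed by its last term. *)
Lemma gram_poly_ratio_le (z : R) j k : 2 <= z -> (j <= k < n)%N ->
  (gram_poly j).[z] ^+ 2 / gram_norm j <= (gram_poly k).[z] ^+ 2 / gram_norm k.
Proof.
move=> z2 /andP[]; elim: k => [|k IH]; first by rewrite leqn0 => /eqP->.
rewrite leq_eqVlt => /orP[/eqP->//|jk kn].
apply: le_trans (IH jk (ltnW kn)) _.
have [p0 p1 _] := gram_poly_growth z2 (ltnW kn).
have g0 := gram_norm_gt0 (ltnW kn); have g1 := gram_norm_gt0 kn.
apply: ler_pM; [exact: sqr_ge0|by rewrite invr_ge0 ltW| |].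
  by rewrite ler_pXn2r// nnegrE ltW// (lt_le_trans p0).
rewrite lef_pV2 ?posrE// gram_normS.
by rewrite ler_piMr ?gram_coef_le1// ltW.
Qed.

(** Parseval on the grid bounds every b_k^2 ||P_k||^2 by n; since |P_k(z)| / ||P_k|| is largest for
    k = d, each of the d + 1 terms of the expansion of q at z is at most sqrt n times P_d(z) /
    ||P_d||. *)
Lemma poly_le_gram (z : R) (q : {poly R}) (d : nat) :
    2 <= z -> (d < n)%N -> (size q <= d.+1)%N ->
    (forall i, (i < n)%N -> `|q.[grid_point i]| <= 1) ->
  `|q.[z]| <= d.+1%:R * Num.sqrt n%:R * ((gram_poly d).[z] / Num.sqrt (gram_norm d)).
Proof.
move=> z2 dn sq q1; have [b qb] := sum_monic_op gram_coef sq.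
have sumE y : q.[y] = \sum_(k < d.+1) b k * (gram_poly k).[y].
  by rewrite qb horner_sum; apply: eq_bigr => k _; rewrite hornerZ.
have parseval : \sum_(i < n) q.[grid_point i] ^+ 2 =
    \sum_(k < d.+1) b k ^+ 2 * gram_norm k.
  under eq_bigr do rewrite expr2 {1}sumE sumE mulr_suml.
  rewrite exchange_big; apply: eq_bigr => k _ /=.
  under eq_bigr do rewrite mulr_sumr.
  rewrite exchange_big (bigD1 k)//= [X in _ + X]big1 ?addr0; last first.
    move=> j jk; under eq_bigr do rewrite mulrACA.
    by rewrite -mulr_sumr gram_poly_orthogonal ?mulr0// eq_sym.
  under eq_bigr do rewrite mulrACA -!expr2.
  by rewrite -mulr_sumr gram_poly_norm.
have sq_le : \sum_(i < n) q.[grid_point i] ^+ 2 <= n%:R.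
  have -> : n%:R = \sum_(i < n) 1 :> R by rewrite sumr_const card_ord.
  rewrite ler_sum// => i _.
  by rewrite -real_normK ?num_real// expr_le1 ?q1.
have b_le k : (k < d.+1)%N -> b k ^+ 2 <= n%:R / gram_norm k.
  move=> kd; rewrite ler_pdivlMr ?gram_norm_gt0 ?(leq_trans kd)//.
  apply: le_trans sq_le; rewrite parseval (bigD1 (Ordinal kd))//= lerDl.
  apply: sumr_ge0 => j _; rewrite mulr_ge0 ?sqr_ge0// ltW// gram_norm_gt0//.
  exact: leq_trans (ltn_ord j) dn.
rewrite sumE; apply: le_trans (ler_norm_sum _ _ _) _.
rewrite -mulrA -[X in X%:R](card_ord d.+1) mulr_natl -sumr_const.
apply: ler_sum => k _; have kn : (k < n)%N := leq_trans (ltn_ord k) dn.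
have [pd0 _ _] := gram_poly_growth z2 dn.
rewrite -[leRHS]ger0_norm; last first.
  by rewrite mulr_ge0 ?sqrtr_ge0// divr_ge0 ?sqrtr_ge0// ltW.
rewrite -ler_sqr ?nnegrE// !real_normK ?num_real// !exprMn exprVn.
rewrite !sqr_sqrtr//; last exact/ltW/gram_norm_gt0.
have := @gram_poly_ratio_le z k d z2; rewrite -ltnS ltn_ord dn => /(_ isT) rle.
apply: le_trans (ler_wpM2r (sqr_ge0 _) (b_le k (ltn_ord k))) _.
by rewrite mulrAC -mulrA ler_wpM2l.
Qed.

Lemma gram_poly_le_norm k i : (i < n)%N ->
  `|(gram_poly k).[grid_point i]| <= Num.sqrt (gram_norm k).
Proof.
move=> ilt; rewrite -sqrtr_sqr ler_wsqrtr// -gram_poly_norm.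
rewrite (bigD1 (Ordinal ilt))//= lerDl.
by apply: sumr_ge0 => j _; rewrite sqr_ge0.
Qed.

End uniform_grid.

(** * Asymptotics outside the interval *)

Section log_expansion.
Context {R : realType}.

(* [wallis m] is binomial(2m, m) / 4^m. *)
Fixpoint wallis (m : nat) : R :=
  if m is j.+1 then (2 * j%:R + 1) / (2 * j%:R + 2) * wallis j else 1.

Arguments wallis : simpl never.

Lemma wallis_gt0 m : 0 < wallis m.
Proof.
elim: m => [|m IH]; rewrite /wallis -/wallis//.
have m0 : 0 <= m%:R :> R by [].
by rewrite mulr_gt0// divr_gt0//; lra.
Qed.

Lemma wallis_le1 m : wallis m <= 1.
Proof.
elim: m => [|m IH]; rewrite /wallis -/wallis//.
have m0 : 0 <= m%:R :> R by [].
rewrite -[leRHS]mulr1 ler_pM//; last by rewrite ler_pdivrMr; lra.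
exact/ltW/wallis_gt0.
Qed.

Lemma wallisS m : (2 * m%:R + 2) * wallis m.+1 = (2 * m%:R + 1) * wallis m.
Proof. by have m0 : 0 <= m%:R :> R by []; rewrite /wallis -/wallis; field; lra. Qed.

Let u : {poly R} := 4%:P * 'X * (1 - 'X).

Let horner_u y : u.[y] = 4 * y * (1 - y).
Proof. by rewrite /u !hornerM !hornerD hornerN !hornerC hornerX. Qed.

Let deriv_u : u^`() = 4%:P * (1 - 2%:P * 'X).
Proof.
rewrite /u !derivM derivC derivX derivB derivX derivC mul0r add0r sub0r.
by rewrite mulr1 (_ : 2%:P = 2)//; ring.
Qed.

Let gen (M : nat) : {poly R} := \sum_(m < M.+1) (wallis m)%:P * u ^+ m.

(* [gen M] truncates the series of (1 - u)^(-1/2), and (1 - 2y)^2 = 1 - u. *)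
Let deriv_gen M : ((1 - 2%:P * 'X) * gen M)^`() =
  - ((4 * M%:R + 2) * wallis M)%:P * u ^+ M.
Proof.
have p2 : 2%:P = 2 :> {poly R} by rewrite -polyC_natr.
have p4 : 4%:P = 4 :> {poly R} by rewrite -polyC_natr.
have dl : (1 - 2%:P * 'X)^`() = - 2%:P :> {poly R}.
  by rewrite derivB derivC derivM derivC derivX mul0r sub0r add0r mulr1.
elim: M => [|M IH].
  by rewrite /gen big_ord1 expr0 /wallis polyC1 !mulr1 dl mulr0 add0r.
rewrite /gen big_ord_recr -/(gen M) mulrDr derivD IH.
rewrite !derivM dl derivC mul0r add0r deriv_exp deriv_u /=.
have e : (1 - 2%:P * 'X) ^+ 2 = 1 - u :> {poly R}.
  by rewrite /u p2 p4; ring.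
have w : (4 * M%:R + 2) * wallis M = (4 * M%:R + 4) * wallis M.+1.
  by have := wallisS M; lra.
rewrite w -[M.+1%:R]natr1; move: (wallis M.+1) => W.
have pM : (M%:R)%:P = M%:R :> {poly R} by rewrite polyC_natr.
have pc : (4 * M%:R + 4)%:P = 4 * M%:R + 4 :> {poly R}.
  by rewrite (polyCD (4 * M%:R) 4) polyCM p4 pM.
have pc' : (4 * (M%:R + 1) + 2)%:P = 4 * M%:R + 6 :> {poly R}.
  rewrite (_ : 4 * (M%:R + 1) + 2 = 4 * M%:R + 6); last by ring.
  by rewrite (polyCD (4 * M%:R) 6) polyCM p4 pM; congr (_ + _); exact: polyC_natr.
rewrite !polyCM pc pc' p2 p4 exprS -(mulr_natl _ M.+1) -[M.+1%:R]natr1.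
have -> : (1 - 2 * 'X) * (W%:P * ((M%:R + 1) * (4 * (1 - 2 * 'X) * u ^+ M))) =
  W%:P * (M%:R + 1) * 4 * u ^+ M * (1 - 2 * 'X) ^+ 2 :> {poly R}.
  by ring.
by rewrite -p2 e; ring.
Qed.

Let gen_near1 M (y : R) : 0 <= y <= 2^-1 ->
  `|1 - (1 - 2 * y) * (gen M).[y]| <= (4 * M%:R + 2) * (4 * y) ^+ M * y.
Proof.
move=> /andP[y0 y2].
set q := (1 - 2%:P * 'X) * gen M.
have hq z : q.[z] = (1 - 2 * z) * (gen M).[z].
  by rewrite /q hornerM !hornerE.
have q0 : q.[0] = 1.
  rewrite hq mulr0 subr0 mul1r /gen horner_sum big_ord_recl big1 /= => [|i _].
    by rewrite addr0 hornerM expr0 !hornerC mulr1.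
  by rewrite hornerM horner_exp horner_u mulr0 mul0r expr0n mulr0.
have [c] := @MVT_segment _ (horner q) (horner q^`()) 0 y y0
  (fun x _ => is_derive_poly q x) (continuous_subspaceT (@continuous_horner _ q)).
rewrite in_itv/= q0 hq subr0 => /andP[c0 cy] e.
rewrite distrC e deriv_gen hornerM hornerN hornerC horner_exp horner_u.
rewrite !normrM normrN (ger0_norm y0) ler_wpM2r//.
have M0 : 0 <= M%:R :> R by [].
have w0 := wallis_gt0 M; have w1 := wallis_le1 M.
have A0 : 0 <= (4 * M%:R + 2) * wallis M by rewrite mulr_ge0//; lra.
have U0 : 0 <= 4 * c * (1 - c) by nra.
rewrite normrX (ger0_norm A0) (ger0_norm U0).
apply: ler_pM => //; [exact: exprn_ge0|nra|].
by apply: lerXn2r; rewrite ?nnegrE; nra.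
Qed.

(** With w = 4 y (1 - y) and y <= 1/2 one has 1 - y = (1 + sqrt (1 - w)) / 2, so this expands - log
    ((1 + sqrt (1 - w)) / 2) in powers of w. Keeping y as the variable avoids the square root and
    makes both sides easy to differentiate. *)
Lemma ln_wallis_expansion M (y : R) : 0 <= y <= 2^-1 ->
  `|- ln (1 - y) -
    \sum_(m < M) wallis m.+1 / (2 * m.+1%:R) * (4 * y * (1 - y)) ^+ m.+1|
  <= (4 * M%:R + 2) * (4 * y) ^+ M * y.
Proof.
move=> /andP[y0 y2].
pose S : {poly R} :=
  \sum_(m < M) (wallis m.+1 / (2 * m.+1%:R))%:P * u ^+ m.+1.
have SE z : S.[z] =
    \sum_(m < M) wallis m.+1 / (2 * m.+1%:R) * (4 * z * (1 - z)) ^+ m.+1.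
  rewrite horner_sum; apply: eq_bigr => i _.
  by rewrite hornerM horner_exp hornerC horner_u.
have S' z : u.[z] * S^`().[z] = 2 * (1 - 2 * z) * ((gen M).[z] - 1).
  rewrite /gen big_ord_recl/= expr0 mulr1 hornerD hornerC addrAC subrr add0r.
  rewrite /S raddf_sum !horner_sum !mulr_sumr; apply: eq_bigr => i _.
  rewrite /= derivM derivC mul0r add0r deriv_exp deriv_u /=.
  rewrite !(hornerM, hornerMn, hornerD, hornerN, horner_exp, hornerC, hornerX).
  rewrite exprSr /bump/= -(mulr_natl _ i.+1).
  have i0 : 0 <= i%:R :> R by [].
  by rewrite -[i.+1%:R]natr1; field; lra.
have [->|y_neq0] := eqVneq y 0.
  rewrite subr0 ln1 oppr0 !mulr0 big1 ?subr0 ?normr0// => i _.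
  by rewrite mul0r expr0n mulr0.
have y_gt0 : 0 < y by rewrite lt_neqAle eq_sym y_neq0.
pose D (z : R) := - ln (1 - z) - S.[z].
pose D' (z : R) := (1 - z)^-1 - S^`().[z].
have dD (z : R) : z < 1 -> is_derive z 1 D (D' z).
  move=> z1; have z1' : 0 < 1 - z by lra.
  have d0 : is_derive z 1 (fun t : R => 1 - t) (0 - 1).
    by apply: is_deriveB.
  have d1 := @is_derive1_comp _ _ (fun t : R => 1 - t) _ _ _ (is_derive1_ln z1') d0.
  apply: trigger_derive (is_deriveB (is_deriveN d1) (is_derive_poly S z)) _.
  by rewrite /D'; ring.
have dD0y (x : R) : x \in `]0, y[ -> is_derive x 1 D (D' x).
  by rewrite in_itv/= => /andP[x0 xy]; apply: dD; lra.
have cD : {within `[0, y], continuous D}.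
  apply: derivable_within_continuous => x; rewrite in_itv/= => /andP[x0 xy].
  by have [] := dD x ltac:(lra).
have [c] := MVT y_gt0 dD0y cD.
rewrite in_itv/= {1 2}/D subr0 ln1 oppr0 add0r SE => /andP[c0 cy].
rewrite (_ : S.[0] = 0); last first.
  by rewrite SE big1// => i _; rewrite mulr0 mul0r expr0n mulr0.
rewrite oppr0 !subr0 addr0 => ->; rewrite normrM (ger0_norm y0) ler_wpM2r//.
have uc : 0 < u.[c] by rewrite horner_u; nra.
(* The derivative [D'] is known only after multiplication by u, which vanishes at 0; the factor c in
   [gen_near1] makes up for it, because 2 c <= u.[c] when c <= 1/2. *)
have uD : u.[c] * D' c = 2 * (1 - (1 - 2 * c) * (gen M).[c]).
  rewrite /D' mulrBr S' horner_u; field; lra.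
have := @gen_near1 M c; rewrite (ltW c0) => /(_ _)/[!andTb] gn.
have {}gn := gn ltac:(lra).
rewrite -(ler_pM2l uc) -{1}(ger0_norm (ltW uc)) -normrM uD normrM ger0_norm//.
apply: le_trans (ler_wpM2l _ gn) _ => //.
have M0 : 0 <= M%:R :> R by [].
have e : (4 * c) ^+ M <= (4 * y) ^+ M.
  by apply: lerXn2r; rewrite ?nnegrE; lra.
have e0 : 0 <= (4 * c) ^+ M by apply: exprn_ge0; lra.
rewrite horner_u.
apply: le_trans (_ : 4 * c * (1 - c) * ((4 * M%:R + 2) * (4 * c) ^+ M) <= _).
  rewrite -subr_ge0 (_ : _ - _ =
    2 * c * (1 - 2 * c) * ((4 * M%:R + 2) * (4 * c) ^+ M)); last by ring.
  by rewrite !mulr_ge0//; lra.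
have U0 : 0 <= 4 * c * (1 - c) by nra.
by rewrite !ler_wpM2l//; lra.
Qed.

End log_expansion.

(** * Riemann sums of the powers of 1 - x^2 *)

Section riemann_sums.
Context {R : realType}.

(* The antiderivative of (1 - X^2)^m that vanishes at 0. *)
Fixpoint prim_beta (m : nat) : {poly R} :=
  if m is j.+1 then
    ((2 * j%:R + 3)^-1)%:P *
      ((2 * j%:R + 2)%:P * prim_beta j + 'X * (1 - 'X ^+ 2) ^+ j.+1)
  else 'X.

Lemma prim_betaS m x : (2 * m%:R + 3) * (prim_beta m.+1).[x] =
  (2 * m%:R + 2) * (prim_beta m).[x] + x * (1 - x ^+ 2) ^+ m.+1.
Proof.
rewrite /= !(hornerM, hornerD, hornerC, horner_exp, hornerN, hornerX).
by have m0 : 0 <= m%:R :> R by []; field; lra.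
Qed.

Lemma deriv_prim_beta m : (prim_beta m)^`() = (1 - 'X ^+ 2) ^+ m.
Proof.
elim: m => [|m IH]; first by rewrite derivX expr0.
have m0 : 0 <= m%:R :> R by [].
have c0 : 2 * m%:R + 3 != 0 :> R by apply: lt0r_neq0; lra.
rewrite /= derivM derivC mul0r add0r derivD derivM derivC mul0r add0r IH.
rewrite derivM derivX mul1r deriv_exp derivB derivC sub0r derivXn /=.
have e : ((2 * m%:R + 3)^-1)%:P * (2 * m%:R + 3)%:P = 1 :> {poly R}.
  by rewrite -polyCM mulVf.
transitivity (((2 * m%:R + 3)^-1)%:P * (2 * m%:R + 3)%:P * (1 - 'X ^+ 2) ^+ m.+1 : {poly R});
  last by rewrite e mul1r.
rewrite -mulrA; congr (_ * _).
have -> : (2 * m%:R + 3)%:P = 2 * m%:R + 3 :> {poly R}.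
  by rewrite !(rmorphD, rmorphM, rmorph_nat).
have -> : (2 * m%:R + 2)%:P = 2 * m%:R + 2 :> {poly R}.
  by rewrite !(rmorphD, rmorphM, rmorph_nat).
rewrite [_ ^+ m.+1]exprS -[_ *+ m.+1]mulr_natl -[m.+1%:R]natr1 expr1 -mulNrn.
rewrite mulr2n; ring.
Qed.

Lemma prim_beta0 m : (prim_beta m).[0] = 0.
Proof.
elim: m => [|m IH] /=; first by rewrite hornerX.
by rewrite hornerM hornerD hornerM IH mulr0 add0r hornerM hornerX mul0r mulr0.
Qed.

Lemma prim_beta_lip m (x y : R) : 0 <= x -> x <= y -> y <= 1 ->
  (y - x) * (1 - y ^+ 2) ^+ m <= (prim_beta m).[y] - (prim_beta m).[x] <=
  (y - x) * (1 - x ^+ 2) ^+ m.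
Proof.
move=> x0 xy y1.
have [c] := @MVT_segment _ (horner (prim_beta m)) (horner (prim_beta m)^`()) x y xy
  (fun t _ => is_derive_poly _ t) (continuous_subspaceT (@continuous_horner _ _)).
rewrite in_itv/= deriv_prim_beta => /andP[xc cy] ->.
rewrite horner_exp hornerD hornerN horner_exp hornerX hornerC.
rewrite [X in _ <= X <= _]mulrC.
by apply/andP; split; apply: ler_wpM2l; rewrite ?subr_ge0//;
  apply: lerXn2r; rewrite ?nnegrE; nra.
Qed.

Lemma riemann_prim_beta m n d : (0 < n)%N -> (d <= n)%N ->
  `|\sum_(k < d) (1 - (k%:R / n%:R) ^+ 2) ^+ m - n%:R * (prim_beta m).[d%:R / n%:R]|
  <= 1.
Proof.
move=> n0; have n_gt0 : 0 < n%:R :> R by rewrite ltr0n.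
pose f (x : R) := (1 - x ^+ 2) ^+ m.
have frac k : (k <= n)%N -> 0 <= (k%:R / n%:R : R) <= 1.
  move=> kn; apply/andP; split; first exact: divr_ge0.
  by rewrite ler_pdivrMr// mul1r ler_nat.
have f01 k : (k <= n)%N -> 0 <= f (k%:R / n%:R) <= 1.
  move=> /frac /andP[x0 x1]; rewrite /f exprn_ge0 ?exprn_ile1//; nra.
(* The integrand decreases, so the left sum exceeds the integral by at most f 0 - f (d / n). This
   sharper form telescopes, unlike the bound 1 of the statement, which is f 0. *)
suff H : (d <= n)%N -> n%:R * (prim_beta m).[d%:R / n%:R] <=
    \sum_(k < d) f (k%:R / n%:R) <=
    n%:R * (prim_beta m).[d%:R / n%:R] + 1 - f (d%:R / n%:R).
  move=> dn; have /andP[h1 h2] := H dn; have /andP[h3 h4] := f01 _ dn.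
  by rewrite ler_norml; apply/andP; split; lra.
elim: d => [_|d IH dn].
  by rewrite big_ord0 mul0r prim_beta0 mulr0 lexx/= /f expr0n/= subr0 expr1n; lra.
have /andP[h1 h2] := IH (ltnW dn); rewrite big_ord_recr/=.
have /andP[x0 _] := frac _ (ltnW dn); have /andP[_ y1] := frac _ dn.
have xy : d%:R / n%:R <= d.+1%:R / n%:R :> R.
  by rewrite ler_wpM2r ?invr_ge0// ler_nat.
have /andP[] := prim_beta_lip m x0 xy y1; rewrite -mulrBl -/(f _) -/(f _).
have -> : d.+1%:R - d%:R = 1 :> R by rewrite -natr1; ring.
rewrite mul1r ler_pdivrMl// ler_pdivlMl// => h3 h4.
by apply/andP; split; lra.
Qed.

End riemann_sums.

(** * Ratio asymptotics with errors uniform in n and z *)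

Section ratio_asymptotics.
Context {R : realType}.

Lemma ln_lip1 (x y : R) : 1 <= x -> 1 <= y -> `|ln x - ln y| <= `|x - y|.
Proof.
wlog yx : x y / y <= x.
  by move=> H x1 y1; have [yx|/ltW xy] := leP y x; [|rewrite distrC (distrC x)]; exact: H.
move=> x1 y1; rewrite !ger0_norm ?subr_ge0 ?ler_ln ?posrE//; [|lra..].
rewrite -ln_div ?posrE; [|lra..].
rewrite (_ : x / y = 1 + (x - y) / y); last by field; lra.
have q0 : 0 <= (x - y) / y by rewrite divr_ge0; lra.
apply: le_trans (le_ln1Dx _) _; first by lra.
by rewrite ler_pdivrMr; nra.
Qed.

Variables (n : nat) (z : R).
Hypotheses (n3 : (2 < n)%N) (z2 : 2 <= z).

Let P k := (@gram_poly R n k).[z].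
Let a k := @gram_coef R n k.
Let r k := P k.+1 / P k.
Let b k : R := (1 - (k%:R / n%:R) ^+ 2) / 4.
(** The attracting fixed point of t = z - b_k / t, that is, of the recurrence of the ratios [r] with
    its coefficient frozen at the limiting value b_k. *)
Let tau k : R := (z + Num.sqrt (z ^+ 2 - 4 * b k)) / 2.

Let n_ge3 : 3 <= n%:R :> R. Proof. by rewrite ler_nat. Qed.

Let b_bound k : (k <= n)%N -> 0 <= b k <= 1 / 4.
Proof.
move=> kn; have x0 : 0 <= k%:R / n%:R :> R by rewrite divr_ge0.
have x1 : k%:R / n%:R <= 1 :> R.
  by rewrite ler_pdivrMr ?mul1r ?ler_nat//; have := n_ge3; lra.
rewrite /b; move: (_ / _) x0 x1 => x x0 x1.
have x2 : x ^+ 2 <= 1 by apply: exprn_ile1.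
have := sqr_ge0 x => x20; apply/andP; split; lra.
Qed.

Let tau_props k : (k <= n)%N ->
  [/\ tau k ^+ 2 = z * tau k - b k, 1 <= tau k, z / 2 <= tau k & tau k <= z].
Proof.
move=> kn; have /andP[b0 b1] := b_bound kn.
rewrite /tau; move: (b k) b0 b1 => B b0 b1.
have z4 : 4 <= z ^+ 2 by have := z2; nra.
have d0 : 0 <= z ^+ 2 - 4 * B by lra.
have s2 := sqr_sqrtr d0; have s0 := sqrtr_ge0 (z ^+ 2 - 4 * B).
have z2' := z2; move: (Num.sqrt _) s2 s0 => s s2 s0.
have sz : s <= z by rewrite -ler_sqr ?nnegrE ?s2; lra.
by split; lra.
Qed.

Let tau_le k : (k < n)%N -> tau k <= tau k.+1.
Proof.
move=> kn; have n0 := n_ge3.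
rewrite /tau ler_wpM2r// lerD2l ler_wsqrtr// lerD2l lerN2 ler_wpM2l//.
rewrite /b ler_wpM2r// lerD2l lerN2; apply: lerXn2r; rewrite ?nnegrE ?divr_ge0//.
by rewrite ler_wpM2r ?invr_ge0// ler_nat.
Qed.

Let r_ge1 k : (k < n)%N -> 1 <= r k.
Proof.
move=> kn; have [p0 p1 _] := gram_poly_growth n3 z2 kn.
by rewrite /r ler_pdivlMr ?mul1r.
Qed.

Let rS k : (k.+1 < n)%N -> r k.+1 = z - a k.+1 / r k.
Proof.
move=> kn; have [p0 _ _] := gram_poly_growth n3 z2 (ltnW kn).
have [p1 _ _] := gram_poly_growth n3 z2 kn.
rewrite /r /P {1}/gram_poly horner_monic_opSS -/(gram_poly n k.+1) -/(gram_poly n k).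
by rewrite /a; field; rewrite !lt0r_neq0.
Qed.

(** The bound is shaped to have a sum below 3 over k < n. Its telescoping part comes from replacing
    k^2 / (4 k^2 - 1) by 1/4, the 1 / n from replacing (n - 1)^2 by n^2. *)
Let ab k : (0 < k < n)%N ->
  `|b k - a k| <= 2 * (k%:R^-1 - k.+1%:R^-1) + n%:R^-1.
Proof.
move=> /andP[k0 kn]; have n0 := n_ge3.
have k1 : 1 <= k%:R :> R by rewrite ler1n.
have kn' : k%:R < n%:R :> R by rewrite ltr_nat.
rewrite /b /a gram_coefE// -[k.+1%:R]natr1.
move: (n%:R : R) (k%:R : R) n0 k1 kn' => N K N3 K1 KN.
have K2 : 1 <= K ^+ 2 by nra.
have D : 0 < 4 * K ^+ 2 - 1 by lra.
have N1 : 0 < (N - 1) ^+ 2 by rewrite exprn_gt0//; lra.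
have -> : (1 - (K / N) ^+ 2) / 4 -
    K ^+ 2 / (4 * K ^+ 2 - 1) * (N ^+ 2 - K ^+ 2) / (N - 1) ^+ 2 =
    - ((N ^+ 2 - K ^+ 2) / (N - 1) ^+ 2 / (4 * (4 * K ^+ 2 - 1))
    + (N ^+ 2 - K ^+ 2) / N ^+ 2 * ((2 * N - 1) / (4 * (N - 1) ^+ 2))).
  by field; rewrite !lt0r_neq0//; lra.
have nk0 : 0 <= N ^+ 2 - K ^+ 2 by nra.
have t1 : (N ^+ 2 - K ^+ 2) / (N - 1) ^+ 2 <= 9 / 4.
  by rewrite ler_pdivrMr//; nra.
have t1' : 0 <= (N ^+ 2 - K ^+ 2) / (N - 1) ^+ 2 by rewrite divr_ge0// ltW.
have t2 : (N ^+ 2 - K ^+ 2) / N ^+ 2 <= 1.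
  by rewrite ler_pdivrMr ?exprn_gt0//; [nra|lra].
have t2' : 0 <= (N ^+ 2 - K ^+ 2) / N ^+ 2 by rewrite divr_ge0// sqr_ge0.
have t3 : (2 * N - 1) / (4 * (N - 1) ^+ 2) <= N^-1.
  rewrite -subr_ge0 (_ : _ - _ =
    (4 * (N - 1) ^+ 2 - N * (2 * N - 1)) / (4 * (N - 1) ^+ 2 * N)).
    by rewrite divr_ge0//; [nra|rewrite !mulr_ge0//; lra].
  by field; rewrite !lt0r_neq0//; lra.
have t3' : 0 <= (2 * N - 1) / (4 * (N - 1) ^+ 2).
  by rewrite divr_ge0//; [lra|rewrite mulr_ge0// ltW].
have t4 : (4 * (4 * K ^+ 2 - 1))^-1 <= 8 / 9 * (K^-1 - (K + 1)^-1).
  rewrite (_ : K^-1 - _ = (K * (K + 1))^-1); last by field; rewrite !lt0r_neq0; lra.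
  have K0 : 0 < K * (K + 1) by nra.
  by rewrite ler_pdivlMr// ler_pdivrMl ?mulr_gt0//; nra.
have t5 : 0 <= (4 * (4 * K ^+ 2 - 1))^-1 by rewrite invr_ge0; lra.
rewrite normrN ger0_norm; last by rewrite addr_ge0// mulr_ge0.
apply: lerD.
  apply: le_trans (ler_pM t1' t5 t1 t4) _.
  by rewrite mulrA (_ : 9 / 4 * (8 / 9) = 2)//; field.
by rewrite -[leRHS]mul1r ler_pM.
Qed.

(** One step of the recurrence contracts the error by 1/4, since b <= 1/4 and r, tau >= 1. The drift
    of the fixed point telescopes because [tau] increases, and the coefficient errors telescope by
    [ab]. The extra quarter of the last error is what the next step consumes. *)
Let sum_ratio k : (k < n)%N ->
  3 / 4 * \sum_(j < k.+1) `|r j - tau j| + 4^-1 * `|r k - tau k| <=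
  `|r 0 - tau 0| + 4^-1 * (tau k - tau 0) + 2 * (1 - k.+1%:R^-1) + k%:R / n%:R.
Proof.
elim: k => [|k IH] kn.
  by rewrite big_ord1 subrr mulr0 mul0r invr1 subrr mulr0 !addr0; lra.
rewrite big_ord_recr/=; have {IH} := IH (ltnW kn).
have [tS t1 _ _] := tau_props (ltnW kn).
have tle := tau_le (ltnW kn); have r1 := r_ge1 (ltnW kn).
have /andP[b0 b1] := b_bound (ltnW kn).
have rSk := rS kn; have abk := @ab k.+1 kn.
clearbody r tau b a.
have ee : `|r k.+1 - tau k.+1| <=
    4^-1 * (`|r k - tau k| + (tau k.+1 - tau k)) + `|b k.+1 - a k.+1|.
  have -> : r k.+1 - tau k.+1 =
      b k.+1 * ((r k - tau k.+1) / (tau k.+1 * r k)) + (b k.+1 - a k.+1) / r k.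
    rewrite rSk (_ : b k.+1 = z * tau k.+1 - tau k.+1 ^+ 2); last by rewrite tS; ring.
    by field; rewrite !lt0r_neq0//; lra.
  apply: le_trans (ler_normD _ _) _; apply: lerD; rewrite !normrM !normfV.
    have Tr : 1 <= tau k.+1 * r k by nra.
    rewrite (ger0_norm b0) (ger0_norm (le_trans ler01 Tr)).
    apply: ler_pM => //; first by rewrite divr_ge0//; lra.
      by lra.
    rewrite ler_pdivrMr; last by lra.
    apply: le_trans (_ : `|r k - tau k| + (tau k.+1 - tau k) <= _).
      rewrite (_ : r k - tau k.+1 = (r k - tau k) - (tau k.+1 - tau k)); last by ring.
      apply: le_trans (ler_normB _ _) _.
      by rewrite lerD2l ger0_norm// subr_ge0.
    by rewrite ler_peMr// addr_ge0// subr_ge0.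
  rewrite (ger0_norm (le_trans ler01 r1)) ler_pdivrMr; last by lra.
  by rewrite ler_peMr.
have -> : k.+1%:R / n%:R = k%:R / n%:R + n%:R^-1 :> R.
  by rewrite -natr1 mulrDl mul1r.
move: (k.+1%:R^-1 : R) (k.+2%:R^-1 : R) (k%:R / n%:R : R) (n%:R^-1 : R) abk.
move=> A B C D abk prev; lra.
Qed.

Let sum_ratio_le d : (d <= n)%N -> \sum_(k < d) `|r k - tau k| <= 6.
Proof.
case: d => [|d] dn; first by rewrite big_ord0.
have sr := sum_ratio dn; have [_ _ _ td] := tau_props (ltnW dn).
have [t0 t1 _ tz] := tau_props (leq0n n); have /andP[b0 b1] := b_bound (leq0n n).
have r0 : r 0 = z.
  by rewrite /r /P /gram_poly monic_op0 monic_op1 hornerX hornerC divr1.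
have zt : z - tau 0 <= 1 / 4.
  have : tau 0 * (z - tau 0) = b 0 by rewrite mulrBr -expr2 t0; ring.
  by nra.
have e0 : `|r 0 - tau 0| <= 1 / 4 by rewrite r0 ger0_norm; lra.
have d0 : 0 <= d.+1%:R^-1 :> R by rewrite invr_ge0.
have d1 : d%:R / n%:R <= 1 :> R.
  by rewrite ler_pdivrMr ?mul1r ?ler_nat 1?ltnW//; have := n_ge3; lra.
have ed := normr_ge0 (r d - tau d).
move: (d.+1%:R^-1 : R) (d%:R / n%:R : R) d0 d1 sr => A B d0 d1 sr; lra.
Qed.

Let ln_gram_poly d : (d < n)%N -> ln (P d) = \sum_(k < d) ln (r k).
Proof.
elim: d => [|d IH] dn; first by rewrite big_ord0 /P /gram_poly monic_op0 hornerC ln1.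
rewrite big_ord_recr/= -IH ?(ltnW dn)//.
have [p0 _ _] := gram_poly_growth n3 z2 (ltnW dn).
have [p1 _ _] := gram_poly_growth n3 z2 dn.
by rewrite /r ln_div ?posrE// addrC subrK.
Qed.

Let ln_tau M k : (k <= n)%N ->
  `|ln (tau k) - ln z + \sum_(m < M) wallis m.+1 / (2 * m.+1%:R) *
     ((1 - (k%:R / n%:R) ^+ 2) ^+ m.+1 / z ^+ (2 * m.+1))|
  <= (4 * M%:R + 2) * 2 ^+ M / z ^+ (2 * M.+1).
Proof.
move=> kn; have [tS t1 tz2 tz] := tau_props kn; have /andP[b0 b1] := b_bound kn.
have z0 : 0 < z by have := z2; lra.
(* In terms of this y the quadratic equation of tau reads 4 y (1 - y) = (1 - (k / n)^2) / z^2, which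
   is the variable of [ln_wallis_expansion]. *)
pose y := 1 - tau k / z.
have ty : tau k / z = 1 - y by rewrite /y; ring.
have y4 : 4 * y * (1 - y) = (1 - (k%:R / n%:R) ^+ 2) / z ^+ 2.
  rewrite -ty /y (_ : 1 - (k%:R / n%:R) ^+ 2 = 4 * b k);
    last by rewrite /b [RHS]mulrC divfK.
  rewrite (_ : 4 * _ * _ = 4 * (z * tau k - tau k ^+ 2) / z ^+ 2); last first.
    by field; exact: lt0r_neq0.
  by rewrite tS; ring.
have y0 : 0 <= y by rewrite /y subr_ge0 ler_pdivrMr// mul1r.
have y2 : y <= 2^-1.
  have : 1 / 2 <= tau k / z by rewrite ler_pdivlMr//; lra.
  by rewrite /y; lra.
have yz : y <= 2^-1 / z ^+ 2.
  have e : 4 * y * (1 - y) * z ^+ 2 = 4 * b k.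
    by rewrite y4 divfK ?expf_neq0 ?lt0r_neq0// /b [RHS]mulrC divfK.
  rewrite ler_pdivlMr ?exprn_gt0//.
  have zz := exprn_gt0 2 z0; nra.
have := @ln_wallis_expansion R M y; rewrite y0 y2 => /(_ isT).
rewrite y4 -ty ln_div ?posrE//; last by lra.
move=> H.
rewrite -normrN; apply: le_trans (_ : _ <= (4 * M%:R + 2) * (4 * y) ^+ M * y) _.
  apply: le_trans H; rewrite le_eqVlt; apply/orP; left; apply/eqP; congr `|_|.
  rewrite opprD; congr (_ - _).
  by apply: eq_bigr => m _; rewrite (expr_div_n _ _ m.+1) -exprM.
have M0 : 0 <= M%:R :> R by [].
rewrite -!mulrA; apply: ler_wpM2l; first by lra.
apply: le_trans (_ : (2 / z ^+ 2) ^+ M * (2^-1 / z ^+ 2) <= _).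
  have zz := exprn_gt0 2 z0.
  apply: ler_pM => //; first by apply: exprn_ge0; lra.
  apply: lerXn2r; rewrite ?nnegrE; [lra|by rewrite divr_ge0// ltW|].
  by apply: le_trans (_ : 4 * (2^-1 / z ^+ 2) <= _); [lra|rewrite mulrA; lra].
have := exprn_gt0 2 z0; rewrite exprM; move: (z ^+ 2) => X X0.
rewrite expr_div_n exprSr -subr_ge0 (_ : _ - _ = 2 ^+ M / (X ^+ M * X) / 2).
  by rewrite !divr_ge0 ?exprn_ge0// mulr_ge0 ?exprn_ge0 ?ltW.
by field; rewrite expf_neq0 lt0r_neq0.
Qed.

(** The constant 6 pays for replacing the ratios by [tau]. Each of the M Riemann sums is off by at
    most 2, one for the sum and one for d / n against alpha, with a weight of at most 1/2. The last
    term is the truncation error of at most n logarithms. *)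
Lemma ln_gram_poly_asymptotics (alpha : R) (d M : nat) :
  0 <= alpha <= 1 -> (d < n)%N -> `|d%:R - n%:R * alpha| <= 1 ->
  `|ln (gram_poly n d).[z] - d%:R * ln z + n%:R * \sum_(m < M)
     wallis m.+1 / (2 * m.+1%:R) * ((prim_beta m.+1).[alpha] / z ^+ (2 * m.+1))|
  <= 6 + M%:R + (4 * M%:R + 2) * 2 ^+ M * (n%:R / z ^+ (2 * M.+1)).
Proof.
move=> /andP[a0 a1] dn da; have n0 : 0 < n%:R :> R by have := n_ge3; lra.
have z0 : 0 < z by have := z2; lra.
pose c m : R := wallis m.+1 / (2 * m.+1%:R).
have c01 m : 0 <= c m <= 1 / 2.
  have m1 : 1 <= m.+1%:R :> R by rewrite ler1n.
  have w0 := wallis_gt0 (R := R) m.+1; have w1 := wallis_le1 (R := R) m.+1.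
  rewrite /c; apply/andP; split; first by rewrite divr_ge0//; lra.
  by rewrite ler_pdivrMr; lra.
pose S k m : R := (1 - (k%:R / n%:R) ^+ 2) ^+ m.+1.
pose I m : R := (prim_beta m.+1).[alpha].
have riem m : `|n%:R * I m - \sum_(k < d) S k m| <= 2.
  have h1 := riemann_prim_beta (R := R) m.+1 (ltnW (ltnW n3)) (ltnW dn).
  suff h2 : `|n%:R * I m - n%:R * (prim_beta m.+1).[d%:R / n%:R]| <= 1.
    apply: le_trans (ler_distD (n%:R * (prim_beta m.+1).[d%:R / n%:R]) _ _) _.
    by rewrite [X in _ + X <= _]distrC; lra.
  have lip x y : 0 <= x -> x <= y -> y <= 1 ->
      `|(prim_beta m.+1).[y] - (prim_beta m.+1).[x]| <= y - x.
    move=> x0 xy y1; have /andP[l1 l2] := prim_beta_lip m.+1 x0 xy y1.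
    have f0 : 0 <= (1 - y ^+ 2) ^+ m.+1 by apply: exprn_ge0; nra.
    have f1 : (1 - x ^+ 2) ^+ m.+1 <= 1 by apply: exprn_ile1; nra.
    by rewrite ger0_norm; nra.
  rewrite -mulrBr normrM (gtr0_norm n0).
  have dn1 : d%:R / n%:R <= 1 :> R by rewrite ler_pdivrMr// mul1r ler_nat ltnW.
  have dn0 : 0 <= d%:R / n%:R :> R by rewrite divr_ge0// ltW.
  have dE : d%:R = n%:R * (d%:R / n%:R) :> R by rewrite mulrC divfK ?lt0r_neq0.
  move: da; rewrite {1}dE -mulrBr normrM (gtr0_norm n0).
  move: (d%:R / n%:R) dn0 dn1 => x x0 x1; apply: le_trans.
  rewrite ler_wpM2l ?(ltW n0)//.
  have [ax|/ltW xa] := leP alpha x.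
    by rewrite distrC (ger0_norm (_ : 0 <= x - alpha)) ?subr_ge0// lip.
  by rewrite (distrC x) (ger0_norm (_ : 0 <= alpha - x)) ?subr_ge0// lip.
have H1 : `|ln (P d) - \sum_(k < d) ln (tau k)| <= 6.
  rewrite ln_gram_poly// -sumrB; apply: le_trans (ler_norm_sum _ _ _) _.
  apply: le_trans (sum_ratio_le (ltnW dn)); apply: ler_sum => k _.
  have kn : (k < n)%N := ltn_trans (ltn_ord k) dn.
  by apply: ln_lip1; [exact: r_ge1|have [] := tau_props (ltnW kn)].
have H2 : `|\sum_(k < d) ln (tau k) - d%:R * ln z + \sum_(m < M)
    c m * ((\sum_(k < d) S k m) / z ^+ (2 * m.+1))| <=
    n%:R * ((4 * M%:R + 2) * 2 ^+ M / z ^+ (2 * M.+1)).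
  rewrite (_ : _ + _ = \sum_(k < d) (ln (tau k) - ln z + \sum_(m < M) c m *
     ((1 - (k%:R / n%:R) ^+ 2) ^+ m.+1 / z ^+ (2 * m.+1)))); last first.
    rewrite !big_split/= sumr_const card_ord mulNrn mulr_natl.
    congr (_ + _).
    rewrite exchange_big/=; apply: eq_bigr => m _.
    by rewrite mulr_suml mulr_sumr.
  apply: le_trans (ler_norm_sum _ _ _) _.
  apply: le_trans (_ : \sum_(k < d) ((4 * M%:R + 2) * 2 ^+ M / z ^+ (2 * M.+1)) <= _).
    by apply: ler_sum => k _; apply: ln_tau; rewrite ltnW// (ltn_trans _ dn).
  rewrite sumr_const card_ord -(mulr_natl _ d) ler_wpM2r// ?ler_nat ?(ltnW dn)//.
  by rewrite divr_ge0 ?exprn_ge0 ?(ltW z0)// mulr_ge0 ?exprn_ge0.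
have H3 : `|\sum_(m < M) c m * ((n%:R * I m - \sum_(k < d) S k m) / z ^+ (2 * m.+1))|
    <= M%:R.
  apply: le_trans (ler_norm_sum _ _ _) _.
  rewrite -[leRHS]mulr1 -[M in leRHS]card_ord mulr_natl -sumr_const.
  apply: ler_sum => m _; have /andP[c0 c1] := c01 m.
  have zm : 1 <= z ^+ (2 * m.+1) by apply: exprn_ege1; have := z2; lra.
  rewrite (normrM (c m)) (ger0_norm c0) normf_div (ger0_norm (le_trans ler01 zm)).
  have rm := riem m.
  apply: le_trans (_ : 1 / 2 * 2 <= _); last by lra.
  apply: ler_pM => //; first by rewrite divr_ge0//; lra.
  by rewrite ler_pdivrMr; lra.
rewrite -/(P d) mulr_sumr.
have -> : \sum_(m < M) n%:R * (c m * (I m / z ^+ (2 * m.+1))) =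
    \sum_(m < M) c m * ((\sum_(k < d) S k m) / z ^+ (2 * m.+1)) +
    \sum_(m < M) c m * ((n%:R * I m - \sum_(k < d) S k m) / z ^+ (2 * m.+1)).
  by rewrite -big_split/=; apply: eq_bigr => m _; ring.
have split4 A T L B C : A - L + (B + C) = (A - T) + (T - L + B) + C :> R by ring.
rewrite (split4 _ (\sum_(k < d) ln (tau k))).
apply: le_trans (ler_normD _ _) _; apply: le_trans (lerD (ler_normD _ _) H3) _.
rewrite (mulrC n%:R) -!mulrA in H2.
rewrite -!mulrA; lra.
Qed.

End ratio_asymptotics.

(** * Structure of extremal polynomials *)

Section alternation.
Context {R : realType}.
Implicit Types (sigma : R -> R) (s p q u : {poly R}) (a l : seq R).

Definition alternates sigma a := sorted (fun x y => sigma x * sigma y < 0) a.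

(* A sign pattern on finitely many points either has a long alternating
   subsequence or is realised by a polynomial of small degree. *)
Lemma alternating_subseq_poly sigma l : sorted <%R l -> l != [::] ->
    {in l, forall x, sigma x != 0} ->
  exists a s, [/\ subseq a l, alternates sigma a, size s = size a,
    {in l, forall x, 0 < s.[x] * sigma x} & a != [::]].
Proof.
case: l => // h l sl _ s0.
(* The induction runs from right to left and must also carry that [a] starts with the sign of the
   leftmost point and that s keeps this sign everywhere to its left. A new leftmost point of the
   same sign then changes nothing, and one of opposite sign costs one linear factor and lengthens
   [a] by one. *)
suff [a [s [? ? ? ? [_ [? _]]]]] : exists a s, [/\ subseq a (h :: l),
    alternates sigma a, size s = size a,
    {in h :: l, forall x, 0 < s.[x] * sigma x} &
    0 < sigma (head 0 a) * sigma h /\ a != [::] /\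
    forall y, y <= h -> 0 < s.[y] * sigma h].
  by exists a, s.
elim: l h sl s0 => [|h' l IH] h sl s0.
  have sh : sigma h != 0 by rewrite s0 ?mem_head.
  have sq : 0 < sigma h * sigma h by rewrite -expr2 exprn_even_gt0.
  exists [:: h], (sigma h)%:P; rewrite subseq_refl size_polyC sh; split => //.
    by move=> x; rewrite inE => /eqP->; rewrite hornerC.
  by split=> //; split=> // y _; rewrite hornerC.
have hh' : h < h' by case/andP: sl.
have [||a [s [sub alt sz pos [hd [a0 left]]]]] := IH h'.
- by case/andP: sl.
- by move=> x xl; rewrite s0// inE xl orbT.
have sh : sigma h != 0 by rewrite s0 ?mem_head.
have sh' : sigma h' != 0 by rewrite s0 ?inE ?eqxx ?orbT.
have [same|opp] := ltP 0 (sigma h * sigma h').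
  have key y : 0 < y * sigma h' -> 0 < y * sigma h.
    move=> yh'; have : 0 < (y * sigma h') * (sigma h * sigma h').
      by rewrite mulr_gt0.
    rewrite (_ : _ * _ = y * sigma h * (sigma h' ^+ 2)); last by ring.
    by rewrite pmulr_lgt0// exprn_even_gt0.
  exists a, s; split => //.
  - exact: subseq_trans sub (subseq_cons _ _).
  - move=> x; rewrite inE => /orP[/eqP->|]; last exact: pos.
    by apply/key/left/ltW.
  - split; first exact: key.
    by split=> // y yh; apply/key/left; rewrite (le_trans yh)// ltW.
have {}opp : sigma h * sigma h' < 0 by rewrite lt_neqAle mulf_neq0.
have key y : 0 < y * sigma h' -> y * sigma h < 0.
  move=> yh'; have : (y * sigma h') * (sigma h * sigma h') < 0.
    by rewrite pmulr_rlt0.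
  rewrite (_ : _ * _ = y * sigma h * (sigma h' ^+ 2)); last by ring.
  by rewrite pmulr_llt0// exprn_even_gt0.
pose c := (h + h') / 2.
have [ch ch'] : h < c /\ c < h' by rewrite /c; split; lra.
exists (h :: a), (s * ('X - c%:P)).
have hc y : (s * ('X - c%:P)).[y] = s.[y] * (y - c).
  by rewrite hornerM hornerXsubC.
have leftpos y : y <= h -> 0 < (s * ('X - c%:P)).[y] * sigma h.
  move=> yh; rewrite hc mulrAC nmulr_rgt0; last by apply/key/left; lra.
  by lra.
split.
- by rewrite /= eqxx.
- case: a a0 sub alt sz hd => // x a _ _ alt _ /= hd.
  by rewrite /alternates /= mulrC key.
- rewrite size_Mmonic ?monicXsubC// ?size_XsubC ?addn2/= ?sz//.
  by rewrite -size_poly_gt0 sz; case: (a) a0.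
- move=> x; rewrite inE => /orP[/eqP->|xl]; first exact: leftpos.
  rewrite hc mulrAC mulr_gt0 ?pos// subr_gt0 (lt_le_trans ch')//.
  move: xl; rewrite inE => /orP[/eqP->//|xl].
  have /andP[_ pl] := sl.
  by have /allP/(_ _ xl)/ltW := order_path_min lt_trans pl.
- by split; [rewrite /= -expr2 exprn_even_gt0|].
Qed.

Lemma alternation_roots p a x : sorted <%R (x :: a) ->
    alternates (horner p) (x :: a) ->
  exists rs, [/\ size rs = size a, sorted <%R rs,
    all (root p) rs & all (fun r => x < r < last x a) rs].
Proof.
elim: a x => [|y a IH] x /=; first by exists [::].
move=> /andP[xy sa] /andP[pxy alt].
have [rs [sz srt rt bd]] := IH y sa alt.
have [r rxy pr] : exists2 r, x < r < y & root p r.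
  have ivt (q : {poly R}) : q.[x] <= 0 <= q.[y] -> exists2 r, x <= r <= y & root q r.
    exact: poly_ivt (ltW xy).
  have [r /andP[xr ry] rr] : exists2 r, x <= r <= y & root p r.
    have [px|px] := leP p.[x] 0.
      have px0 : p.[x] < 0.
        by rewrite lt_neqAle px andbT; apply/eqP => e; move: pxy; rewrite e mul0r ltxx.
      by apply: ivt; rewrite px ltW// -(nmulr_rlt0 _ px0).
    have [|r xr] := ivt (- p); last by rewrite rootN; exists r.
    by rewrite !hornerN !oppr_le0 oppr_ge0 (ltW px)/= ltW// -(pmulr_rlt0 _ px).
  exists r => //; move/rootP: rr => rr.
  rewrite !lt_neqAle xr ry !andbT; apply/andP; split; apply/eqP => e.
    by move: pxy; rewrite e rr mul0r ltxx.
  by move: pxy; rewrite -e rr mulr0 ltxx.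
exists (r :: rs); rewrite /= sz pr rt; split => //.
  case: rs sz srt rt bd => //= b rs _ -> _ /andP[/andP[yb _] _].
  by rewrite andbT (lt_trans _ yb)//; case/andP: rxy.
have yl : y <= last y a.
  have [->//|] : a = [::] \/ y < last y a.
    case: (a) sa => [|b a']; [by left|right].
    have /allP := order_path_min lt_trans sa.
    by apply; rewrite /= mem_last.
  exact: ltW.
have /andP[xr ry] := rxy; rewrite xr (lt_le_trans ry yl)/=.
by apply: sub_all bd => t /andP[yt ->]; rewrite (lt_trans xy yt).
Qed.

End alternation.

(** * Perturbation of a real polynomial that is optimal at a point off the grid *)

Section optimal_polynomial.
Context {R : realType} (t : nat -> R) (n d : nat) (u : {poly R}) (x0 : R).
Hypothesis t_incr : forall i j, (i < j)%N -> t i < t j.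
Hypothesis t_bound : forall i, (i < n)%N -> -1 <= t i <= 1.
Hypothesis size_u : (size u <= d.+1)%N.
Hypothesis u_le1 : forall i, (i < n)%N -> `|u.[t i]| <= 1.

Lemma uniform_small_step (P : nat -> R -> Prop) m :
    (forall i, (i < m)%N -> exists2 e, 0 < e & forall x, 0 < x < e -> P i x) ->
  exists2 e, 0 < e & forall i, (i < m)%N -> P i e.
Proof.
move=> H; suff [e e0 He] : exists2 e, 0 < e &
    forall i, (i < m)%N -> forall x, 0 < x < e -> P i x.
  by exists (e / 2) => [|i im]; [|apply: (He i im)]; lra.
elim: m H => [|m IH] H; first by exists 1.
have [e e0 He] := IH (fun i im => H i (ltnW im)).
have [e' e0' He'] := H m (ltnSn m).
exists (Num.min e e') => [|i]; first by rewrite lt_min e0.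
rewrite ltnS leq_eqVlt => /orP[/eqP->|im] x; rewrite lt_min => /and3P[x0' xe xe'].
  by apply: He'; rewrite x0'.
by apply: (He i im); rewrite x0'.
Qed.

Lemma uniform_lt1 (f : nat -> R) m : (forall i, (i < m)%N -> f i < 1) ->
  exists2 rho, rho < 1 & forall i, (i < m)%N -> f i <= rho.
Proof.
elim: m => [|m IH] H; first by exists 0.
have [r r1 Hr] := IH (fun i im => H i (ltnW im)).
exists (Num.max r (f m)) => [|i]; first by rewrite gt_max r1 H.
rewrite ltnS leq_eqVlt le_max => /orP[/eqP->|im]; first by rewrite lexx orbT.
by rewrite Hr.
Qed.

Section alternation_nodes.
Hypothesis u_x0 : 0 < u.[x0].
Hypothesis x0_notin : forall i, (i < n)%N -> x0 != t i.
Hypothesis optimal : forall (q : {poly R}) (rho : R), (size q <= d.+1)%N ->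
  (forall i, (i < n)%N -> `|q.[t i]| <= rho) -> q.[x0] <= rho * u.[x0].

(** Otherwise u - e q, for small e > 0, would stay strictly below 1 on the grid while keeping the
    value of u at x0, against optimality. At a node with |u| = 1 this works as long as e q^2 < q u;
    at the other nodes there is room. *)
Let no_descent_direction (q : {poly R}) : (size q <= d.+1)%N -> q.[x0] = 0 ->
  ~ (forall i, (i < n)%N -> `|u.[t i]| = 1 -> 0 < q.[t i] * u.[t i]).
Proof.
move=> sq qx0 H.
have [|e e0 He] :=
    @uniform_small_step (fun i (e : R) => `|u.[t i] - e * q.[t i]| < 1) n.
  move=> i im; have [u1|u1] := eqVneq `|u.[t i]| 1.
    have uq := H i im u1.
    have q0 : 0 < q.[t i] ^+ 2.
      by rewrite exprn_even_gt0//=; apply/eqP => q0; move: uq; rewrite q0 mul0r ltxx.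
    exists (q.[t i] * u.[t i] / q.[t i] ^+ 2); first by rewrite divr_gt0.
    move=> e /andP[e0]; rewrite ltr_pdivlMr// => ee.
    have u2 : u.[t i] ^+ 2 = 1 by rewrite -real_normK ?num_real// u1 expr1n.
    rewrite -(@expr_lt1 _ 2)// real_normK ?num_real//.
    have -> : (u.[t i] - e * q.[t i]) ^+ 2 =
      u.[t i] ^+ 2 - e * (2 * (q.[t i] * u.[t i]) - e * q.[t i] ^+ 2) by ring.
    by rewrite u2 ltrBlDr ltrDl mulr_gt0//; lra.
  have {}u1 : `|u.[t i]| < 1 by rewrite lt_neqAle u1 u_le1.
  have q0 := normr_ge0 q.[t i].
  exists ((1 - `|u.[t i]|) / (1 + `|q.[t i]|)); first by rewrite divr_gt0; lra.
  move=> e /andP[e0]; rewrite ltr_pdivlMr; last by lra.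
  move=> ee; apply: le_lt_trans (ler_normB _ _) _.
  by rewrite normrM (gtr0_norm e0); lra.
have [rho rho1 Hrho] := @uniform_lt1 (fun i => `|u.[t i] - e * q.[t i]|) n He.
have sv : (size (u - e *: q)%R <= d.+1)%N.
  rewrite (leq_trans (size_polyD _ _))// geq_max size_u size_polyN.
  by rewrite (leq_trans (size_scale_leq _ _)).
have vr i : (i < n)%N -> `|(u - e *: q).[t i]| <= rho.
  by move=> im; rewrite !hornerE Hrho.
have := optimal sv vr; rewrite !hornerE qx0 mulr0 subr0; apply/negP.
by rewrite -ltNge gtr_pMl.
Qed.

(** If the pattern of u(x) (x - x0) on the nodes with |u| = 1 alternated at most d times, a
    polynomial s of degree below d would realise it, and (X - x0) s, of degree at most d and zero at
    x0, would be a descent direction. *)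
Lemma optimal_alternation : exists a : seq R,
  [/\ size a = d.+1, sorted <%R a,
      {in a, forall x, exists2 i, (i < n)%N & x = t i},
      {in a, forall x, `|u.[x]| = 1} &
      alternates (fun x => u.[x] * (x - x0)) a].
Proof.
pose l := [seq x <- [seq t i | i <- iota 0 n] | `|u.[x]| == 1].
have lP x : x \in l -> (exists2 i, (i < n)%N & x = t i) /\ `|u.[x]| = 1.
  rewrite mem_filter => /andP[/eqP u1 xl]; have [j] := mapP xl.
  by rewrite mem_iota add0n => /andP[_ im] xe; split => //; exists j.
have lM i : (i < n)%N -> `|u.[t i]| = 1 -> t i \in l.
  move=> im u1; rewrite mem_filter u1 eqxx/=; apply/mapP; exists i => //.
  by rewrite mem_iota.
have sl : sorted <%R l.
  apply: sorted_filter; first exact: lt_trans.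
  rewrite sorted_map; apply: sub_sorted (iota_ltn_sorted 0 n).
  by move=> i j /t_incr.
have l0 : l != [::].
  apply/eqP => l0; apply: (@no_descent_direction 0); rewrite ?size_poly0 ?horner0//.
  by move=> i im /(lM i im); rewrite l0.
have [|a [s [sub alt sz pos a0]]] := alternating_subseq_poly sl l0
    (sigma := fun x => u.[x] * (x - x0)).
  move=> x /lP[[i im ->] u1]; rewrite mulf_neq0//.
    by rewrite -normr_eq0 u1 oner_eq0.
  by rewrite subr_eq0 eq_sym x0_notin.
have [sad|sad] := leqP (size a) d.
  exfalso; apply: (@no_descent_direction (('X - x0%:P) * s)).
  - rewrite (leq_trans (size_polyMleq _ _))// size_XsubC sz/=.
    by rewrite ltnS.
  - by rewrite hornerM hornerXsubC subrr mul0r.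
  - move=> i im u1; have := pos _ (lM i im u1).
    by rewrite hornerM hornerXsubC; congr (_ < _); ring.
exists (take d.+1 a); split.
- by rewrite size_takel.
- by apply: take_sorted; apply: subseq_sorted sub sl; exact: lt_trans.
- by move=> x /mem_take /(mem_subseq sub) /lP[].
- by move=> x /mem_take /(mem_subseq sub) /lP[].
- exact: take_sorted.
Qed.

End alternation_nodes.

Lemma same_sign_product (a b v w x y : R) :
  a * x * (b * y) < 0 -> 0 < v * a -> 0 < w * b -> x * v * (y * w) < 0.
Proof.
move=> h va wb; have : a * x * (b * y) * ((v * a) * (w * b)) < 0.
  by rewrite nmulr_rlt0// mulr_gt0.
rewrite (_ : _ * _ = x * v * (y * w) * (a * b) ^+ 2); last by ring.
rewrite pmulr_llt0// exprn_even_gt0//=; apply/eqP => ab0; move: h.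
by rewrite mulrACA ab0 mul0r ltxx.
Qed.

Section domination.
Variable a : seq R.
Hypothesis size_a : size a = d.+1.
Hypothesis sorted_a : sorted <%R a.
Hypothesis a_node : {in a, forall x, exists2 i, (i < n)%N & x = t i}.
Hypothesis u_a : {in a, forall x, `|u.[x]| = 1}.
Hypothesis x0_notin_grid : forall i, (i < n)%N -> x0 != t i.
Hypothesis alt_a : alternates (fun x => u.[x] * (x - x0)) a.

Let b := last 0 a.
Let kappa := u`_d * (u.[b] * (b - x0)).

Let b_in : b \in a.
Proof. by rewrite /b; case: a size_a => //= x s _; exact: mem_last. Qed.

(** At the nodes of [a] the perturbation is smaller than |u| = 1, so the signs and the alternation
    survive, and each of the d gaps contains a root. *)
Let perturb_roots (lam : R) (q : {poly R}) : `|lam| < 1 ->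
    (forall i, (i < n)%N -> `|q.[t i]| <= 1) ->
  [/\ forall x, x \in a -> 0 < (u - lam *: q).[x] * u.[x] &
  exists rs, [/\ size rs = d, uniq rs,
    all (root (('X - x0%:P) * (u - lam *: q))) rs &
    all (fun r => -1 < r < b) rs]].
Proof.
move=> lam1 q1; pose U := ('X - x0%:P) * (u - lam *: q).
have same x : x \in a -> 0 < (u - lam *: q).[x] * u.[x].
  move=> xa; have [i im xi] := a_node xa; have ux := u_a xa.
  have lq : `|lam * q.[x]| < 1.
    by rewrite normrM xi (le_lt_trans _ lam1)// ler_piMr// q1.
  rewrite hornerD hornerN hornerZ mulrBl -expr2 -real_normK ?num_real// ux expr1n.
  rewrite subr_gt0 (le_lt_trans (ler_norm _))// normrM ux mulr1//.
split=> //.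
have altU : alternates (horner U) a.
  move: alt_a; rewrite /alternates; apply: (@sub_in_sorted _ (mem a)); last exact/allP.
  move=> x y xa ya xy; rewrite /U !hornerM !hornerXsubC.
  exact: same_sign_product xy (same x xa) (same y ya).
have a_ge x : x \in a -> -1 <= x.
  by move=> /a_node[i im ->]; case/andP: (t_bound im).
rewrite /b; move: sorted_a altU a_ge size_a.
case: a => // x a' sa altU a_ge [sz].
have [rs [szr srt rt bd]] := alternation_roots sa altU.
exists rs; rewrite szr sz; split => //.
  exact: sorted_uniq lt_trans ltxx _ srt.
apply: sub_all bd => r /andP[xr ->]; rewrite andbT (le_lt_trans _ xr)//.
by rewrite a_ge// mem_head.
Qed.

(** With no perturbation the d roots are those of (X - x0) u; x0 may be one of them, hence d - 1. *)
Lemma optimal_roots : exists rs : seq R,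
  [/\ size rs = d.-1, uniq rs, all (root u) rs & all (fun r => -1 < r < 1) rs].
Proof.
have [||_ [rs [sz un rt bd]]] := @perturb_roots 0 0; rewrite ?normr0//.
  by move=> i _; rewrite horner0 normr0.
have b1 : b <= 1 by have [i im ->] := a_node b_in; case/andP: (t_bound im).
have sub : {subset take d.-1 (rem x0 rs) <= rs}.
  by move=> x /mem_take; exact: mem_rem.
exists (take d.-1 (rem x0 rs)); split.
- rewrite size_takel//; case: (boolP (x0 \in rs)) => h.
    by rewrite size_rem// sz.
  by rewrite rem_id// sz leq_pred.
- exact/take_uniq/rem_uniq.
- apply/allP => x xr; have /allP/(_ _ (sub _ xr)) := rt.
  rewrite scaler0 subr0 rootM => /orP[|//]; rewrite root_XsubC => /eqP xx0.
  by move: xr => /mem_take; rewrite xx0 mem_rem_uniqF.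
- apply/allP => x /sub xr; have /allP/(_ _ xr)/andP[-> /lt_le_trans->//] := bd.
Qed.

Let dominates_side (z : R) (q : {poly R}) : (size q <= d)%N ->
    (forall i, (i < n)%N -> `|q.[t i]| <= 1) -> 1 <= `|z| ->
    `|u.[z]| < `|q.[z]| ->
  0 < kappa * (b - z).
Proof.
move=> sq q1 z1 uqz.
have qz : q.[z] != 0 by rewrite -normr_gt0 (le_lt_trans _ uqz).
pose lam := u.[z] / q.[z].
have lam1 : `|lam| < 1 by rewrite normf_div ltr_pdivrMr ?normr_gt0// mul1r.
have [same [rs [sz un rt bd]]] := perturb_roots lam1 q1.
set U := ('X - _) * _ in rt.
have b1 : b <= 1 by have [i im ->] := a_node b_in; case/andP: (t_bound im).
have zrs : z \notin rs.
  apply/negP => zr; have /allP/(_ _ zr)/andP[h1 h2] := bd.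
  by move: z1; rewrite leNgt ltr_norml h1 (lt_le_trans h2 b1).
have zU : root U z.
  by rewrite rootM orbC /root !hornerE /lam divfK// subrr eqxx.
have sV : (size (u - lam *: q)%R <= d.+1)%N.
  rewrite (leq_trans (size_polyD _ _))// geq_max size_u size_polyN.
  by rewrite (leq_trans (size_scale_leq _ _))// ltnW.
have V0 : u - lam *: q != 0.
  by apply/eqP => e; have := same b b_in; rewrite e horner0 mul0r ltxx.
have sUV : size U = (size (u - lam *: q)%R).+1.
  by rewrite /U mulrC size_Mmonic ?monicXsubC// size_XsubC addn2.
have sU : size U = (size (z :: rs)).+1.
  apply/eqP; rewrite eqn_leq; apply/andP; split; first by rewrite sUV /= sz.
  apply: max_poly_roots; rewrite /= ?zU ?zrs//.
  by rewrite mulf_neq0// polyXsubC_eq0.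
have leadU : lead_coef U = u`_d.
  rewrite /U lead_coefM lead_coefXsubC mul1r lead_coefE.
  have -> : (size (u - lam *: q)%R).-1 = d by move: sU; rewrite sUV /= sz => -[->].
  by rewrite coefB coefZ [q`_d]nth_default// mulr0 subr0.
have UE : U = u`_d *: \prod_(r <- z :: rs) ('X - r%:P).
  rewrite -leadU; apply: all_roots_prod_XsubC => //; first by rewrite /= zU.
  by rewrite uniq_rootsE /= zrs.
have Ub : U.[b] = u`_d * ((b - z) * \prod_(r <- rs) (b - r)).
  rewrite UE hornerZ big_cons hornerM hornerXsubC horner_prod.
  by congr (_ * (_ * _)); apply: eq_bigr => r _; rewrite hornerXsubC.
have pos : 0 < \prod_(r <- rs) (b - r).
  rewrite big_seq; apply: prodr_gt0 => r rr.
  by have /allP/(_ _ rr)/andP[_] := bd; rewrite subr_gt0.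
have bx0 : 0 < (b - x0) ^+ 2.
  have [i im bi] := a_node b_in.
  by rewrite exprn_even_gt0//= subr_eq0 bi eq_sym x0_notin_grid.
rewrite -(pmulr_lgt0 _ pos).
have -> : kappa * (b - z) * \prod_(r <- rs) (b - r) =
    u.[b] * (b - x0) * (u`_d * ((b - z) * \prod_(r <- rs) (b - r))).
  by rewrite /kappa; ring.
rewrite -Ub /U hornerM hornerXsubC.
have := mulr_gt0 bx0 (same b b_in); congr (_ < _); ring.
Qed.

Lemma optimal_dominates : exists2 eps : R, eps ^+ 2 = 1 &
  forall (z : R) (q : {poly R}), 1 <= z -> (size q <= d)%N ->
    (forall i, (i < n)%N -> `|q.[t i]| <= 1) -> `|q.[eps * z]| <= `|u.[eps * z]|.
Proof.
have [i im bi] := a_node b_in; have /andP[b1 b2] := t_bound im; rewrite -bi in b1 b2.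
have [k0|k0] := leP kappa 0.
  exists (-1) => [|z q z1 sq q1]; first by rewrite sqrrN expr1n.
  rewrite mulN1r leNgt; apply/negP => lt.
  have := dominates_side sq q1 _ lt; rewrite normrN ger0_norm; last by lra.
  move=> /(_ z1); apply/negP; rewrite -leNgt mulr_le0_ge0//; lra.
exists 1 => [|z q z1 sq q1]; first by rewrite expr1n.
rewrite mul1r leNgt; apply/negP => lt.
have := dominates_side sq q1 _ lt; rewrite ger0_norm; last by lra.
move=> /(_ z1); apply/negP; rewrite -leNgt mulr_ge0_le0//; [exact: ltW|lra].
Qed.

End domination.
End optimal_polynomial.

Local Open Scope complex_scope.

(** * Real and imaginary parts, and norms on the segment and on the grid *)

Section complex_polynomials.
Context {R : realType}.
Implicit Types (p : {poly R[i]}) (q : {poly R}).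

Notation toC := (real_complex R).

Definition re_poly p : {poly R} := \poly_(j < size p) complex.Re p`_j.
Definition im_poly p : {poly R} := \poly_(j < size p) complex.Im p`_j.

Lemma re_im_polyE p :
  p = map_poly toC (re_poly p) + 'i%C *: map_poly toC (im_poly p).
Proof.
apply/polyP => j; rewrite coefD coefZ !coef_map /=.
by case: (p`_j) => a b; apply/eqP; rewrite eq_complex /=; apply/andP; split; apply/eqP; ring.
Qed.

Lemma horner_real_complex q (x : R) : (map_poly toC q).[x%:C] = q.[x]%:C.
Proof. exact: horner_map. Qed.

Lemma horner_re_im p (x : R) : p.[x%:C] = (re_poly p).[x] +i* (im_poly p).[x].
Proof.
rewrite {1}(re_im_polyE p) hornerD hornerZ !horner_real_complex.
by apply/eqP; rewrite eq_complex /=; apply/andP; split; apply/eqP; ring.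
Qed.

Lemma size_re_poly p : (size (re_poly p) <= size p)%N.
Proof. exact: size_poly. Qed.

Lemma size_im_poly p : (size (im_poly p) <= size p)%N.
Proof. exact: size_poly. Qed.

Lemma normc_real (x : R) : Normc.normc x%:C = `|x|.
Proof. by rewrite /Normc.normc /= expr0n/= addr0 sqrtr_sqr. Qed.

Lemma normc_ge0 (z : R[i]) : 0 <= Normc.normc z.
Proof. by case: z => a b; exact: sqrtr_ge0. Qed.

Lemma continuous_normc_horner p :
  continuous (fun x : R => Normc.normc p.[x%:C]).
Proof.
move=> x; rewrite (_ : (fun x => _) = Num.sqrt \o
    (fun x => (re_poly p).[x] ^+ 2 + (im_poly p).[x] ^+ 2)); last first.
  by apply/funext => y; rewrite horner_re_im.
apply: continuous_comp; last exact: sqrt_continuous.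
have c q : {for x, continuous (fun x => q.[x] ^+ 2)}.
  apply: (@continuous_comp _ _ _ (horner q) (fun y => y ^+ 2)).
    exact: continuous_horner.
  exact: exprn_continuous.
by apply: cvgD; exact: c.
Qed.

Lemma supnorm_segment p : exists x0 : R,
  [/\ -1 <= x0 <= 1, supnorm `[-1, 1] p = Normc.normc p.[x0%:C] &
      forall x : R, -1 <= x <= 1 -> Normc.normc p.[x%:C] <= supnorm `[-1, 1] p].
Proof.
have [x0 x0in max] := @EVT_max R (fun x => Normc.normc p.[x%:C]) (-1) 1 ltac:(lra)
  (continuous_subspaceT (@continuous_normc_horner p)).
have sE : supnorm `[-1, 1] p = Normc.normc p.[x0%:C].
  have ub : ubound [set Normc.normc p.[x%:C] | x in [set` `[-1, 1]]] (Normc.normc p.[x0%:C]).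
    by move=> _ [x xin <-]; exact: max.
  apply/eqP; rewrite eq_le; apply/andP; split.
    by apply: ge_sup => //; exists (Normc.normc p.[x0%:C]), x0.
  by apply: ub_le_sup; [exists (Normc.normc p.[x0%:C])|exists x0].
by exists x0; rewrite sE; split.
Qed.

Section grid.
Variables (n : nat).
Hypothesis n2 : (1 < n)%N.

Lemma grid_pointE : grid n = [set grid_point n j | j in [set j | (j < n)%N]] :> set R.
Proof.
have n1 : n%:R - 1 != 0 :> R by rewrite subr_eq0 pnatr_eq1 gtn_eqF.
apply/seteqP; split => _ [k /= kn <-].
  case: k kn => // k /= kn; exists k => //; rewrite /grid_point -natr1; field.
  exact: n1.
exists k.+1 => //=; rewrite /grid_point -natr1; field.
exact: n1.
Qed.

Lemma supnorm_grid_ge p j : (j < n)%N ->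
  Normc.normc p.[(grid_point n j)%:C] <= supnorm (grid n) p.
Proof.
move=> jn; apply: ub_le_sup; last first.
  by exists (grid_point n j); rewrite ?grid_pointE//; exists j.
have [x0 [_ _ max]] := supnorm_segment p.
exists (supnorm `[-1, 1] p) => _ [x + <-].
rewrite grid_pointE => -[k /= kn <-]; apply: max.
have n1 : 0 < n%:R - 1 :> R by rewrite subr_gt0 ltr1n.
have k0 : 0 <= k%:R :> R by [].
have k1 : k%:R <= n%:R - 1 :> R by rewrite lerBrDr natr1 ler_nat.
rewrite /grid_point mulrAC; apply/andP; split.
  by rewrite lerDl divr_ge0 ?mulr_ge0// ltW.
by rewrite -lerBrDl ler_pdivrMr//; lra.
Qed.

Lemma supnorm_grid_le p (rho : R) :
  (forall j, (j < n)%N -> Normc.normc p.[(grid_point n j)%:C] <= rho) ->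
  supnorm (grid n) p <= rho.
Proof.
move=> H; apply: ge_sup.
  by exists (Normc.normc p.[(grid_point n 0)%:C]), (grid_point n 0) => //;
    rewrite grid_pointE; exists 0%N => //=; exact: ltnW.
by move=> _ [x + <-]; rewrite grid_pointE => -[j /= jn <-]; exact: H.
Qed.

Lemma grid_point_incr (j k : nat) : (j < k)%N -> grid_point n j < grid_point n k :> R.
Proof.
move=> jk; rewrite /grid_point ltrD2l ltr_pM2l ?ltr_nat// divr_gt0//.
by rewrite subr_gt0 ltr1n.
Qed.

Lemma grid_point_bound (k : nat) : (k < n)%N -> -1 <= (grid_point n k : R) <= 1.
Proof.
move=> kn; have n1 : 0 < n%:R - 1 :> R by rewrite subr_gt0 ltr1n.
have k0 : 0 <= k%:R :> R by [].
have k1 : k%:R <= n%:R - 1 :> R by rewrite lerBrDr natr1 ler_nat.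
rewrite /grid_point mulrAC; apply/andP; split.
  by rewrite lerDl divr_ge0 ?mulr_ge0// ltW.
by rewrite -lerBrDl ler_pdivrMr//; lra.
Qed.

Lemma supnorm_grid_gt0 p : p != 0 -> (size p <= n)%N -> 0 < supnorm (grid n) p.
Proof.
move=> p0 sp; rewrite ltNge; apply/negP => s0.
pose rs : seq R[i] := [seq (grid_point n j)%:C | j <- iota 0 n].
have := @max_poly_roots _ p rs p0; rewrite size_map size_iota ltnNge sp => H.
suff: false by []; apply: H.
  apply/allP => z /mapP[j]; rewrite mem_iota add0n => /andP[_ jn] ->.
  apply/rootP; apply: Normc.eq0_normc; apply/eqP; rewrite eq_le normc_ge0 andbT.
  exact: le_trans (supnorm_grid_ge p jn) s0.
rewrite map_inj_uniq ?iota_uniq// => j k /complexI jk.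
by case: (ltngtP j k) => // /grid_point_incr; rewrite jk ltxx.
Qed.

End grid.
End complex_polynomials.

Section extremal_structure.
Context {R : realType} (alpha : R) (n d : nat) (p : {poly R[i]}).
Hypothesis n3 : (2 < n)%N.
Hypothesis d_bounds : (1 < d < n)%N.
Hypothesis dE : forall k : nat, (k%:R <= alpha * n%:R) = (k <= d)%N.
Hypothesis p_extremal : extremal alpha n p.

Notation toC := (real_complex R).
Notation t := (@grid_point R n).

Let n2 : (1 < n)%N. Proof. exact: ltnW. Qed.

Let admissibleE (q : {poly R[i]}) :
  admissible alpha n q <-> q != 0 /\ (size q <= d.+1)%N.
Proof.
rewrite /admissible dE; split => -[q0 sq]; split => //.
  by move: sq; rewrite -ltnS prednK// size_poly_gt0.
by rewrite -ltnS prednK// size_poly_gt0.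
Qed.

Let grid_gt0 (q : {poly R[i]}) : q != 0 -> (size q <= d.+1)%N ->
  0 < supnorm (grid n) q.
Proof.
move=> q0 sq; apply: supnorm_grid_gt0 => //; apply: leq_trans sq _.
by case/andP: d_bounds.
Qed.

Let ratio_le (q : {poly R[i]}) : q != 0 -> (size q <= d.+1)%N ->
  norm_ratio n q <= norm_ratio n p.
Proof.
move=> q0 sq; rewrite -lee_fin p_extremal.2; apply: ereal_sup_ubound.
by exists q => //; apply/admissibleE.
Qed.

Let p0 : p != 0. Proof. by case: p_extremal => /admissibleE[]. Qed.
Let sp : (size p <= d.+1)%N. Proof. by case: p_extremal => /admissibleE[]. Qed.

Let size_real (q : {poly R}) : size (map_poly toC q) = size q.
Proof. by rewrite size_map_poly. Qed.

Let real_ratio_le (q : {poly R}) (x rho : R) : (size q <= d.+1)%N ->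
    -1 <= x <= 1 -> (forall j, (j < n)%N -> `|q.[t j]| <= rho) ->
  `|q.[x]| <= rho * norm_ratio n p.
Proof.
move=> sq xin q_le; have [->|q0] := eqVneq q 0.
  rewrite horner0 normr0 mulr_ge0//.
    exact: le_trans (normr_ge0 _) (q_le 0%N (ltnW n2)).
  rewrite divr_ge0 ?(ltW (grid_gt0 p0 sp))//.
  by have [y [_ -> _]] := supnorm_segment p; exact: normc_ge0.
have q0' : map_poly toC q != 0 by rewrite map_poly_eq0.
have sq' : (size (map_poly toC q) <= d.+1)%N by rewrite size_real.
have E_gt0 := grid_gt0 q0' sq'.
have E_le : supnorm (grid n) (map_poly toC q) <= rho.
  apply: (supnorm_grid_le n2) => j jn.
  by rewrite horner_real_complex normc_real q_le.
have [y [_ _ max]] := supnorm_segment (map_poly toC q).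
have := ratio_le q0' sq'; rewrite {1}/norm_ratio ler_pdivrMr// => le1.
have := max _ xin; rewrite horner_real_complex normc_real => /le_trans; apply.
apply: le_trans le1 _; rewrite mulrC ler_wpM2r//.
rewrite divr_ge0 ?(ltW (grid_gt0 p0 sp))//.
by have [y' [_ -> _]] := supnorm_segment p; exact: normc_ge0.
Qed.

(* A parabola whose vertex is the midpoint of a gap of the grid. *)
Let ratio_gt1 : 1 < norm_ratio n p.
Proof.
have n1 : 0 < n%:R - 1 :> R by rewrite subr_gt0 ltr1n.
have N3 : 3 <= n%:R :> R by rewrite ler_nat.
pose h : R := 2 / (n%:R - 1); pose m : R := -1 + h / 2.
have h0 : 0 < h by rewrite divr_gt0.
have h1 : h <= 1 by rewrite ler_pdivrMr//; lra.
pose q : {poly R} := 4%:P - ('X - m%:P) ^+ 2.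
have qE x : q.[x] = 4 - (x - m) ^+ 2.
  by rewrite /q hornerD hornerN horner_exp hornerXsubC hornerC.
have sq : (size q <= d.+1)%N.
  rewrite (leq_trans (size_polyD _ _))// geq_max size_polyN size_exp_XsubC.
  rewrite (leq_trans (size_polyC_leq1 _))//=.
  by case/andP: d_bounds.
have hj j : (j < n)%N -> `|q.[t j]| <= 4 - h ^+ 2 / 4.
  move=> jn; rewrite qE; have /andP[t1 t2] := grid_point_bound (R := R) n2 jn.
  have far : h ^+ 2 / 4 <= (t j - m) ^+ 2.
    have -> : t j - m = h * (j%:R - 1 / 2) by rewrite /grid_point /m /h; field; exact: lt0r_neq0.
    rewrite [(h * _) ^+ 2]exprMn ler_pM2l ?exprn_gt0//.
    case: j {jn t1 t2} => [|j]; first by lra.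
    have j0 : 0 <= j%:R :> R by [].
    have jj := mulr_ge0 j0 j0.
    by rewrite -[j.+1%:R]natr1; lra.
  have m1 : -1 <= m <= 0 by rewrite /m; apply/andP; split; lra.
  by rewrite ger0_norm; nra.
have m_in : -1 <= m <= 1 by rewrite /m; apply/andP; split; lra.
have := real_ratio_le sq m_in hj.
rewrite qE subrr expr0n/= subr0 ger0_norm//.
have : 0 < h ^+ 2 by rewrite exprn_gt0.
have : h ^+ 2 <= 1 by rewrite exprn_ile1// ltW.
move: (h ^+ 2) => H h2 hh le4; rewrite ltNge; apply/negP => le1.
have := ler_piMr (_ : 0 <= 4 - H / 4) le1; lra.
Qed.

Lemma extremal_structure : exists (c : R[i]) (u : {poly R}),
  [/\ c != 0 /\ p = c *: map_poly toC u, (size u <= d.+1)%N,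
      forall j, (j < n)%N -> `|u.[t j]| <= 1,
      exists2 eps : R, eps ^+ 2 = 1 &
        forall (z : R) (q : {poly R}), 1 <= z -> (size q <= d)%N ->
          (forall j, (j < n)%N -> `|q.[t j]| <= 1) ->
          `|q.[eps * z]| <= `|u.[eps * z]| &
      exists rs : seq R, [/\ size rs = d.-1, uniq rs, all (root u) rs &
        all (fun r => -1 < r < 1) rs]].
Proof.
have [x0 [x0in maxE max]] := supnorm_segment p.
have E0 := grid_gt0 p0 sp; have r1 := ratio_gt1.
have M0 : 0 < Normc.normc p.[x0%:C].
  rewrite -maxE; move: r1; rewrite /norm_ratio ltr_pdivlMr// mul1r.
  exact: lt_trans.
set M := Normc.normc p.[x0%:C] in M0 maxE.
set E := supnorm (grid n) p in E0.
have px0 : p.[x0%:C] != 0.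
  by apply/eqP => e; move: M0; rewrite /M e Normc.normc0 ltxx.
(* Normalisation making the value at the maximum point real. *)
pose c := (M / E)%:C / p.[x0%:C].
have ME : norm_ratio n p = M / E by rewrite /norm_ratio maxE.
have ME0 : 0 < M / E by rewrite divr_gt0.
have c0 : c != 0.
  by rewrite mulf_neq0 ?invr_neq0// eq_complex /= eqxx andbT lt0r_neq0.
have cn : Normc.normc c = E^-1.
  rewrite /c Normc.normcM Normc.normcV normc_real (gtr0_norm ME0) -/M.
  by field; rewrite !lt0r_neq0.
pose p1 := c *: p; pose u := re_poly p1; pose v := im_poly p1.
have sp1 : (size p1 <= d.+1)%N by rewrite (leq_trans (size_scale_leq _ _)).
have su : (size u <= d.+1)%N := leq_trans (size_re_poly p1) sp1.
have sv : (size v <= d.+1)%N := leq_trans (size_im_poly p1) sp1.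
have ux0 : u.[x0] = M / E.
  have := horner_re_im p1 x0; rewrite hornerZ /c divfK// => /eqP.
  by rewrite eq_complex => /andP[/eqP].
have uv1 j : (j < n)%N -> u.[t j] ^+ 2 + v.[t j] ^+ 2 <= 1.
  move=> jn; have : Normc.normc p1.[(t j)%:C] <= 1.
    rewrite hornerZ Normc.normcM cn mulrC ler_pdivrMr// mul1r.
    exact: supnorm_grid_ge.
  rewrite horner_re_im /Normc.normc -/u -/v => h.
  by rewrite -[leLHS]sqr_sqrtr ?addr_ge0 ?sqr_ge0// exprn_ile1// sqrtr_ge0.
have u1 j : (j < n)%N -> `|u.[t j]| <= 1.
  move=> jn; rewrite -(@expr_le1 _ 2)// real_normK ?num_real//.
  by apply: le_trans (uv1 j jn); rewrite lerDl sqr_ge0.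
(* This is where [ratio_gt1] matters: the value at the maximum point exceeds 1, whereas u is bounded
   by 1 at the nodes. *)
have x0t j : (j < n)%N -> x0 != t j.
  move=> jn; apply/eqP => x0j; have := u1 j jn.
  by rewrite -x0j ux0 -ME gtr0_norm ?(lt_trans ltr01)// leNgt r1.
have opt (q : {poly R}) (rho : R) : (size q <= d.+1)%N ->
    (forall j, (j < n)%N -> `|q.[t j]| <= rho) -> q.[x0] <= rho * u.[x0].
  move=> sq q1; rewrite ux0 -ME; apply: le_trans (ler_norm _) _.
  exact: real_ratio_le.
have ux0_gt0 : 0 < u.[x0] by rewrite ux0.
have incr j k : (j < k)%N -> t j < t k by exact: grid_point_incr.
have bnd j : (j < n)%N -> -1 <= t j <= 1 by exact: grid_point_bound.
have [a [sa srt nodes ua alt]] :=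
  optimal_alternation incr su u1 ux0_gt0 x0t opt.
(* At the d + 1 alternation nodes u^2 = 1 and u^2 + v^2 <= 1, so v, of degree at most d, has d + 1
   zeros: an extremal polynomial is real up to a constant factor. *)
have v0 : v = 0.
  apply/eqP/negPn/negP => v0; have := @max_poly_roots _ v a v0.
  rewrite sa ltnNge sv => H; suff: false by []; apply: H.
    apply/allP => x xa; have [j jn xj] := nodes x xa.
    have := uv1 j jn; rewrite -xj -[u.[x] ^+ 2]real_normK ?num_real// ua// expr1n.
    by rewrite gerDl => v2; rewrite /root -sqrf_eq0 eq_le v2 sqr_ge0.
  exact: sorted_uniq lt_trans ltxx _ srt.
exists c^-1, u; split => //.
- split; first by rewrite invr_neq0.
  have := re_im_polyE p1; rewrite -/u -/v v0 map_poly0 scaler0 addr0 => <-.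
  by rewrite /p1 scalerA mulVf// scale1r.
- exact: (optimal_dominates bnd su sa srt nodes ua x0t alt).
- exact: (optimal_roots bnd sa srt nodes ua alt).
Qed.

End extremal_structure.

(** * Moments of the zeros *)

Section log_taylor.
Context {R : realType}.

Lemma ln_taylor (K : nat) (x : R) : `|x| <= 2^-1 ->
  `|ln (1 - x) + \sum_(k < K) x ^+ k.+1 / k.+1%:R| <= 2 * `|x| ^+ K.+1.
Proof.
move=> x2.
pose S : {poly R} := \sum_(k < K) (k.+1%:R^-1)%:P * 'X ^+ k.+1.
have SE y : S.[y] = \sum_(k < K) y ^+ k.+1 / k.+1%:R.
  rewrite /S horner_sum; apply: eq_bigr => k _.
  by rewrite hornerM hornerC hornerXn mulrC.
have S'E y : (1 - y) * S^`().[y] = 1 - y ^+ K.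
  have -> : S^`().[y] = \sum_(k < K) y ^+ k.
    rewrite /S raddf_sum horner_sum; apply: eq_bigr => k _ /=.
    rewrite derivM derivC mul0r add0r derivXn hornerM hornerC hornerMn hornerXn /=.
    by rewrite -(mulr_natl (y ^+ k)) mulKf// pnatr_eq0.
  by rewrite -[RHS]opprB subrX1; ring.
pose F (y : R) := ln (1 - y) + S.[y].
(* Moving along the segment from 0 to x treats both signs of x with a single application of the mean
   value theorem. *)
pose f (s : R) := F (s * x).
have dF (y : R) : y < 1 -> is_derive y 1 F (- y ^+ K / (1 - y)).
  move=> y1; have y1' : 0 < 1 - y by lra.
  have d0 : is_derive y 1 (fun t : R => 1 - t) (0 - 1) by apply: is_deriveB.
  have d1 := @is_derive1_comp _ _ (fun t : R => 1 - t) _ _ _ (is_derive1_ln y1') d0.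
  apply: trigger_derive (is_deriveD d1 (is_derive_poly S y)) _.
  apply: (mulfI (lt0r_neq0 y1')); rewrite mulrDr S'E; field; exact: lt0r_neq0.
have sx (s : R) : 0 <= s <= 1 -> `|s * x| <= `|x|.
  by move=> /andP[s0 s1]; rewrite normrM (ger0_norm s0) ler_piMl.
have sx1 (s : R) : 0 <= s <= 1 -> s * x < 1.
  by move=> /sx h; apply: le_lt_trans (ler_norm _) _; lra.
have df (s : R) : s \in `]0, 1[ ->
    is_derive s 1 f (- (s * x) ^+ K / (1 - s * x) * x).
  rewrite in_itv/= => /andP[s0 s1].
  have dl : is_derive s 1 (fun s : R => s * x) x.
    have := is_deriveM (is_derive_id s (1 : R)) (is_derive_cst x s (1 : R)).
    by move/trigger_derive; apply; rewrite scaler0 add0r /GRing.scale/= mulr1.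
  apply: (@is_derive1_comp _ F (fun s : R => s * x) s _ _ _ dl).
  by apply: dF; apply: sx1; rewrite !ltW.
have cf : {within `[0, 1], continuous f}.
  apply: continuous_in_subspaceT => s; rewrite inE/= in_itv/= => s01.
  apply: (@continuous_comp _ _ _ (fun s : R => s * x) F).
    exact: mulrr_continuous.
  by apply/differentiable_continuous/derivable1_diffP; case: (dF _ (sx1 _ s01)).
have [s] := MVT_segment ler01 df cf.
rewrite in_itv/= /f mul1r mul0r {1 2}/F SE subr0 ln1 add0r => s01.
have -> : S.[0] = 0 by rewrite SE big1// => k _; rewrite expr0n mul0r.
rewrite ?subr0 ?addr0 ?mulr1 => ->.
have h := sx _ s01; have h1 : 2^-1 <= 1 - s * x.
  by have := ler_norm (s * x); lra.
rewrite exprSr mulrA normrM; apply: ler_pM => //.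
rewrite normrM normrN normfV normrX (ger0_norm (_ : 0 <= 1 - s * x)); last by lra.
rewrite mulrC ler_pM ?exprn_ge0 ?invr_ge0//; [lra| |by apply: lerXn2r].
by rewrite -[leRHS]invrK lef_pV2 ?posrE//; lra.
Qed.

End log_taylor.

Section null_sequences.
Context {R : realType}.

(* If every truncation of sum_j E n j z^(-j-1) is asymptotically as small as its
   next term, uniformly in z, then the coefficients vanish one after another. *)
Lemma coefficients_vanish (E : nat -> nat -> R) (B : R) :
    (forall n j, `|E n j| <= B) ->
    (forall J, exists2 J', (J <= J')%N & exists2 C, 0 <= C &
      forall z delta : R, 2 <= z -> 0 < delta -> exists N, forall n, (N <= n)%N ->
        `|\sum_(j < J') E n j / z ^+ j.+1| <= C / z ^+ J'.+1 + delta) ->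
  forall j (eta : R), 0 < eta -> exists N, forall n, (N <= n)%N -> `|E n j| <= eta.
Proof.
move=> EB H j; elim/ltn_ind: j => j IH eta eta0.
have [J' jJ [C C0 HC]] := H j.+1.
have B0 : 0 <= B by exact: le_trans (normr_ge0 (E 0%N 0%N)) (EB _ _).
(* For this z the remainder and the terms after the j-th, multiplied by z^(j+1), take at most eta /
   2. The other half is 2 delta z^(j+1): one delta for the hypothesis, one for the terms before the
   j-th, already known to vanish. *)
pose z := 2 + (J'%:R * B + C) * 2 / eta.
have J0 : 0 <= J'%:R :> R by [].
have q0 : 0 <= (J'%:R * B + C) * 2 / eta by rewrite divr_ge0 ?mulr_ge0 ?addr_ge0 ?mulr_ge0// ltW.
have z2 : 2 <= z by rewrite /z lerDl.
have z0 : 0 < z by lra.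
have z1 : 1 <= z by lra.
have zeta : (J'%:R * B + C) / z <= eta / 2.
  have h : (J'%:R * B + C) * 2 / eta <= z by rewrite /z; lra.
  rewrite ler_pdivrMr// mulrAC ler_pdivlMr//.
  by move: h; rewrite ler_pdivrMr// [z * _]mulrC.
pose delta := eta / (4 * z ^+ j.+1).
have zj0 : 0 < z ^+ j.+1 by rewrite exprn_gt0.
have delta0 : 0 < delta by rewrite divr_gt0// mulr_gt0.
have [N1 HN1] := HC z delta z2 delta0.
have [N2 HN2] : exists N, forall n, (N <= n)%N ->
    `|\sum_(k < j) E n k / z ^+ k.+1| <= delta.
  pose e := delta / j.+1%:R.
  have e0 : 0 < e by rewrite divr_gt0.
  have [N HN] : exists N, forall n, (N <= n)%N -> forall k, (k < j)%N -> `|E n k| <= e.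
    have {}IH k : (k < j)%N -> exists N, forall n, (N <= n)%N -> `|E n k| <= e.
      by move=> kj; exact: IH.
    elim: (j) IH => [|i IHi] IH; first by exists 0%N.
    have [N HN] := IHi (fun k ki => IH k (ltnW ki)).
    have [N' HN'] := IH i (ltnSn i).
    exists (maxn N N') => n; rewrite geq_max => /andP[nN nN'] k.
    by rewrite ltnS leq_eqVlt => /orP[/eqP->|ki]; [exact: HN'|exact: HN].
  exists N => n nN; apply: le_trans (ler_norm_sum _ _ _) _.
  apply: le_trans (_ : \sum_(k < j) e <= _).
    apply: ler_sum => k _; rewrite normf_div ler_pdivrMr; last first.
      by rewrite normr_gt0 expf_neq0// lt0r_neq0.
    apply: le_trans (HN n nN k (ltn_ord k)) _; rewrite ler_peMr ?(ltW e0)//.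
    by rewrite ger0_norm ?exprn_ge0 ?exprn_ege1// ltW.
  rewrite sumr_const card_ord -[leLHS]mulr_natl /e mulrA ler_pdivrMr// mulrC.
  by rewrite ler_wpM2l ?(ltW delta0)// ler_nat.
exists (maxn N1 N2) => n; rewrite geq_max => /andP[nN1 nN2].
have h1 := HN1 n nN1; have h2 := HN2 n nN2.
have tail : `|\sum_(k < J' | (j < k)%N) E n k / z ^+ k.+1| <= J'%:R * B / z / z ^+ j.+1.
  apply: le_trans (ler_norm_sum _ _ _) _.
  apply: le_trans (_ : \sum_(k < J') B / z / z ^+ j.+1 <= _); last first.
    by rewrite sumr_const card_ord -[leLHS]mulr_natl !mulrA.
  rewrite big_mkcond; apply: ler_sum => k _; case: ifP => [jk|_]; last first.
    by rewrite !divr_ge0 // ltW.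
  rewrite normf_div -mulrA -invfM -exprS ler_pM ?normr_ge0 ?invr_ge0//.
  rewrite ger0_norm ?exprn_ge0 ?(ltW z0)// lef_pV2 ?posrE ?exprn_gt0//.
  by rewrite ler_weXn2l.
have split : \sum_(k < J') E n k / z ^+ k.+1 = \sum_(k < j) E n k / z ^+ k.+1 +
    E n j / z ^+ j.+1 + \sum_(k < J' | (j < k)%N) E n k / z ^+ k.+1.
  rewrite (bigID (fun k : 'I_J' => (j < k)%N))/= addrC; congr (_ + _).
  rewrite (eq_bigl (fun k : 'I_J' => (k < j.+1)%N)); last by move=> k; rewrite -leqNgt.
  rewrite -(big_ord_widen_cond J' xpredT (fun k => E n k / z ^+ k.+1))//.
  by rewrite big_ord_recr.
have Cz : C / z ^+ J'.+1 <= C / z / z ^+ j.+1.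
  rewrite -mulrA -invfM -exprS ler_wpM2l// lef_pV2 ?posrE ?exprn_gt0//.
  by rewrite ler_weXn2l.
have main : `|E n j| / z ^+ j.+1 <= 2 * delta + (J'%:R * B + C) / z / z ^+ j.+1.
  rewrite -[z ^+ j.+1 in X in X <= _](ger0_norm (ltW zj0)) -normf_div.
  have -> : E n j / z ^+ j.+1 = \sum_(k < J') E n k / z ^+ k.+1 -
    \sum_(k < j) E n k / z ^+ k.+1 - \sum_(k < J' | (j < k)%N) E n k / z ^+ k.+1.
    by rewrite split; ring.
  apply: le_trans (ler_normB _ _) _; apply: le_trans (lerD (ler_normB _ _) tail) _.
  rewrite (mulrDl _ C) !mulrDl; move: h1 h2 Cz; clear; lra.
move: main; rewrite ler_pdivrMr// mulrDl divfK ?lt0r_neq0//.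
rewrite {1}/delta (_ : 2 * (eta / _) * _ = eta / 2); last by field; rewrite lt0r_neq0.
lra.
Qed.

End null_sequences.

(** * Comparison of logarithms at z and 2 z for one fixed n *)

Section moment_estimate.
Context {R : realType}.

Lemma ln_prod_seq (I : eqType) (l : seq I) (f : I -> R) :
  {in l, forall x, 0 < f x} -> ln (\prod_(x <- l) f x) = \sum_(x <- l) ln (f x).
Proof.
elim: l => [|x l IH] f0; first by rewrite !big_nil ln1.
have l0 : {in l, forall y, 0 < f y} by move=> y yl; rewrite f0// inE yl orbT.
rewrite !big_cons lnM ?posrE ?IH//; first by rewrite f0 ?mem_head.
by rewrite big_seq; apply: prodr_gt0.
Qed.

(** mu_alpha is the integral over s in [0, alpha] of the arcsine laws of
    [-sqrt (1 - s^2), sqrt (1 - s^2)]. The moment of order 2 m of such a law is [wallis m] times (1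
    - s^2)^m, and integration in s yields [prim_beta m] at alpha. *)
Definition equilibrium_moment (alpha : R) (k : nat) : R :=
  if odd k then 0 else wallis k./2 * (prim_beta k./2).[alpha].

(** The last of the 2 M + 1 terms is an odd moment, hence 0. It is included so that the Taylor
    expansion of the zeros, cut at the same place, has a remainder of the same order z^(-2M-2) as
    [ln_gram_poly_asymptotics]. *)
Lemma sum_equilibrium_moment (alpha z : R) (M : nat) :
  \sum_(k < M.*2.+1) equilibrium_moment alpha k.+1 / (k.+1%:R * z ^+ k.+1) =
  \sum_(m < M) wallis m.+1 / (2 * m.+1%:R) *
    ((prim_beta m.+1).[alpha] / z ^+ (2 * m.+1)).
Proof.
elim: M => [|M IH].
  by rewrite big_ord1 big_ord0 /equilibrium_moment /= mul0r.
rewrite doubleS big_ord_recr big_ord_recr/= IH [RHS]big_ord_recr/= -addrA.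
congr (_ + _); rewrite /equilibrium_moment /= odd_double /= mul0r addr0.
rewrite doubleK mul2n doubleS -[M.*2.+2]doubleS -muln2 natrM.
by rewrite (mulrC _ 2) !invfM; ring.
Qed.

Variables (alpha : R) (n d : nat) (u : {poly R}) (eps : R) (rs : seq R).
Hypothesis alpha01 : 0 < alpha < 1.
Hypothesis n3 : (2 < n)%N.
Hypothesis d_bounds : (1 < d < n)%N.
Hypothesis d_alpha : d%:R <= alpha * n%:R < d%:R + 1.
Hypothesis size_u : (size u <= d.+1)%N.
Hypothesis u_le1 : forall j, (j < n)%N -> `|u.[grid_point n j]| <= 1.
Hypothesis eps2 : eps ^+ 2 = 1.
Hypothesis u_dominates : forall (z : R) (q : {poly R}), 1 <= z -> (size q <= d)%N ->
  (forall j, (j < n)%N -> `|q.[grid_point n j]| <= 1) ->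
  `|q.[eps * z]| <= `|u.[eps * z]|.
Hypothesis size_rs : size rs = d.-1.
Hypothesis uniq_rs : uniq rs.
Hypothesis root_rs : all (root u) rs.
Hypothesis rs_bound : all (fun x => -1 < x < 1) rs.

Let P k z := (@gram_poly R n k).[z].
Let g k := @gram_norm R n k.

Let dn : (d < n)%N. Proof. by case/andP: d_bounds. Qed.
Let d1 : (1 < d)%N. Proof. by case/andP: d_bounds. Qed.

Let eps_cases : eps = 1 \/ eps = -1.
Proof.
have : (eps - 1) * (eps + 1) = 0 by rewrite -subr_sqr eps2 expr1n subrr.
move/eqP; rewrite mulf_eq0 subr_eq0 addr_eq0 => /orP[/eqP|/eqP]; by [left|right].
Qed.

Let u_neq0 z : 1 <= z -> 1 <= `|u.[eps * z]|.
Proof.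
move=> z1; have := @u_dominates z 1 z1; rewrite size_poly1 !hornerC normr1.
by apply; [exact: ltnW|move=> j _; rewrite hornerC normr1].
Qed.

Let upper z : 2 <= z ->
  `|u.[eps * z]| <= d.+1%:R * Num.sqrt n%:R * (P d z / Num.sqrt (g d)).
Proof.
move=> z2; pose q := u \Po (eps *: 'X).
have qE x : q.[x] = u.[eps * x] by rewrite /q horner_comp hornerZ hornerX.
rewrite -qE; apply: poly_le_gram => //.
  rewrite /q (leq_trans (size_comp_poly_leq _ _))// ltnS.
  have s2 : ((size (eps *: 'X)%R).-1 <= 1)%N.
    by rewrite -subn1 leq_subLR (leq_trans (size_scale_leq _ _))// size_polyX.
  rewrite -[X in (_ <= X)%N]muln1 leq_mul//.
  by rewrite -subn1 leq_subLR.
move=> j jn; rewrite qE; have [->|->] := eps_cases; first by rewrite mul1r u_le1.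
rewrite mulN1r (_ : - grid_point n j = grid_point n (n - j.+1)).
  by rewrite u_le1// ltn_subrL (leq_ltn_trans _ jn).
rewrite /grid_point natrB// -natr1; field.
by rewrite subr_eq0 pnatr_eq1 gtn_eqF// ltnW.
Qed.

Let lower z : 2 <= z -> P d.-1 z / Num.sqrt (g d.-1) <= `|u.[eps * z]|.
Proof.
move=> z2; have d'n : (d.-1 < n)%N by rewrite (leq_ltn_trans (leq_pred d)).
have g0 : 0 < g d.-1 by exact: gram_norm_gt0.
have [p0 _ _] := gram_poly_growth n3 z2 d'n.
have s0 : 0 < Num.sqrt (g d.-1) by rewrite sqrtr_gt0.
have := @u_dominates z ((Num.sqrt (g d.-1))^-1 *: gram_poly n d.-1).
rewrite hornerZ => H; apply: le_trans (H _ _ _).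
- rewrite normrM normfV (gtr0_norm s0) mulrC ler_wpM2l ?invr_ge0 ?(ltW s0)//.
  have [->|->] := eps_cases; first by rewrite mul1r gtr0_norm.
  rewrite mulN1r /gram_poly horner_monic_opN normrM normrX normrN1 expr1n mul1r.
  by rewrite gtr0_norm.
- by lra.
- rewrite (leq_trans (size_scale_leq _ _))// size_monic_op prednK//.
  exact: ltnW.
- move=> j jn; rewrite hornerZ normrM normfV (gtr0_norm s0) mulrC.
  by rewrite ler_pdivrMr// mul1r gram_poly_le_norm.
Qed.

Let K0 : R := - ln ((1 - alpha) / 4).

(** From above, the factor (d + 1) sqrt n of [poly_le_gram] costs at most 2 ln n. From below, the
    competitor has degree d - 1 only: passing to degree d costs ln z for the values and K0 / 2 for
    the norms, by [gram_coef_ge]. *)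
Let ln_u z : 2 <= z ->
  `|ln `|u.[eps * z]| - (ln (P d z) - 2^-1 * ln (g d))| <=
  2 * ln n%:R + ln z + K0.
Proof.
move=> z2; have N3 : 3 <= n%:R :> R by rewrite ler_nat.
have /andP[al0 al1] := alpha01.
have uz : 1 <= `|u.[eps * z]| by apply: u_neq0; lra.
have d0 : (0 < d)%N by exact: ltnW.
have d'n : (d.-1 < n)%N by rewrite (leq_ltn_trans (leq_pred d)).
have gd := gram_norm_gt0 (R := R) n3 dn; have gd' := gram_norm_gt0 (R := R) n3 d'n.
have [pd _ _] := gram_poly_growth n3 z2 dn.
have [pd' _ pz] := gram_poly_growth n3 z2 d'n; rewrite prednK// in pz.
have lnsqrt x : 0 < x -> ln (Num.sqrt x) = 2^-1 * ln x :> R.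
  move=> x0; have s0 : 0 < Num.sqrt x by rewrite sqrtr_gt0.
  by rewrite -[in RHS](sqr_sqrtr (ltW x0)) expr2 lnM ?posrE//; field.
have ln_frac k : 0 < P k z -> 0 < g k ->
    ln (P k z / Num.sqrt (g k)) = ln (P k z) - 2^-1 * ln (g k).
  by move=> h1 h2; rewrite ln_div ?posrE ?sqrtr_gt0// lnsqrt.
have hi : ln `|u.[eps * z]| <= 2 * ln n%:R + (ln (P d z) - 2^-1 * ln (g d)).
  have frac0 : 0 < P d z / Num.sqrt (g d) by rewrite divr_gt0 ?sqrtr_gt0.
  have n0 : 0 < n%:R :> R by lra.
  have u0 := lt_le_trans ltr01 uz.
  have s0 : 0 < Num.sqrt n%:R :> R by rewrite sqrtr_gt0.
  have ds0 : 0 < d.+1%:R * Num.sqrt n%:R :> R by rewrite mulr_gt0.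
  have rhs0 := mulr_gt0 ds0 frac0.
  have : ln `|u.[eps * z]| <=
      ln (d.+1%:R * Num.sqrt n%:R * (P d z / Num.sqrt (g d))).
    by rewrite ler_ln ?posrE//; exact: upper.
  rewrite (lnM ds0 frac0) (lnM _ s0) ?posrE// ln_frac// lnsqrt//.
  have : ln d.+1%:R <= ln n%:R :> R by rewrite ler_ln ?posrE ?ltr0n ?ler_nat ?(ltnW (ltnW n3)).
  have : 0 <= ln n%:R :> R by apply: ln_ge0; lra.
  lra.
have gE : g d = g d.-1 * gram_coef n d by rewrite /g -{1 3}(prednK d0) gram_normS.
have a0 : 0 < gram_coef n d :> R by apply: gram_coef_gt0; rewrite ?d0.
have aK : - ln (gram_coef n d) <= K0.
  rewrite /K0 lerN2 ler_ln ?posrE//; last by lra.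
  apply: le_trans (gram_coef_ge n3 _); last by rewrite d0 dn.
  rewrite mulrC ler_wpM2l// lerD2l lerN2 ler_pdivrMr; last by lra.
  by case/andP: d_alpha.
have lo : ln (P d z) - 2^-1 * ln (g d) - ln z - 2^-1 * K0 <= ln `|u.[eps * z]|.
  have frac0 : 0 < P d.-1 z / Num.sqrt (g d.-1) by rewrite divr_gt0 ?sqrtr_gt0.
  have : ln (P d.-1 z / Num.sqrt (g d.-1)) <= ln `|u.[eps * z]|.
    by rewrite ler_ln ?posrE//; [exact: lower|lra].
  rewrite ln_frac// => h.
  have : ln (P d z) <= ln z + ln (P d.-1 z).
    by rewrite -lnM ?posrE// ?ler_ln ?posrE ?mulr_gt0//; lra.
  have : ln (g d) = ln (g d.-1) + ln (gram_coef n d) by rewrite gE lnM ?posrE.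
  lra.
have K00 : 0 <= K0.
  by rewrite /K0 oppr_ge0 ln_le0//; lra.
have lz : 0 <= ln z by apply: ln_ge0; lra.
have lnn : 0 <= ln n%:R :> R by apply: ln_ge0; lra.
by rewrite ler_norml; apply/andP; split; lra.
Qed.

(** Dividing u by its d - 1 known roots leaves degree at most one. The affine factor has no zero on
    the ray because |u| >= 1 there, by domination of the constant 1. *)
Let factor : exists A B : R, (forall z, 1 <= z -> A + B * z != 0) /\
  forall z, 1 <= z ->
    `|u.[eps * z]| = `|A + B * z| * \prod_(r <- rs) (z - eps * r).
Proof.
have [q uE] : exists q, u = q * \prod_(r <- rs) ('X - r%:P).
  by apply: uniq_roots_prod_XsubC => //; rewrite uniq_rootsE.
have u0 : u != 0.
  apply: contraTneq (@u_neq0 1 (lexx _)) => ->.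
  by rewrite horner0 normr0 -ltNge.
have q0 : q != 0 by apply: contra_neq u0 => q0; rewrite uE q0 mul0r.
have sq : (size q <= 2)%N.
  have : (size u <= d.+1)%N by [].
  rewrite uE size_Mmonic ?monic_prod_XsubC// size_prod_XsubC size_rs prednK ?(ltnW d1)//.
  by rewrite -subn1 leq_subLR addnC add1n -addn2 leq_add2l.
have qE x : q.[x] = q`_0 + q`_1 * x.
  rewrite (horner_coef_wide _ sq) big_ord_recr big_ord1 /=.
  by rewrite expr0 mulr1 expr1.
have uz z : 1 <= z ->
    `|u.[eps * z]| = `|q`_0 + q`_1 * eps * z| * \prod_(r <- rs) (z - eps * r).
  move=> z1; rewrite uE hornerM normrM qE mulrA; congr (_ * _).
  rewrite horner_prod normr_prod !big_seq; apply: eq_bigr => r rr.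
  have /allP/(_ _ rr)/andP[r1 r2] := rs_bound.
  rewrite hornerXsubC; have [->|->] := eps_cases.
    by rewrite !mul1r ger0_norm//; lra.
  by rewrite !mulN1r -normrN ger0_norm; lra.
exists q`_0, (q`_1 * eps); split=> // z z1.
have := u_neq0 z1; rewrite uz//; apply: contraTneq => ->.
by rewrite normr0 mul0r -ltNge.
Qed.

(** Nothing else is known about the free zero, and nothing more is needed: if A + B > 0, the absence
    of zeros in [1, oo[ forces B >= 0, so that doubling z >= 2 multiplies the value by a factor
    between 1 and 4, and ln 4 <= 3. *)
Let affine_ratio (A B z : R) : (forall z, 1 <= z -> A + B * z != 0) -> 2 <= z ->
  `|ln `|A + B * z| - ln `|A + B * (2 * z)| | <= 3.
Proof.
wlog pos : A B / 0 < A + B.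
  move=> H AB z2; have := AB 1 (lexx _); rewrite mulr1 neq_lt => /orP[neg|pos].
    have := H (- A) (- B); rewrite !mulNr -!opprD !normrN; apply => //.
      by rewrite oppr_gt0.
    by move=> y y1; rewrite mulNr -opprD oppr_eq0 AB.
  exact: H.
move=> AB z2.
have B0 : 0 <= B.
  rewrite leNgt; apply/negP => B0.
  have : 1 <= A / - B by rewrite ler_pdivlMr; lra.
  move=> /AB/eqP; apply; field; exact: ltr0_neq0.
have l0 : 0 < A + B * z by nra.
have l1 : A + B * z <= A + B * (2 * z) by nra.
have l2 : A + B * (2 * z) <= (1 + 3) * (A + B * z) by nra.
have l3 := lt_le_trans l0 l1.
rewrite (gtr0_norm l0) (gtr0_norm l3).
have e1 : ln (A + B * z) <= ln (A + B * (2 * z)) by rewrite ler_ln ?posrE.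
have e2 : ln (A + B * (2 * z)) <= ln (1 + 3) + ln (A + B * z).
  have l4 : 0 < 1 + 3 :> R by lra.
  by rewrite -lnM ?posrE// ler_ln ?posrE// mulr_gt0.
have e3 : ln (1 + 3 : R) <= 3 by apply: le_ln1Dx; lra.
by rewrite ler_norml; apply/andP; split; lra.
Qed.

Let m k : R := \sum_(r <- rs) (eps * r) ^+ k.

Let taylor_side K z : 2 <= z ->
  `|\sum_(r <- rs) ln (z - eps * r) - (d%:R - 1) * ln z +
    \sum_(k < K) m k.+1 / (k.+1%:R * z ^+ k.+1)| <= 2 * n%:R / z ^+ K.+1.
Proof.
move=> z2; have z0 : 0 < z by lra.
have -> : \sum_(k < K) m k.+1 / (k.+1%:R * z ^+ k.+1) =
    \sum_(r <- rs) \sum_(k < K) (eps * r / z) ^+ k.+1 / k.+1%:R.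
  rewrite exchange_big; apply: eq_bigr => k _; rewrite /m mulr_suml.
  by apply: eq_bigr => r _; rewrite expr_div_n invfM mulrA mulrAC.
have -> : (d%:R - 1) * ln z = \sum_(r <- rs) ln z.
  rewrite big_const_seq count_predT size_rs iter_addr addr0 -[RHS]mulr_natl.
  by rewrite -subn1 natrB// ltnW.
rewrite -sumrB -big_split /=; apply: le_trans (ler_norm_sum _ _ _) _.
apply: le_trans (_ : \sum_(r <- rs) 2 / z ^+ K.+1 <= _); last first.
  rewrite big_const_seq count_predT size_rs iter_addr addr0 -[leLHS]mulr_natr.
  rewrite mulrAC ler_wpM2r ?invr_ge0 ?exprn_ge0 ?(ltW z0)// ler_wpM2l//.
  by rewrite ler_nat (leq_trans (leq_pred d))// ltnW.
rewrite !big_seq; apply: ler_sum => r rr.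
have /allP/(_ _ rr)/andP[r1 r2] := rs_bound.
have er : `|eps * r| <= 1.
  have [->|->] := eps_cases; rewrite ?mul1r ?mulN1r ?normrN;
    by rewrite ler_norml !ltW.
have x2 : `|eps * r / z| <= 2^-1.
  by rewrite normf_div (gtr0_norm z0) ler_pdivrMr//; lra.
have [ex1 ex2] : -1 <= eps * r /\ eps * r <= 1 by move: er; rewrite ler_norml => /andP.
rewrite -ln_div ?posrE//; last by lra.
rewrite (_ : (z - eps * r) / z = 1 - eps * r / z); last by field; exact: lt0r_neq0.
apply: le_trans (ln_taylor K x2) _.
rewrite ler_wpM2l// normf_div (gtr0_norm z0) expr_div_n.
by rewrite ler_pdivrMr ?exprn_gt0// mulVf ?expf_neq0 ?lt0r_neq0// exprn_ile1.
Qed.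

(** Subtracting the expansions at z and 2 z removes ln (g d) and produces the weights 1 - 2^-(k+1),
    which stay away from 0. The terms d ln z cancel between the zeros and P_d, and the terms left
    over grow at most like ln n for fixed z and M. *)
Lemma moment_estimate (M : nat) (z : R) : 2 <= z ->
  `|\sum_(k < M.*2.+1) ((\sum_(r <- rs) (eps * r) ^+ k.+1) / n%:R -
       equilibrium_moment alpha k.+1) * (1 - 2^-1 ^+ k.+1) / k.+1%:R / z ^+ k.+1|
  <= (4 * ln n%:R + 2 * ln z + 2 * K0 + 20 + 2 * M%:R) / n%:R +
     (2 * ((4 * M%:R + 2) * 2 ^+ M) + 4) / z ^+ M.*2.+2.
Proof.
move=> z2; have N3 : 3 <= n%:R :> R by rewrite ler_nat.
have z0 : 0 < z by lra.
pose Q y := \sum_(k < M.*2.+1) equilibrium_moment alpha k.+1 / (k.+1%:R * y ^+ k.+1).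
pose S y := \sum_(k < M.*2.+1) m k.+1 / (k.+1%:R * y ^+ k.+1).
have E : \sum_(k < M.*2.+1) ((\sum_(r <- rs) (eps * r) ^+ k.+1) / n%:R -
       equilibrium_moment alpha k.+1) * (1 - 2^-1 ^+ k.+1) / k.+1%:R / z ^+ k.+1 =
   ((S z - n%:R * Q z) - (S (2 * z) - n%:R * Q (2 * z))) / n%:R.
  rewrite /S /Q !mulr_sumr -!sumrB mulr_suml; apply: eq_bigr => k _.
  rewrite -/(m k.+1) exprMn exprVn; field.
  by rewrite !expf_neq0 ?lt0r_neq0//=; lra.
have z4 : 2 <= 2 * z by lra.
have [A [B [AB uAB]]] := factor.
have lnu y : 2 <= y -> ln `|u.[eps * y]| =
    ln `|A + B * y| + \sum_(r <- rs) ln (y - eps * r).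
  move=> y2; have y1 : 1 <= y by lra.
  have factor_gt0 r : r \in rs -> 0 < y - eps * r.
    move=> rr; have /allP/(_ _ rr)/andP[r1 r2] := rs_bound.
    by have [->|->] := eps_cases; lra.
  rewrite uAB// lnM ?posrE ?normr_gt0 ?AB//; last first.
    by rewrite big_seq; apply: prodr_gt0 => r rr; exact: factor_gt0.
  congr (_ + _); rewrite ln_prod_seq//.
have l2 : ln 2 <= 1 :> R by have := @le_ln1Dx R 1; rewrite (_ : 1 + 1 = 2)//; apply; lra.
have l20 : 0 <= ln 2 :> R by apply: ln_ge0; lra.
have n0 : 0 < n%:R :> R by rewrite ltr0n (ltn_trans _ n3).
set X := z ^+ M.*2.+2; have X0 : 0 < X by rewrite exprn_gt0.
have X2 : ((2 * z) ^+ M.*2.+2)^-1 <= X^-1.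
  rewrite lef_pV2 ?posrE ?exprn_gt0//; last by lra.
  by apply: lerXn2r; rewrite ?nnegrE; lra.
have al01 : 0 <= alpha <= 1 by case/andP: alpha01 => h1 h2; rewrite !ltW.
have da : `|d%:R - n%:R * alpha| <= 1.
  by case/andP: d_alpha => h1 h2; rewrite ler_norml; apply/andP; split; lra.
have asym y (y2 : 2 <= y) := @ln_gram_poly_asymptotics R n y n3 y2 alpha d M al01 dn da.
have h1 := asym z z2; have h2 := asym (2 * z) z4.
rewrite -!sum_equilibrium_moment -/(Q _) -/(Q _) in h1 h2.
have t1 := taylor_side M.*2.+1 z2; have t2 := taylor_side M.*2.+1 z4.
have u1 := ln_u z2; have u2 := ln_u z4; rewrite !lnu// in u1 u2.
have aff := affine_ratio AB z2.
have lz : ln (2 * z) = ln 2 + ln z by rewrite lnM ?posrE.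
have dbl : (2 * M.+1)%N = M.*2.+2 by rewrite mul2n doubleS.
rewrite !dbl -/X in h1 h2; rewrite -/X in t1.
have c0 : 0 <= (4 * M%:R + 2) * 2 ^+ M :> R.
  by rewrite mulr_ge0 ?exprn_ge0//; have M0 : 0 <= M%:R :> R by []; lra.
have h2' := le_trans h2 (lerD (lexx _) (ler_wpM2l c0 (ler_wpM2l (ltW n0) X2))).
have t2' := le_trans t2 (ler_wpM2l (mulr_ge0 (ler0n _ 2) (ltW n0)) X2).
rewrite E normf_div (gtr0_norm n0) ler_pdivrMr// [leRHS]mulrDl divfK ?lt0r_neq0//.
rewrite -/(S z) -/(S (2 * z)) in t1 t2'.
move: u1 u2 aff h1 h2' t1 t2'; rewrite lz.
rewrite -(mulrA 2 n%:R X^-1) [_ / X * n%:R]mulrAC -(mulrA _ n%:R X^-1).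
move: (n%:R / X) ((4 * M%:R + 2) * 2 ^+ M) => Y C.
rewrite !ler_norml.
move: (ln `|A + B * z|) (ln `|A + B * (2 * z)|) => a1 a2.
move: (\sum_(r <- rs) ln (z - eps * r)) (\sum_(r <- rs) ln (2 * z - eps * r)) => s1 s2.
rewrite -/(P d z) -/(P d (2 * z)).
move: (ln (P d z)) (ln (P d (2 * z))) (ln (g d)) (n%:R * Q z) (n%:R * Q (2 * z)) => b1 b2 b3 q1 q2.
move: (S z) (S (2 * z)) (d%:R : R) (ln n%:R) (ln z) (ln 2) l2 l20 => S1 S2 D ln1 ln2 ln3 l2 l20.
move: M%:R K0 => MM KK.
do 7 (move=> /andP[? ?]).
by apply/andP; split; lra.
Qed.

End moment_estimate.

(** * Convergence of the moments as n tends to infinity *)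

Section moment_convergence.
Context {R : realType}.

Lemma equilibrium_moment_bound (alpha : R) k : 0 <= alpha <= 1 ->
  `|equilibrium_moment alpha k| <= 1.
Proof.
move=> /andP[a0 a1]; rewrite /equilibrium_moment; case: ifP => _.
  by rewrite normr0.
have /andP[] := prim_beta_lip k./2 (lexx 0) a0 a1.
rewrite prim_beta0 !subr0 expr0n/= subr0 expr1n mulr1 => l1 l2.
have b0 : 0 <= (prim_beta k./2).[alpha].
  apply: le_trans l1; rewrite mulr_ge0// exprn_ge0//; nra.
have w0 := wallis_gt0 (R := R) k./2; have w1 := wallis_le1 (R := R) k./2.
rewrite ger0_norm ?mulr_ge0 ?(ltW w0)// -[leRHS]mulr1 ler_pM ?(ltW w0)//.
exact: le_trans l2 a1.
Qed.

Lemma nat_archi (x : R) : exists N, forall n, (N <= n)%N -> x <= n%:R.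
Proof.
exists (Num.bound `|x|) => n Nn; apply: le_trans (ler_norm x) _.
by apply: le_trans (ltW (archi_boundP (normr_ge0 x))) _; rewrite ler_nat.
Qed.

Lemma ln_over_n (c delta : R) : 0 < delta ->
  exists N, forall n, (N <= n)%N -> (4 * ln n%:R + c) / n%:R <= delta.
Proof.
(* Since ln n = 2 ln (sqrt n) <= 2 sqrt n, it is enough that delta sqrt n exceeds 8 + |c|. *)
move=> delta0; pose s := 1 + (8 + `|c|) / delta.
have q0 : 0 <= (8 + `|c|) / delta by rewrite divr_ge0 ?addr_ge0 ?(ltW delta0).
have [N HN] := nat_archi (s ^+ 2).
exists (maxn N 1) => n; rewrite geq_max => /andP[nN n1].
have n0 : 0 < n%:R :> R by rewrite ltr0n.
pose t := Num.sqrt n%:R : R.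
have tt : t ^+ 2 = n%:R by rewrite sqr_sqrtr ?(ltW n0).
have s1 : 1 <= s by rewrite /s lerDl.
have st : s <= t.
  by rewrite -[s]ger0_norm -?sqrtr_sqr ?ler_wsqrtr ?HN//; lra.
have t0 : 0 < t by lra.
have lt : ln n%:R <= 2 * t.
  have h : ln t <= t.
    have h0 : 0 < t by [].
    apply: le_trans (_ : ln (1 + t) <= _).
      by rewrite ler_ln ?posrE//; lra.
    by apply: le_ln1Dx; lra.
  by rewrite -tt expr2 lnM ?posrE//; lra.
rewrite ler_pdivrMr// -[X in _ <= _ * X]tt.
have sd : 8 + `|c| <= delta * t.
  apply: le_trans (_ : delta * s <= _); last by rewrite ler_wpM2l// ltW.
  by rewrite /s mulrDr mulr1 mulrC divfK ?lt0r_neq0//; lra.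
have := ler_norm c; have t1 : 1 <= t by lra.
have c0 := normr_ge0 c.
have p1 := ler_wpM2r (ltW t0) sd.
have p2 : `|c| <= `|c| * t by rewrite ler_peMr.
by move=> cn; lra.
Qed.

Variables (alpha : R) (d : nat -> nat) (u : nat -> {poly R}) (eps : nat -> R)
  (rs : nat -> seq R) (N0 : nat).
Hypothesis alpha01 : 0 < alpha < 1.
Hypothesis d_bounds : forall n, (N0 <= n)%N -> (2 < n)%N /\ (1 < d n < n)%N.
Hypothesis d_alpha : forall n, (N0 <= n)%N ->
  (d n)%:R <= alpha * n%:R < (d n)%:R + 1.
Hypothesis size_u : forall n, (N0 <= n)%N -> (size (u n) <= (d n).+1)%N.
Hypothesis u_le1 : forall n, (N0 <= n)%N ->
  forall j, (j < n)%N -> `|(u n).[grid_point n j]| <= 1.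
Hypothesis eps2 : forall n, (N0 <= n)%N -> eps n ^+ 2 = 1.
Hypothesis u_dominates : forall n, (N0 <= n)%N ->
  forall (z : R) (q : {poly R}), 1 <= z -> (size q <= d n)%N ->
  (forall j, (j < n)%N -> `|q.[grid_point n j]| <= 1) ->
  `|q.[eps n * z]| <= `|(u n).[eps n * z]|.
Hypothesis rs_roots : forall n, (N0 <= n)%N ->
  [/\ size (rs n) = (d n).-1, uniq (rs n), all (root (u n)) (rs n) &
      all (fun x => -1 < x < 1) (rs n)].

Let m n k : R := (\sum_(r <- rs n) (eps n * r) ^+ k) / n%:R.

Let m_bound n k : (N0 <= n)%N -> `|m n k| <= 1.
Proof.
move=> nN; have [n3 /andP[_ dn]] := d_bounds nN.
have [srs _ _ brs] := rs_roots nN.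
have n0 : 0 < n%:R :> R by rewrite ltr0n (ltn_trans _ n3).
rewrite normf_div (gtr0_norm n0) ler_pdivrMr// mul1r.
apply: le_trans (ler_norm_sum _ _ _) _.
apply: le_trans (_ : \sum_(r <- rs n) 1 <= _).
  rewrite !big_seq; apply: ler_sum => r rr.
  rewrite normrX exprn_ile1// normrM.
  have -> : `|eps n| = 1 by apply/eqP; rewrite -sqrp_eq1// -normrX eps2// normr1.
  rewrite mul1r; have /allP/(_ _ rr)/andP[r1 r2] := brs.
  by rewrite ler_norml !ltW.
rewrite big_const_seq count_predT iter_addr addr0 srs ler_nat.
by rewrite (leq_trans (leq_pred _))// ltnW.
Qed.

Let scaled_moment_cvg j (eta : R) : 0 < eta ->
  exists N, forall n, (N <= n)%N ->
    `|m n j.+1 - equilibrium_moment alpha j.+1| <= eta.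
Proof.
have /andP[al0 al1] := alpha01.
(* The value 0 below N0 is a default, since [coefficients_vanish] asks for a bound at every n. The
   weight is at least 1 / (2 (j + 1)), so it is undone at the end by the choice of the tolerance. *)
pose E n j : R := if (N0 <= n)%N then
  (m n j.+1 - equilibrium_moment alpha j.+1) * (1 - 2^-1 ^+ j.+1) / j.+1%:R else 0.
have half k : 1 / 2 <= (1 - 2^-1 ^+ k.+1 : R) <= 1.
  have h0 : 0 <= (2^-1 : R) ^+ k by rewrite exprn_ge0.
  have h1 : (2^-1 : R) ^+ k <= 1 by rewrite exprn_ile1//; lra.
  by rewrite exprS; apply/andP; split; lra.
have EB n k : `|E n k| <= 2.
  rewrite /E; case: ifP => nN; last by rewrite normr0.
  rewrite normrM normfV normrM normr_nat.
  have /andP[h1 h2] := half k.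
  have k0 : 0 < k.+1%:R :> R by [].
  rewrite ler_pdivrMr//; have k1 : 1 <= k.+1%:R :> R by rewrite ler1n.
  apply: ler_pM => //.
    apply: le_trans (ler_normB _ _) _.
    have mb := m_bound k.+1 nN.
    have eb : `|equilibrium_moment alpha k.+1| <= 1.
      by apply: equilibrium_moment_bound; rewrite (ltW al0) (ltW al1).
    lra.
  by rewrite ger0_norm; lra.
move=> eta0.
have [||N HN] := @coefficients_vanish R E 2 EB _ j (eta / (2 * j.+1%:R)).
- move=> J; exists J.*2.+1; first by rewrite -addnn leqW// leq_addr.
  exists (2 * ((4 * J%:R + 2) * 2 ^+ J) + 4) => [|z delta z2 delta0].
    have J0 : 0 <= J%:R :> R by [].
    have : 0 <= (2 : R) ^+ J by rewrite exprn_ge0.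
    by move=> h; rewrite addr_ge0// !mulr_ge0//; lra.
  have [N HN] := ln_over_n (2 * ln z + 2 * (- ln ((1 - alpha) / 4)) + 20 + 2 * J%:R) delta0.
  exists (maxn N N0) => n; rewrite geq_max => /andP[nN nN0].
  have [n3 dn] := d_bounds nN0; have [srs urs rrs brs] := rs_roots nN0.
  have := moment_estimate alpha01 n3 dn (d_alpha nN0) (size_u nN0) (u_le1 nN0)
    (eps2 nN0) (u_dominates nN0) srs urs rrs brs J z2.
  rewrite /E nN0 => /le_trans; apply.
  rewrite addrC lerD2l; apply: le_trans (HN n nN).
  by rewrite !addrA.
- by rewrite divr_gt0// mulr_gt0.
exists (maxn N N0) => n; rewrite geq_max => /andP[nN nN0].
have := HN n nN; rewrite /E nN0 normrM normfV normrM normr_nat.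
have /andP[h1 h2] := half j.
have k0 : 0 < j.+1%:R :> R by [].
rewrite ler_pdivrMr// invfM mulrA mulfVK ?lt0r_neq0//.
rewrite (ger0_norm (_ : 0 <= 1 - _)); last by lra.
by have := normr_ge0 (m n j.+1 - equilibrium_moment alpha j.+1); nra.
Qed.

Lemma moments_cvg k (eta : R) : 0 < eta ->
  exists N, forall n, (N <= n)%N ->
    `|(\sum_(r <- rs n) r ^+ k) / n%:R - equilibrium_moment alpha k| <= eta.
Proof.
move=> eta0; case: k => [|k].
  have [N HN] := nat_archi (2 / eta).
  exists (maxn N N0) => n; rewrite geq_max => /andP[nN nN0].
  have [n3 /andP[d1 _]] := d_bounds nN0; have [srs _ _ _] := rs_roots nN0.
  have /andP[a1 a2] := d_alpha nN0.
  have n0 : 0 < n%:R :> R by rewrite ltr0n (ltn_trans _ n3).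
  under eq_bigr do rewrite expr0.
  rewrite big_const_seq count_predT iter_addr addr0 srs.
  rewrite /equilibrium_moment /= hornerX mul1r.
  have -> : (d n).-1%:R = (d n)%:R - 1 :> R by rewrite -subn1 natrB// ltnW.
  have -> : ((d n)%:R - 1) / n%:R - alpha = - ((1 + alpha * n%:R - (d n)%:R) / n%:R).
    by field; exact: lt0r_neq0.
  rewrite normrN ger0_norm ?divr_ge0//; [|lra].
  rewrite ler_pdivrMr//; have := HN n nN.
  by rewrite ler_pdivrMr// mulrC; lra.
have [N HN] := @scaled_moment_cvg k eta eta0.
exists (maxn N N0) => n; rewrite geq_max => /andP[nN nN0].
have e2 := eps2 nN0.
have := HN n nN.
have -> : m n k.+1 = eps n ^+ k.+1 * ((\sum_(r <- rs n) r ^+ k.+1) / n%:R).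
  rewrite /m mulrA; congr (_ / _); rewrite mulr_sumr.
  by apply: eq_bigr => r _; rewrite exprMn.
have ek : eps n ^+ k.+1 = if odd k.+1 then eps n else 1.
  by rewrite -[X in eps n ^+ X]odd_double_half exprD -mul2n exprM e2 expr1n mulr1; case: odd.
rewrite ek /equilibrium_moment; case: (odd k.+1); last by rewrite mul1r.
rewrite !subr0 normrM.
have -> : `|eps n| = 1 by apply/eqP; rewrite -sqrp_eq1// -normrX e2 normr1.
by rewrite mul1r.
Qed.

End moment_convergence.

(** * Moments of the equilibrium measure *)

Section real_derivatives.
Context {R : realType}.
Implicit Types (f g : R -> R) (x a b : R).

Lemma is_derive1D f g x a b : is_derive x 1 f a -> is_derive x 1 g b ->
  is_derive x 1 (fun y => f y + g y) (a + b).
Proof. by move=> df dg; exact: is_deriveD. Qed.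

Lemma is_derive1B f g x a b : is_derive x 1 f a -> is_derive x 1 g b ->
  is_derive x 1 (fun y => f y - g y) (a - b).
Proof. by move=> df dg; exact: is_deriveB. Qed.

Lemma is_derive1M f g x a b : is_derive x 1 f a -> is_derive x 1 g b ->
  is_derive x 1 (fun y => f y * g y) (a * g x + f x * b).
Proof.
move=> df dg; apply: trigger_derive (is_deriveM df dg) _.
by rewrite /GRing.scale /=; ring.
Qed.

Lemma is_derive1V g x b : g x != 0 -> is_derive x 1 g b ->
  is_derive x 1 (fun y => (g y)^-1) (- b / g x ^+ 2).
Proof.
move=> gx dg; apply: trigger_derive (is_deriveV gx dg) _.
by rewrite /GRing.scale /=; field.
Qed.

Lemma is_derive1_div f g x a b : g x != 0 ->
  is_derive x 1 f a -> is_derive x 1 g b ->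
  is_derive x 1 (fun y => f y / g y) ((a * g x - f x * b) / g x ^+ 2).
Proof.
move=> gx df dg; apply: trigger_derive (is_derive1M df (is_derive1V gx dg)) _.
by field.
Qed.

Lemma is_derive1_const (c : R) x : is_derive x 1 (fun _ : R => c) 0.
Proof. exact: is_derive_cst. Qed.

Lemma is_derive1_id x : is_derive x 1 (fun y : R => y) 1.
Proof. exact: is_derive_id. Qed.

Lemma is_derive1_pow k x :
  is_derive x 1 (fun y : R => y ^+ k) (k%:R * x ^+ k.-1).
Proof.
have -> : (fun y : R => y ^+ k) = horner 'X^k.
  by apply/funext => y; rewrite hornerXn.
apply: trigger_derive (is_derive_poly _ _) _.
by rewrite derivXn hornerMn hornerXn mulr_natl.
Qed.

Lemma is_derive1_atan_comp f x a : is_derive x 1 f a ->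
  is_derive x 1 (fun y => atan (f y)) (a / (1 + f x ^+ 2)).
Proof.
move=> df; apply: trigger_derive (is_derive1_comp (is_derive1_atan (f x)) df) _.
by rewrite mulrC.
Qed.

Lemma atan_inv x : 0 < x -> atan x^-1 = pi / 2 - atan x.
Proof.
move=> x0; have a0 : 0 < atan x by rewrite -[ltLHS]atan0 lt_atan.
have a2 := atan_ltpi2 x.
have e : tan (pi / 2 - atan x) = x^-1.
  rewrite {1}/tan sinB cosB sin_pihalf cos_pihalf !mul1r !mul0r subr0 add0r.
  by rewrite -invf_div -[X in _ = X^-1]atanK.
by rewrite -e tanK// in_itv/=; apply/andP; split; lra.
Qed.

Lemma Rintegral_FTC (f F : R -> R) a b : a < b ->
    (forall x, a <= x <= b -> {for x, continuous f}) ->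
    (forall x, a <= x <= b -> {for x, continuous F}) ->
    (forall x, a < x < b -> is_derive x 1 F (f x)) ->
  (\int[lebesgue_measure]_(x in `[a, b]) f x = F b - F a)%R.
Proof.
move=> ab cf cF dF; rewrite /Rintegral (@continuous_FTC2 _ f F a b ab).
- by [].
- by apply: continuous_in_subspaceT => x; rewrite inE/= in_itv/=; exact: cf.
- split.
  + by move=> x; rewrite in_itv/= => /dF[].
  + by apply: cvg_at_right_filter; apply: cF; rewrite lexx ltW.
  + by apply: cvg_at_left_filter; apply: cF; rewrite lexx ltW.
- by move=> x; rewrite in_itv/= => /dF[_ <-]; rewrite derive1E.
Qed.

End real_derivatives.

Section equilibrium_antiderivative.
Context {R : realType} (alpha : R).
Hypothesis alpha01 : 0 < alpha < 1.

Let r : R := Num.sqrt (1 - alpha ^+ 2).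
Let s (x : R) : R := Num.sqrt (r ^+ 2 - x ^+ 2).

(* The square root of a negative number is 0, so this extends the density on
   ]-r, r[ continuously by 1/2. *)
Definition eq_density (x : R) : R := 2^-1 - atan (s x / alpha) / pi.

(** By the half-angle formula theta is asin (x / r), in a form continuous up to the endpoints. The
    derivative of atan (alpha x / s) is alpha / ((1 - x^2) s), and [hh] is the tangent of atan (x /
    s) - atan (alpha x / s) with the divisions by s cleared, so atan (hh x) is continuous at r and -
    r too. *)
Let theta (x : R) : R := 2 * atan (x / (r + s x)).
Let hh (x : R) : R := (1 - alpha) * (x * s x) / (r ^+ 2 - (1 - alpha) * x ^+ 2).

(* Antiderivatives of x^k / sqrt (r^2 - x^2) on ]-r, r[. *)
Fixpoint arcsine_prim (k : nat) (x : R) : R :=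
  match k with
  | 0 => theta x
  | 1 => - s x
  | j.+2 => ((j%:R + 1) * r ^+ 2 * arcsine_prim j x - x ^+ j.+1 * s x) / (j%:R + 2)
  end.

(* Antiderivatives of x^k times the density on ]-r, r[, by integration by
   parts against x^(k+1) - x^(k-1): the factor 1 - x^2 of its derivative
   cancels the one in the denominator of the derivative of the density. *)
Fixpoint density_prim (k : nat) (x : R) : R :=
  match k with
  | 0 => x * eq_density x + alpha / pi * theta x - (theta x - atan (hh x)) / pi
  | 1 => ((x ^+ 2 - 1) * eq_density x + alpha / pi * arcsine_prim 1 x) / 2
  | j.+2 => ((j%:R + 1) * density_prim j x + (x ^+ j.+3 - x ^+ j.+1) * eq_density x
             + alpha / pi * arcsine_prim j.+2 x) / (j%:R + 3)
  end.

Let r2 : r ^+ 2 = 1 - alpha ^+ 2.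
Proof. by rewrite sqr_sqrtr//; have /andP[a0 a1] := alpha01; nra. Qed.

Let r_gt0 : 0 < r.
Proof. by rewrite sqrtr_gt0; have /andP[a0 a1] := alpha01; nra. Qed.

Let r_lt1 : r < 1.
Proof.
have /andP[a0 a1] := alpha01; have := r2; have := r_gt0; nra.
Qed.

Let s_r : s r = 0. Proof. by rewrite /s subrr sqrtr0. Qed.
Let s_Nr : s (- r) = 0. Proof. by rewrite /s sqrrN subrr sqrtr0. Qed.

Let s2 (x : R) : - r < x < r -> s x ^+ 2 = 1 - alpha ^+ 2 - x ^+ 2 /\ 0 < s x.
Proof.
move=> /andP[x1 x2]; have h : 0 < r ^+ 2 - x ^+ 2 by nra.
by rewrite sqr_sqrtr ?(ltW h)// r2 sqrtr_gt0.
Qed.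

Let x2_lt1 (x : R) : - r < x < r -> 0 < 1 - x ^+ 2.
Proof. by move=> /andP[x1 x2]; have := r_lt1; have := r_gt0; nra. Qed.

Let ds (x : R) : - r < x < r -> is_derive x 1 s (- x / s x).
Proof.
move=> xr; have [sx s0] := s2 xr.
have h : 0 < r ^+ 2 - x ^+ 2 by rewrite -sqrtr_gt0.
have dp : is_derive x 1 (fun y : R => r ^+ 2 - y ^+ 2) (0 - 2 * x ^+ 1).
  exact: is_derive1B (is_derive1_const _ x) (is_derive1_pow 2 x).
apply: trigger_derive (@is_derive1_comp _ _ (fun y : R => r ^+ 2 - y ^+ 2) _ _ _
  (is_derive1_sqrt h) dp) _.
by rewrite -/(s x) expr1; field; exact: lt0r_neq0.
Qed.

Let dtheta (x : R) : - r < x < r -> is_derive x 1 theta (s x)^-1.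
Proof.
move=> xr; have [sx s0] := s2 xr; have r0 := r_gt0; have rr := r2.
have rs0 : 0 < r + s x by rewrite addr_gt0.
have dq := is_derive1_div (f := fun y => y) (g := fun y => r + s y) (x := x)
  (lt0r_neq0 rs0) (is_derive1_id x)
  (is_derive1D (is_derive1_const r x) (ds xr)).
apply: trigger_derive (is_derive1M (is_derive1_const 2 x) (is_derive1_atan_comp dq)) _.
have xx : s x ^+ 2 + x ^+ 2 = r ^+ 2 by rewrite sx rr; ring.
have e1 : 1 * (r + s x) - x * (0 + - x / s x) = r * (r + s x) / s x.
  rewrite (_ : _ - _ = (r * s x + (s x ^+ 2 + x ^+ 2)) / s x); last first.
    by field; exact: lt0r_neq0.
  by rewrite xx; ring.
have e2 : 1 + (x / (r + s x)) ^+ 2 = 2 * r / (r + s x).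
  rewrite (_ : 1 + _ = (r ^+ 2 + 2 * r * s x + (s x ^+ 2 + x ^+ 2)) / (r + s x) ^+ 2).
    by rewrite xx; field; exact: lt0r_neq0.
  by field; exact: lt0r_neq0.
rewrite e1 e2; field; by rewrite !lt0r_neq0.
Qed.

Let deq_density (x : R) : - r < x < r ->
  is_derive x 1 eq_density (alpha * x / (pi * s x * (1 - x ^+ 2))).
Proof.
move=> xr; have [sx s0] := s2 xr; have /andP[a0 a1] := alpha01.
have pi0 := pi_gt0 R; have x20 := x2_lt1 xr.
have dq := is_derive1_div (g := fun=> alpha) (x := x) (lt0r_neq0 a0) (ds xr)
  (is_derive1_const alpha x).
apply: trigger_derive (is_derive1B (is_derive1_const 2^-1 x)
  (is_derive1_div (g := fun=> pi) (x := x) (lt0r_neq0 pi0)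
    (is_derive1_atan_comp dq) (is_derive1_const pi x))) _.
have -> : 1 + (s x / alpha) ^+ 2 = (1 - x ^+ 2) / alpha ^+ 2.
  by rewrite expr_div_n sx; field; exact: lt0r_neq0.
by move: (pi : R) pi0 => p pi0; field; rewrite !lt0r_neq0//.
Qed.

Let datan_hh (x : R) : - r < x < r ->
  is_derive x 1 (fun y => atan (hh y)) ((1 - alpha / (1 - x ^+ 2)) / s x).
Proof.
move=> xr; have [sx s0] := s2 xr; have /andP[a0 a1] := alpha01.
have x20 := x2_lt1 xr; have rr := r2.
have D0 : 0 < 1 - alpha ^+ 2 - (1 - alpha) * x ^+ 2 by nra.
have D0' : r ^+ 2 - (1 - alpha) * x ^+ 2 != 0 by rewrite rr lt0r_neq0.
have dxs : is_derive x 1 (fun y => y * s y) ((1 - alpha ^+ 2 - 2 * x ^+ 2) / s x).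
  apply: trigger_derive (is_derive1M (is_derive1_id x) (ds xr)) _.
  transitivity ((s x ^+ 2 - x ^+ 2) / s x).
    by move: (s x) s0 => S S0; field; exact: lt0r_neq0.
  by rewrite sx; congr (_ / _); ring.
have dD := is_derive1B (is_derive1_const (r ^+ 2) x)
  (is_derive1M (is_derive1_const (1 - alpha) x) (is_derive1_pow 2 x)).
have dq := is_derive1_div (g := fun y => r ^+ 2 - (1 - alpha) * y ^+ 2) (x := x) D0'
  (is_derive1M (is_derive1_const (1 - alpha) x) dxs) dD.
apply: trigger_derive (is_derive1_atan_comp dq) _.
have -> : 1 + ((1 - alpha) * (x * s x) / (r ^+ 2 - (1 - alpha) * x ^+ 2)) ^+ 2 =
    (1 - alpha ^+ 2) ^+ 2 * (1 - x ^+ 2) / (r ^+ 2 - (1 - alpha) * x ^+ 2) ^+ 2.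
  rewrite expr_div_n 2!exprMn sx rr; field; exact: lt0r_neq0.
rewrite (_ : (1 - alpha) * (x * s x) = (1 - alpha) * x * (s x ^+ 2) / s x); last first.
  by field; exact: lt0r_neq0.
rewrite sx expr1 rr; field.
rewrite !lt0r_neq0//; nra.
Qed.

Lemma is_derive_arcsine_prim k (x : R) : - r < x < r ->
  is_derive x 1 (arcsine_prim k) (x ^+ k / s x).
Proof.
move=> xr; have [sx s0] := s2 xr.
elim/ltn_ind: k => -[_|[_|k IH]].
- by apply: trigger_derive (dtheta xr) _; rewrite expr0 mul1r.
- apply: trigger_derive (is_deriveN (ds xr)) _.
  by rewrite mulNr opprK.
have k0 : 0 <= k%:R :> R by [].
have d0 := is_derive1M (is_derive1_const ((k%:R + 1) * r ^+ 2) x)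
  (IH k (ltnW (ltnSn k.+1))).
have d1 := is_derive1M (is_derive1_pow k.+1 x) (ds xr).
have d2 := is_derive1M (is_derive1B d0 d1) (is_derive1_const (k%:R + 2)^-1 x).
apply: trigger_derive d2 _.
transitivity (((k%:R + 1) * x ^+ k * (r ^+ 2 - s x ^+ 2) + x ^+ k * x ^+ 2) /
    (s x * (k%:R + 2))).
  rewrite -[k.+1%:R]natr1 [x ^+ k.+1]exprS /=.
  move: (s x) s0 => S S0; field; rewrite lt0r_neq0//; lra.
by rewrite sx r2 !exprS; field; rewrite lt0r_neq0//; lra.
Qed.

Let continuous_sqrt_comp (f : R -> R) (x : R) : {for x, continuous f} ->
  {for x, continuous (fun y => Num.sqrt (f y))}.
Proof. by move=> cf; apply: (continuous_comp cf); exact: sqrt_continuous. Qed.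

Let continuous_atan_comp (f : R -> R) (x : R) : {for x, continuous f} ->
  {for x, continuous (fun y => atan (f y))}.
Proof. by move=> cf; apply: (continuous_comp cf); exact: continuous_atan. Qed.

Let continuous_s : continuous s.
Proof.
move=> x; apply: (@continuous_sqrt_comp (fun y => r ^+ 2 - y ^+ 2)).
by apply: cvgB; [exact: cvg_cst|exact: exprn_continuous].
Qed.

Lemma continuous_eq_density : continuous eq_density.
Proof.
move=> x; apply: cvgB; first exact: cvg_cst.
apply: cvgM; last exact: cvg_cst.
apply: (@continuous_atan_comp (fun y => s y / alpha)).
by apply: cvgM; [exact: continuous_s|exact: cvg_cst].
Qed.

Let continuous_theta : continuous theta.
Proof.
move=> x; apply: cvgM; first exact: cvg_cst.
apply: (@continuous_atan_comp (fun y => y / (r + s y))).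
apply: cvgM; first exact: cvg_id.
apply: cvgV.
  by rewrite lt0r_neq0// ltr_pwDl// sqrtr_ge0.
by apply: cvgD; [exact: cvg_cst|exact: continuous_s].
Qed.

Let continuous_hh (x : R) : - r <= x <= r -> {for x, continuous hh}.
Proof.
move=> /andP[x1 x2]; have /andP[a0 a1] := alpha01; have r0 := r_gt0.
apply: cvgM.
  apply: cvgM; first exact: cvg_cst.
  by apply: cvgM; [exact: cvg_id|exact: continuous_s].
apply: cvgV.
  have xr : x ^+ 2 <= r ^+ 2 by nra.
  by apply: lt0r_neq0; have := exprn_gt0 2 r0; nra.
apply: cvgB; first exact: cvg_cst.
by apply: cvgM; [exact: cvg_cst|exact: exprn_continuous].
Qed.

Lemma continuous_arcsine_prim k : continuous (arcsine_prim k).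
Proof.
elim/ltn_ind: k => -[_|[_|k IH]] x.
- exact: continuous_theta.
- by apply: cvgN; exact: continuous_s.
- apply: cvgM; last exact: cvg_cst.
  apply: cvgB.
    by apply: cvgM; [exact: cvg_cst|exact: IH (ltnW (ltnSn k.+1)) x].
  by apply: cvgM; [exact: exprn_continuous|exact: continuous_s].
Qed.

Lemma is_derive_density_prim k (x : R) : - r < x < r ->
  is_derive x 1 (density_prim k) (x ^+ k * eq_density x).
Proof.
move=> xr; have [sx s0] := s2 xr; have x20 := x2_lt1 xr.
have dw := deq_density xr; have pi0 := pi_gt0 R.
elim/ltn_ind: k => -[_|[_|k IH]].
- have d1 := is_derive1M (is_derive1_id x) dw.
  have d2 := is_derive1M (is_derive1_const (alpha / pi) x) (dtheta xr).
  have d3 := is_derive1M (is_derive1B (dtheta xr) (datan_hh xr)) (is_derive1_const pi^-1 x).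
  apply: trigger_derive (is_derive1B (is_derive1D d1 d2) d3) _.
  move: (pi : R) (s x) (eq_density x) (theta x) (atan (hh x)) pi0 s0.
  move=> p S w th at' p0 S0; field; rewrite !lt0r_neq0//.
- have d1 := is_derive1M (is_derive1B (is_derive1_pow 2 x) (is_derive1_const 1 x)) dw.
  have d2 := is_derive1M (is_derive1_const (alpha / pi) x) (is_derive_arcsine_prim 1 xr).
  apply: trigger_derive (is_derive1M (is_derive1D d1 d2) (is_derive1_const 2^-1 x)) _.
  move: (pi : R) (s x) (eq_density x) (arcsine_prim 1 x) pi0 s0.
  move=> p S w th p0 S0; rewrite !expr1; field; rewrite !lt0r_neq0//.
have k0 : 0 <= k%:R :> R by [].
have d0 := is_derive1M (is_derive1_const (k%:R + 1) x) (IH k (ltnW (ltnSn k.+1))).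
have d1 := is_derive1M (is_derive1B (is_derive1_pow k.+3 x) (is_derive1_pow k.+1 x)) dw.
have d2 := is_derive1M (is_derive1_const (alpha / pi) x) (is_derive_arcsine_prim k.+2 xr).
apply: trigger_derive (is_derive1M (is_derive1D (is_derive1D d0 d1) d2)
  (is_derive1_const (k%:R + 3)^-1 x)) _.
move: (pi : R) (s x) (eq_density x) (arcsine_prim k.+2 x) (density_prim k x) pi0 s0.
move=> p S w th ph p0 S0; rewrite -[k.+1%:R]natr1.
rewrite (_ : k.+3%:R = k%:R + 3 :> R); last by rewrite -!natr1; ring.
rewrite /= !exprS; field; rewrite !lt0r_neq0//; lra.
Qed.

Lemma continuous_density_prim k (x : R) : - r <= x <= r ->
  {for x, continuous (density_prim k)}.
Proof.
move=> xr; elim/ltn_ind: k => -[_|[_|k IH]].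
- apply: cvgB.
    apply: cvgD; first by apply: cvgM; [exact: cvg_id|exact: continuous_eq_density].
    by apply: cvgM; [exact: cvg_cst|exact: continuous_theta].
  apply: cvgM; last exact: cvg_cst.
  apply: cvgB; first exact: continuous_theta.
  by apply: continuous_atan_comp; exact: continuous_hh.
- apply: cvgM; last exact: cvg_cst.
  apply: cvgD.
    apply: cvgM; last exact: continuous_eq_density.
    by apply: cvgB; [exact: exprn_continuous|exact: cvg_cst].
  by apply: cvgM; [exact: cvg_cst|exact: continuous_arcsine_prim].
apply: cvgM; last exact: cvg_cst.
apply: cvgD; last first.
  by apply: cvgM; [exact: cvg_cst|exact: continuous_arcsine_prim].
apply: cvgD.
  by apply: cvgM; [exact: cvg_cst|exact: IH (ltnW (ltnSn k.+1))].
apply: cvgM; last exact: continuous_eq_density.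
by apply: cvgB; exact: exprn_continuous.
Qed.

End equilibrium_antiderivative.

Section equilibrium_moments.
Context {R : realType} (alpha : R).
Hypothesis alpha01 : 0 < alpha < 1.

Let r : R := Num.sqrt (1 - alpha ^+ 2).

Let r2 : r ^+ 2 = 1 - alpha ^+ 2.
Proof. by rewrite sqr_sqrtr//; have /andP[a0 a1] := alpha01; nra. Qed.

Let r_gt0 : 0 < r.
Proof. by rewrite sqrtr_gt0; have /andP[a0 a1] := alpha01; nra. Qed.

Let r_lt1 : r < 1.
Proof.
have /andP[a0 a1] := alpha01; have := r2; have := r_gt0; nra.
Qed.

Lemma eq_density_outer (x : R) : r ^+ 2 <= x ^+ 2 -> eq_density alpha x = 2^-1.
Proof.
move=> rx; rewrite /eq_density ler0_sqrtr ?subr_le0//.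
by rewrite mul0r atan0 mul0r subr0.
Qed.

(** These are the moments of the arcsine law of [-r, r], times pi; the boundary terms with s vanish
    and the recursion becomes that of [wallis]. *)
Let arcsine_jump k : arcsine_prim alpha k r - arcsine_prim alpha k (- r) =
  if odd k then 0 else pi * wallis k./2 * r ^+ k.
Proof.
have sr (y : R) : y ^+ 2 = r ^+ 2 -> Num.sqrt (r ^+ 2 - y ^+ 2) = 0.
  by move=> ->; rewrite subrr sqrtr0.
elim/ltn_ind: k => -[_|[_|k IH]] /=; rewrite -/r ?sr ?sqrrN//.
- rewrite addr0 mulNr divff ?lt0r_neq0// atanN atan1 expr0 /wallis mulr1.
  by rewrite mulr1; field.
- by rewrite subrr.
rewrite !mulr0 !subr0 -mulrBl -mulrBr IH ?(ltnW (ltnSn _))// negbK.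
have k0 : 0 <= k%:R :> R by [].
case: ifP => ok; first by rewrite mulr0 mul0r.
have e : k%:R = 2 * (k./2)%:R :> R.
  by rewrite -natrM mul2n -[in LHS](odd_double_half k) ok.
by rewrite -e; move: (pi : R) => p; rewrite !exprS; field; lra.
Qed.

(** The second summand is the integral of x^k / 2 over the two outer intervals, where the density is
    constant. *)
Let total k : R := density_prim alpha k r - density_prim alpha k (- r) +
  ((- r) ^+ k.+1 - (-1) ^+ k.+1 + 1 - r ^+ k.+1) / (2 * k.+1%:R).

Let total_moment k : total k = equilibrium_moment alpha k.
Proof.
have wr : eq_density alpha r = 2^-1 by exact: eq_density_outer.
have wNr : eq_density alpha (- r) = 2^-1 by apply: eq_density_outer; rewrite sqrrN.
have pi0 := pi_gt0 R.
elim/ltn_ind: k => -[_|[_|k IH]]; rewrite /total.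
- have j0 := arcsine_jump 0; rewrite /= in j0.
  rewrite /= wr wNr -/r sqrrN subrr sqrtr0 !mulr0 !mul0r atan0 !subr0 /equilibrium_moment /=.
  rewrite hornerX expr1 /wallis mul1r.
  move: j0; rewrite -/r sqrrN subrr sqrtr0 expr0 /wallis !mulr1.
  move: (2 * atan (r / (r + 0))) (2 * atan (- r / (r + 0))) => t1 t2 t12.
  have -> : t1 = t2 + pi by rewrite -t12; ring.
  by move: (pi : R) pi0 => p p0; field; exact: lt0r_neq0.
- have j1 := arcsine_jump 1; move/subr0_eq: j1 => j1.
  rewrite /= in j1; rewrite /= wr wNr j1 sqrrN /equilibrium_moment /=.
  by rewrite !sqrrN expr1n subrr add0r subrK subrr mul0r.
have k0 : 0 <= k%:R :> R by [].
have jk := arcsine_jump k.+2.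
have := IH k (ltnW (ltnSn k.+1)); rewrite /total.
have step j x : density_prim alpha j.+2 x = ((j%:R + 1) * density_prim alpha j x +
  (x ^+ j.+3 - x ^+ j.+1) * eq_density alpha x +
  alpha / pi * arcsine_prim alpha j.+2 x) / (j%:R + 3) by [].
rewrite !step wr wNr => IHk.
have -> : arcsine_prim alpha k.+2 r = arcsine_prim alpha k.+2 (- r) +
    (if odd k.+2 then 0 else pi * wallis (k.+2)./2 * r ^+ k.+2).
  by rewrite -jk; ring.
have e3 : k.+3%:R = k%:R + 3 :> R by rewrite -!natr1; ring.
have m1 : (-1) ^+ k.+3 = (-1) ^+ k.+1 :> R by rewrite 2!exprS; ring.
(* For even k this combines the recurrences of [wallis] and [prim_beta]. The antiderivatives satisfy
   the same recurrence: their boundary terms (x^(k+3) - x^(k+1)) / 2 at r and - r are compensated by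
   the outer intervals. *)
have eqN : (k%:R + 3) * equilibrium_moment alpha k.+2 =
   (k%:R + 1) * equilibrium_moment alpha k +
   alpha * (if odd k.+2 then 0 else wallis (k.+2)./2 * r ^+ k.+2).
  rewrite /equilibrium_moment; case: ifPn => ok; rewrite /= negbK in ok *.
    by rewrite ok; ring.
  rewrite (negbTE ok).
  have e : k%:R = 2 * (k./2)%:R :> R.
    by rewrite -natrM mul2n -[in LHS](odd_double_half k) (negbTE ok).
  have w := wallisS (R := R) k./2; have b := prim_betaS k./2 alpha.
  rewrite -e in w b.
  have rk : r ^+ k.+2 = (1 - alpha ^+ 2) ^+ (k./2).+1.
    by rewrite -r2 -exprM mul2n -[in LHS](odd_double_half k) (negbTE ok) add0n doubleS.
  rewrite rk mulrCA b mulrDr.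
  by rewrite -e; field; lra.
apply: (@mulfI _ (k%:R + 3)); first by apply: lt0r_neq0; lra.
rewrite eqN -IHk e3 m1 -[k.+1%:R]natr1.
rewrite [(- r) ^+ k.+3]exprS [(- r) ^+ k.+2]exprS [r ^+ k.+3]exprS [r ^+ k.+2]exprS.
move: (density_prim _ _ _) (density_prim _ _ _) (arcsine_prim _ _ _) => a b c.
move: ((- r) ^+ k.+1) (r ^+ k.+1) ((-1) ^+ k.+1) (wallis _) => x y z w.
move: (pi : R) pi0 => p p0.
case: ifP => _; field; rewrite ?(lt0r_neq0 p0)/=; lra.
Qed.

Lemma integral_eq_density k :
  (\int[lebesgue_measure]_(x in `[-1, 1]) (x ^+ k * eq_density alpha x) =
   equilibrium_moment alpha k)%R.
Proof.
have r0 := r_gt0; have r1 := r_lt1.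
pose f (x : R) := x ^+ k * eq_density alpha x.
have cf : continuous f.
  move=> x; apply: cvgM; first exact: exprn_continuous.
  exact: continuous_eq_density.
have intf (a b : R) : lebesgue_measure.-integrable `[a, b] (EFin \o f).
  apply: continuous_compact_integrable; first exact: segment_compact.
  exact: continuous_subspaceT.
have mid : (\int[lebesgue_measure]_(x in `[- r, r]) f x =
    density_prim alpha k r - density_prim alpha k (- r))%R.
  apply: Rintegral_FTC => [|x _|x xr|x xr]; first by lra.
  - exact: cf.
  - exact: continuous_density_prim.
  - exact: is_derive_density_prim.
have outer (a b : R) : a < b -> (forall x, a <= x <= b -> r ^+ 2 <= x ^+ 2) ->
    (\int[lebesgue_measure]_(x in `[a, b]) f x =
     (b ^+ k.+1 - a ^+ k.+1) / (2 * k.+1%:R))%R.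
  move=> ab rab; rewrite mulrBl.
  apply: (@Rintegral_FTC _ f (fun x => x ^+ k.+1 / (2 * k.+1%:R))) => // [x _|x _|x xab].
  - exact: cf.
  - by apply: cvgM; [exact: exprn_continuous|exact: cvg_cst].
  apply: trigger_derive (is_derive1M (is_derive1_pow k.+1 x) (is_derive1_const _ x)) _.
  have /andP[ax xb] := xab.
  rewrite /f eq_density_outer; last by apply: rab; rewrite !ltW.
  have k0 : 0 <= k%:R :> R by [].
  by rewrite mulr0 addr0 /= -[k.+1%:R]natr1; field; lra.
have split (a b c : R) : a <= b -> b <= c ->
    (\int[lebesgue_measure]_(x in `[a, c]) f x =
     \int[lebesgue_measure]_(x in `[a, b]) f x +
     \int[lebesgue_measure]_(x in `[b, c]) f x)%R.
  move=> ab bc; have := @Rintegral_itvB R f (BLeft a) (BRight c) b (intf a c).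
  rewrite !bnd_simp => /(_ ab bc); rewrite Rintegral_itv_obnd_cbnd; last first.
    apply: integrableS (intf b c) => //.
    by apply: subset_itvr; rewrite bnd_simp.
  by move=> <-; rewrite addrC subrK.
rewrite -/f (@split (-1) (- r) 1); [|lra|lra].
rewrite (@split (- r) r 1); [|lra|lra].
rewrite mid outer; [|lra|]; last by move=> x /andP[x1 x2]; nra.
rewrite outer; [|lra|]; last by move=> x /andP[x1 x2]; nra.
rewrite -total_moment /total expr1n.
by ring.
Qed.

End equilibrium_moments.

(** * Weierstrass approximation and weak convergence *)

Section bernstein.
Context {R : realType}.

Lemma uniform_continuity_segment (f : R -> R) (eps : R) : continuous f -> 0 < eps ->
  exists2 delta, 0 < delta & forall x y : R, 0 <= x <= 1 -> `|y - x| < delta ->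
    `|f y - f x| <= eps.
Proof.
move=> cf eps0.
have cpt : compact (`[0, 1] : set R) by exact: segment_compact.
have nc := (@compact_near_coveringP R `[0, 1]).1 cpt.
pose P (d x : R) := forall y, `|y - x| < d -> `|f y - f x| <= eps.
have cov (x : R) : [set` `[0, 1]] x -> \forall x' \near x & d \near 0^'+, P d x'.
  move=> _; have /cvgrPdist_lt/(_ (eps / 2)) := cf x.
  move=> /(_ (divr_gt0 eps0 (ltr0n _ 2)))/nbhs_ballP[eta /= eta0 H].
  have e20 : 0 < eta / 2 by rewrite divr_gt0.
  exists (ball x (eta / 2), [set d | d < eta / 2]); first split => /=.
  - exact: nbhsx_ballx.
  - exact: nbhs_right_lt.
  move=> [x' d] /= [xx' de] y yd; rewrite /ball/= in xx'.
  have h1 : `|f x - f x'| < eps / 2 by apply: H; rewrite /ball/=; lra.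
  have h2 : `|f x - f y| < eps / 2.
    apply: H; rewrite /ball/=.
    have := ler_distD x' x y; rewrite (distrC x' y); lra.
  have := ler_distD (f x) (f y) (f x'); rewrite (distrC (f y) (f x)); lra.
have H := nc R (0^'+) P _ cov.
near (0 : R)^'+ => d.
exists d => // x y x01 yx.
have Hd : [set` `[0, 1]] `<=` P d by near: d; exact: H.
by apply: (Hd x); rewrite /= ?in_itv.
Unshelve. all: by end_near.
Qed.

(* [bern N g x] is the expectation of g(S) for a binomial variable S of
   parameters N and x, defined by conditioning on the first trial. *)
Fixpoint bern (N : nat) (g : nat -> R) (x : R) : R :=
  if N is M.+1 then x * bern M (g \o S) x + (1 - x) * bern M g x else g 0%N.

Lemma bern_poly N g : exists p : {poly R}, forall x, p.[x] = bern N g x.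
Proof.
elim: N g => [|N IH] g; first by exists (g 0%N)%:P => x; rewrite hornerC.
have [p pE] := IH (g \o S); have [q qE] := IH g.
exists ('X * p + (1 - 'X) * q) => x.
by rewrite hornerD !hornerM hornerD hornerN hornerX hornerC pE qE.
Qed.

Lemma bern_le N g h x : 0 <= x <= 1 -> (forall k, (k <= N)%N -> g k <= h k) ->
  bern N g x <= bern N h x.
Proof.
move=> /andP[x0 x1]; elim: N g h => [|N IH] g h gh /=; first exact: gh.
apply: lerD; apply: ler_wpM2l; rewrite ?subr_ge0//; apply: IH => k kN.
  by apply: gh.
by apply: gh; exact: leq_trans kN _.
Qed.

Lemma bern_affine N g (a b : R) x :
  bern N (fun k => a + b * g k) x = a + b * bern N g x.
Proof.
by elim: N g => [//|N IH] g /=; rewrite IH (IH (g \o S)); ring.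
Qed.

Lemma bern_variance N (a x : R) :
  bern N (fun k => (k%:R - a) ^+ 2) x = N%:R * x * (1 - x) + (N%:R * x - a) ^+ 2.
Proof.
elim: N a => [|N IH] a /=; first by ring.
have -> : bern N ((fun k => (k%:R - a) ^+ 2) \o S) x =
    bern N (fun k => (k%:R - (a - 1)) ^+ 2) x.
  by congr bern; apply/funext => k /=; rewrite -natr1; congr (_ ^+ 2); ring.
by rewrite !IH -[N.+1%:R]natr1; ring.
Qed.

Lemma weierstrass01 (f : R -> R) (eps : R) : continuous f -> 0 < eps ->
  exists p : {poly R}, forall x, 0 <= x <= 1 -> `|f x - p.[x]| <= eps.
Proof.
move=> cf eps0.
have [d d0 Hd] := uniform_continuity_segment cf (divr_gt0 eps0 (ltr0n _ 2)).
have [B HB] : exists B, forall x, 0 <= x <= 1 -> `|f x| <= B.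
  have cn : continuous (fun x => `|f x|).
    by move=> x; apply: continuous_comp; [exact: cf|exact: norm_continuous].
  have [c _ Hc] := @EVT_max R (fun x => `|f x|) 0 1 ler01 (continuous_subspaceT cn).
  by exists `|f c| => x x01; apply: Hc; rewrite in_itv.
have B0 : 0 <= B by apply: le_trans (HB 0 _); rewrite ?lexx ?ler01.
pose C := 2 * B / d ^+ 2.
have d20 : 0 < d ^+ 2 by rewrite exprn_gt0.
have C0 : 0 <= C by rewrite divr_ge0 ?mulr_ge0// ltW.
(* Uniform continuity covers |y - x| < d and the bound B the rest. As [bern] is monotone and affine
   in its function argument, this reduces the error to the variance, which is x (1 - x) / N:
   Chebyshev's inequality in disguise. *)
have mod (x y : R) : 0 <= x <= 1 -> 0 <= y <= 1 -> `|f y - f x| <= eps / 2 + C * (y - x) ^+ 2.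
  move=> x01 y01; have [near|far] := ltP `|y - x| d.
    by apply: le_trans (Hd x y x01 near) _; rewrite lerDl mulr_ge0 ?sqr_ge0.
  apply: le_trans (ler_normB _ _) _.
  have h1 := HB x x01; have h2 := HB y y01.
  have dd : d ^+ 2 <= (y - x) ^+ 2.
    by rewrite -[leRHS]real_normK ?num_real//; apply: lerXn2r; rewrite ?nnegrE ?(ltW d0).
  have : 2 * B <= C * (y - x) ^+ 2.
    by rewrite /C mulrAC ler_pdivlMr// ler_wpM2l// mulr_ge0.
  by have := eps0; lra.
pose N := (Num.bound (C / (eps / 2))).+1.
have N0 : 0 < N%:R :> R by [].
have NC : C / N%:R <= eps / 2.
  have q0 : 0 <= C / (eps / 2) by rewrite divr_ge0// divr_ge0// ltW.
  rewrite ler_pdivrMr// mulrC -ler_pdivrMr ?divr_gt0//.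
  apply: le_trans (ltW (archi_boundP q0)) _; by rewrite ler_nat leqnSn.
have [p pE] := bern_poly N (fun k => f (k%:R / N%:R)).
exists p => x x01; rewrite pE.
have kN k : (k <= N)%N -> 0 <= (k%:R / N%:R : R) <= 1.
  by move=> kn; rewrite divr_ge0//= ler_pdivrMr// mul1r ler_nat.
have var : bern N (fun k => (k%:R / N%:R - x) ^+ 2) x <= N%:R^-1.
  have -> : (fun k : nat => (k%:R / N%:R - x) ^+ 2) =
      (fun k : nat => 0 + (N%:R ^+ 2)^-1 * (k%:R - N%:R * x) ^+ 2).
    by apply/funext => k; field; exact: lt0r_neq0.
  rewrite bern_affine add0r bern_variance subrr expr0n/= addr0.
  have -> : (N%:R ^+ 2)^-1 * (N%:R * x * (1 - x)) = x * (1 - x) * N%:R^-1.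
    by field; exact: lt0r_neq0.
  by rewrite ler_piMl ?invr_ge0//; have /andP[? ?] := x01; nra.
have bnd : eps / 2 + C * bern N (fun k => (k%:R / N%:R - x) ^+ 2) x <= eps.
  have := ler_wpM2l C0 var; lra.
have up : bern N (fun k => f (k%:R / N%:R)) x <=
    bern N (fun k => (f x + eps / 2) + C * (k%:R / N%:R - x) ^+ 2) x.
  apply: bern_le => // k kn; have := mod x _ x01 (kN k kn).
  by rewrite ler_norml => /andP[_]; lra.
have lo : bern N (fun k => (f x - eps / 2) + (- C) * (k%:R / N%:R - x) ^+ 2) x <=
    bern N (fun k => f (k%:R / N%:R)) x.
  apply: bern_le => // k kn; have := mod x _ x01 (kN k kn).
  by rewrite ler_norml => /andP[+ _]; lra.
rewrite bern_affine in up; rewrite bern_affine in lo.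
by rewrite ler_norml; apply/andP; split; lra.
Qed.

Lemma weierstrass (f : R -> R) (eps : R) : continuous f -> 0 < eps ->
  exists p : {poly R}, forall x, -1 <= x <= 1 -> `|f x - p.[x]| <= eps.
Proof.
move=> cf eps0; pose g (y : R) := f (2 * y - 1).
have cg : continuous g.
  have ca : continuous (fun y : R => 2 * y - 1).
    move=> y; apply: cvgB; last exact: cvg_cst.
    by apply: cvgM; [exact: cvg_cst|exact: cvg_id].
  by move=> y; exact: (continuous_comp (ca y) (cf _)).
have [p Hp] := weierstrass01 cg eps0.
exists (p \Po (2^-1%:P * ('X + 1%:P))) => x /andP[x0 x1].
have := Hp ((x + 1) / 2); rewrite /g.
rewrite horner_comp hornerM hornerD hornerX !hornerC [2^-1 * _]mulrC.
rewrite (_ : 2 * ((x + 1) / 2) - 1 = x); last by field.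
by apply; apply/andP; split; lra.
Qed.

End bernstein.

(** * Integration against a measure with a density *)

Section density.
Local Open Scope ereal_scope.
Context d (T : measurableType d) (R : realType).
Variables (mu nu : {measure set T -> \bar R}) (w : T -> R).
Hypothesis w0 : forall x, (0 <= w x)%R.
Hypothesis mw : measurable_fun [set: T] w.
Hypothesis nuE : forall A, measurable A -> nu A = \int[mu]_(x in A) (w x)%:E.

Import HBNNSimple.

Let mwE : measurable_fun [set: T] (fun x => (w x)%:E).
Proof. exact/measurable_EFinP. Qed.

Let integral_density_indic (A : set T) (r : R) : (0 <= r)%R -> measurable A ->
  \int[nu]_x (r * \1_A x)%:E = \int[mu]_x ((r * \1_A x)%:E * (w x)%:E).
Proof.
move=> r0 mA.
under eq_integral do rewrite EFinM.
under [RHS]eq_integral do rewrite EFinM -muleA.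
rewrite !ge0_integralZl//.
- rewrite integral_indic// setIT nuE// [in LHS]integral_mkcond; congr (_ * _).
  apply: eq_integral => x _; rewrite patchE indicE.
  by case: (x \in A); rewrite ?mul1e ?mul0e.
- by apply: emeasurable_funM => //; exact/measurable_EFinP.
- by move=> x _; rewrite -EFinM lee_fin mulr_ge0.
- exact/measurable_EFinP.
Qed.

Let integral_density_nnsfun (h : {nnsfun T >-> R}) :
  \int[nu]_x (h x)%:E = \int[mu]_x ((h x)%:E * (w x)%:E).
Proof.
have mh r : measurable (h @^-1` [set r]).
  exact: measurable_sfunP.
have m1 r : measurable_fun [set: T] (fun x => (r * \1_(h @^-1` [set r]) x)%:E).
  by apply/measurable_EFinP; apply: measurable_funM.
transitivity (\int[nu]_x (\sum_(r \in range h) (r * \1_(h @^-1` [set r]) x)%:E)).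
  by apply: eq_integral => x _; rewrite fimfunE -fsumEFin.
rewrite ge0_integral_fsum//; last by move=> r x _; rewrite /= EFinM nnfun_muleindic_ge0.
transitivity (\int[mu]_x (\sum_(r \in range h)
    (r * \1_(h @^-1` [set r]) x)%:E * (w x)%:E)); last first.
  apply: eq_integral => x _; rewrite fimfunE -fsumEFin// ge0_mule_fsuml// => r.
  rewrite EFinM; exact: nnfun_muleindic_ge0.
rewrite ge0_integral_fsum//.
- apply: eq_fsbigr => r; rewrite inE => -[x _ <-].
  exact: integral_density_indic.
- by move=> r; exact: emeasurable_funM.
- move=> r x _; apply: mule_ge0; last by rewrite lee_fin.
  by rewrite EFinM; exact: nnfun_muleindic_ge0.
Qed.

Lemma ge0_integral_density (f : T -> \bar R) : measurable_fun [set: T] f ->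
  (forall x, 0 <= f x) -> \int[nu]_x f x = \int[mu]_x (f x * (w x)%:E).
Proof.
move=> mf f0; pose h := nnsfun_approx measurableT mf.
have cvgh x : EFin \o h^~ x @ \oo --> f x by exact: cvg_nnsfun_approx.
transitivity (limn (fun n => \int[nu]_x (h n x)%:E)).
  rewrite -monotone_convergence//.
  - by apply: eq_integral => x _; apply/esym/cvg_lim => //; exact: cvgh.
  - by move=> n; exact/measurable_EFinP.
  - by move=> n x _; rewrite lee_fin.
  - by move=> x _ m n mn; rewrite lee_fin; exact/lefP/nd_nnsfun_approx.
transitivity (limn (fun n => \int[mu]_x ((h n x)%:E * (w x)%:E))).
  by congr (limn _); apply/funext => n; exact: integral_density_nnsfun.
rewrite -monotone_convergence//.
- apply: eq_integral => x _; apply/cvg_lim => //.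
  by apply: cvgeZr => //; exact: cvgh.
- by move=> n; apply: emeasurable_funM => //; exact/measurable_EFinP.
- by move=> n x _; rewrite mule_ge0// lee_fin.
- move=> x _ m n mn; rewrite lee_wpmul2r ?lee_fin//.
  exact/lefP/nd_nnsfun_approx.
Qed.

End density.

Section integrals.
Context {R : realType}.

Lemma measurable_continuousC (f : R[i]^o -> R) : continuous f ->
  measurable_fun [set: @borelC R] (f : @borelC R -> R).
Proof.
move=> /continuousP cf; apply: (measurability _ (RGenOpens.measurableE R)).
move=> _ [_ [a [b ->] <-]]; rewrite setTI.
by apply: sub_sigma_algebra; apply: cf; exact: interval_open.
Qed.

Lemma integral_zero_counting n (p : {poly R[i]}) (f : R[i]^o -> R) :
  continuous f -> (forall z, 0 <= f z) ->
  (\int[zero_counting n p]_z (f z)%:E)%E =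
  ((\sum_(z <- zeros p) f z) / n%:R)%:E.
Proof.
move=> cf f0.
have mf : measurable_fun [set: @borelC R] (fun z => (f z)%:E).
  by apply/measurable_EFinP; exact: measurable_continuousC.
rewrite ge0_integral_mscale//=; last by move=> z _; rewrite lee_fin.
rewrite ge0_integral_measure_sum//; last by move=> z _; rewrite lee_fin.
under [X in (_ * X)%E]eq_bigr do rewrite integral_dirac// diracT mul1e.
by rewrite sumEFin -EFinM mulrC (big_nth 0) big_mkord.
Qed.

End integrals.

Section equilibrium_integral.
Context {R : realType} (alpha : R).
Hypothesis alpha01 : 0 < alpha < 1.

Lemma equilibrium_densityE (x : R) : equilibrium_density alpha x =
  if -1 <= x <= 1 then eq_density alpha x else 0.
Proof.
have /andP[a0 a1] := alpha01.
rewrite /equilibrium_density; set r := Num.sqrt _.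
have r2 : r ^+ 2 = 1 - alpha ^+ 2 by rewrite sqr_sqrtr//; nra.
have r0 : 0 < r by rewrite sqrtr_gt0; nra.
have r1 : r < 1 by nra.
rewrite !in_itv/=; case: ifPn => [out|].
  have x1 : -1 <= x <= 1.
    by apply/andP; case/orP: out => /andP[h1 h2]; split; lra.
  rewrite x1 eq_density_outer// -/r.
  by case/orP: out => /andP[h1 h2]; nra.
case: ifPn => [/andP[rx xr] _|].
  have x1 : -1 <= x <= 1 by apply/andP; split; lra.
  rewrite x1 /eq_density -/r.
  have h : 0 < r ^+ 2 - x ^+ 2 by nra.
  rewrite -[alpha / _]invf_div atan_inv ?divr_gt0 ?sqrtr_gt0//.
  have p0 := pi_gt0 R; move: (atan _) (pi : R) p0 => t q q0.
  by field; rewrite gt_eqF.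
rewrite !negb_and !negb_or !negb_and -!ltNge -!leNgt => h1 h2.
rewrite ifF//; apply/negP => /andP[h3 h4]; move: h1 h2.
by case/orP => h1; rewrite andbC => /andP[/orP[h5|h5] /orP[h6|h6]]; lra.
Qed.

Lemma integral_equilibriumC (f : R[i]^o -> R) :
  continuous f -> (forall z, 0 <= f z) ->
  (\int[equilibrium_measureC alpha01]_z (f z)%:E)%E =
  (\int[lebesgue_measure]_(x in `[(-1)%R, 1%R]) (f x%:C * eq_density alpha x)%:E)%E.
Proof.
move=> cf f0.
have mf : measurable_fun [set: @borelC R] (fun z => (f z)%:E).
  by apply/measurable_EFinP; exact: measurable_continuousC.
transitivity (\int[equilibrium_measure alpha01]_x (f x%:C)%:E)%E.
  by rewrite (ge0_integral_pushforward (@measurable_real_complex R))// => z _;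
    rewrite lee_fin.
rewrite (ge0_integral_density (mu := lebesgue_measure)
  (w := equilibrium_density alpha))//.
- rewrite [RHS]integral_mkcond; apply: eq_integral => x _.
  rewrite patchE equilibrium_densityE -EFinM.
  rewrite mem_setE in_itv/=; case: ifPn => //.
  by rewrite mulr0.
- by move=> x; exact: equilibrium_density_ge0.
- exact: measurable_equilibrium_density.
- exact: (measurableT_comp mf (@measurable_real_complex R)).
- by move=> x; rewrite lee_fin.
Qed.

End equilibrium_integral.

(** * From moments to continuous test functions *)

Section averages.
Context {R : realType} (alpha : R).
Hypothesis alpha01 : 0 < alpha < 1.
Variables (rs : nat -> seq R) (N0 : nat).
Hypothesis size_rs : forall n, (N0 <= n)%N -> (size (rs n) <= n)%N.
Hypothesis rs_bounds : forall n, (N0 <= n)%N ->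
  all (fun x => -1 < x < 1) (rs n).
Hypothesis moments : forall k eta, 0 < eta -> exists N, forall n, (N <= n)%N ->
  `|(\sum_(r <- rs n) r ^+ k) / n%:R - equilibrium_moment alpha k| <= eta.

Let average (g : R -> R) n : R := (\sum_(r <- rs n) g r) / n%:R.

Let I (g : R -> R) : R :=
  (\int[lebesgue_measure]_(x in `[(-1)%R, 1%R]) (g x * eq_density alpha x))%R.

Let integrableM (g : R -> R) : continuous g ->
  lebesgue_measure.-integrable `[(-1)%R, 1%R]
    (EFin \o (fun x => g x * eq_density alpha x)).
Proof.
move=> cg; apply: continuous_compact_integrable; first exact: segment_compact.
apply: continuous_subspaceT => x; apply: cvgM; first exact: cg.
exact: continuous_eq_density.
Qed.

Let ID (g h : R -> R) : continuous g -> continuous h ->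
  I (fun x => g x + h x) = I g + I h.
Proof.
move=> cg ch; rewrite /I -RintegralD//; [|exact: integrableM..].
by apply: eq_Rintegral => x _; rewrite mulrDl.
Qed.

Let IZ (a : R) (g : R -> R) : continuous g -> I (fun x => a * g x) = a * I g.
Proof.
move=> cg; rewrite /I -RintegralZl//; last exact: integrableM.
by apply: eq_Rintegral => x _; rewrite mulrA.
Qed.

Let I_monotone (g h : R -> R) : continuous g -> continuous h ->
  (forall x, -1 <= x <= 1 -> g x <= h x) -> I g <= I h.
Proof.
move=> cg ch gh; apply: le_Rintegral => //; [exact: integrableM..|].
move=> x; rewrite /= in_itv/= => x1; rewrite ler_wpM2r ?gh//.
have := equilibrium_density_ge0 x alpha01.
by rewrite equilibrium_densityE// x1.
Qed.

Let I_monomial k : I (fun x => x ^+ k) = equilibrium_moment alpha k.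
Proof. exact: integral_eq_density. Qed.

Let I1_le1 : 0 <= I (fun x => x ^+ 0) <= 1.
Proof.
have /andP[a0 a1] := alpha01.
rewrite I_monomial; apply/andP; split; last first.
  apply: le_trans (ler_norm _) (equilibrium_moment_bound 0 _).
  by rewrite (ltW a0) (ltW a1).
rewrite -I_monomial; apply: Rintegral_ge0 => x; rewrite /= in_itv/= => x1.
rewrite expr0 mul1r.
by have := equilibrium_density_ge0 x alpha01; rewrite equilibrium_densityE// x1.
Qed.

Let continuous_sum (a : nat -> R) m :
  continuous (fun x : R => \sum_(i < m) a i * x ^+ i).
Proof.
elim: m => [|m IH] x.
  by under eq_fun do rewrite big_ord0; exact: cvg_cst.
under eq_fun do rewrite big_ord_recr/=.
apply: cvgD; first exact: IH.
by apply: cvgM; [exact: cvg_cst|exact: exprn_continuous].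
Qed.

Let average_sum_cvg (a : nat -> R) m :
  average (fun x => \sum_(i < m) a i * x ^+ i) n @[n --> \oo] -->
  I (fun x => \sum_(i < m) a i * x ^+ i).
Proof.
elim: m => [|m IH].
  rewrite (_ : average _ = fun=> 0); last first.
    by apply/funext => n; rewrite /average big1 ?mul0r// => i _; rewrite big_ord0.
  rewrite (_ : I _ = 0); first exact: cvg_cst.
  rewrite /I -[RHS](Rintegral_set0 lebesgue_measure (fun=> 0)).
  rewrite Rintegral_mkcond [RHS]Rintegral_mkcond; apply: eq_Rintegral => x _.
  by rewrite !patchE big_ord0 mul0r !if_same.
have -> : (fun x : R => \sum_(i < m.+1) a i * x ^+ i) =
    (fun x => \sum_(i < m) a i * x ^+ i + a m * x ^+ m).
  by apply/funext => x; rewrite big_ord_recr.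
rewrite ID; [|exact: continuous_sum|]; last first.
  by move=> x; apply: cvgM; [exact: cvg_cst|exact: exprn_continuous].
rewrite IZ; last exact: exprn_continuous.
have -> : average (fun x => \sum_(i < m) a i * x ^+ i + a m * x ^+ m) =
    (fun n => average (fun x => \sum_(i < m) a i * x ^+ i) n +
              a m * average (fun x => x ^+ m) n).
  apply/funext => n; rewrite /average big_split/= -mulr_sumr mulrDl.
  by rewrite mulrA.
apply: cvgD => //; apply: cvgM; first exact: cvg_cst.
apply/cvgrPdist_le => e e0; rewrite I_monomial.
have [N HN] := moments m e0.
by exists N => // n /= Nn; rewrite distrC; exact: HN.
Qed.

Let hornerE_sum (q : {poly R}) :
  horner q = fun x => \sum_(i < size q) q`_i * x ^+ i.
Proof. by apply/funext => x; exact: horner_coef. Qed.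

(** Replacing F by a polynomial within e / 3 on [-1, 1] moves both functionals by at most e / 3: the
    average has at most n terms divided by n, and the limit functional is monotone of total mass at
    most 1. *)
Lemma average_cvg (F : R -> R) : continuous F ->
  average F n @[n --> \oo] --> I F.
Proof.
move=> cF; apply/cvgrPdist_le => e e0.
have e3 : 0 < e / 3 by rewrite divr_gt0.
have [q Hq] := weierstrass cF e3.
have cq : continuous (horner q) by exact: continuous_horner.
have : average (horner q) n @[n --> \oo] --> I (horner q).
  by have := @average_sum_cvg (fun i => q`_i) (size q); rewrite -hornerE_sum.
move=> /cvgrPdist_le/(_ _ e3) [N _ HN].
have c0 : continuous (fun x : R => x ^+ 0) by exact: exprn_continuous.
have c1 : continuous (fun x : R => e / 3 * x ^+ 0).
  by move=> x; apply: cvgM; [exact: cvg_cst|exact: exprn_continuous].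
have IFq : `|I F - I (horner q)| <= e / 3.
  have /andP[i0 i1] := I1_le1.
  have ub : e / 3 * I (fun x => x ^+ 0) <= e / 3 by rewrite ler_piMr// (ltW e3).
  have l1 : I F <= I (horner q) + e / 3 * I (fun x => x ^+ 0).
    rewrite -IZ// -ID//; apply: I_monotone => // [x|x x1].
      by apply: cvgD; [exact: cq|exact: c1].
    by have := Hq x x1; rewrite ler_norml expr0 => /andP[]; lra.
  have l2 : I (horner q) <= I F + e / 3 * I (fun x => x ^+ 0).
    rewrite -IZ// -ID//; apply: I_monotone => // [x|x x1].
      by apply: cvgD; [exact: cF|exact: c1].
    by have := Hq x x1; rewrite ler_norml expr0 => /andP[]; lra.
  by rewrite ler_norml; apply/andP; split; lra.
exists (maxn N (maxn N0 1)) => // n /=; rewrite !geq_max => /and3P[Nn N0n n1].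
have n0 : 0 < n%:R :> R by rewrite ltr0n.
have avq : `|average F n - average (horner q) n| <= e / 3.
  rewrite /average -mulrBl -sumrB normrM normfV (ger0_norm (ltW n0)).
  rewrite ler_pdivrMr//; apply: le_trans (ler_norm_sum _ _ _) _.
  apply: (@le_trans _ _ (\sum_(x <- rs n) e / 3)).
    rewrite big_seq [leRHS]big_seq; apply: ler_sum => x xr; apply: Hq.
    by have /allP/(_ _ xr)/andP[h1 h2] := rs_bounds N0n; rewrite (ltW h1) (ltW h2).
  rewrite big_const_seq count_predT iter_addr_0 -(mulr_natr (e / 3)) ler_wpM2l ?(ltW e3)//.
  by rewrite ler_nat size_rs.
have := HN n Nn; move: IFq avq; rewrite !ler_norml.
move=> /andP[? ?] /andP[? ?] /andP[? ?]; apply/andP; split; lra.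
Qed.

End averages.

Section zeros.
Context {R : realType}.
Notation toC := (real_complex R).

Lemma root_zeros (p : {poly R[i]}) z : p != 0 -> root p z = (z \in zeros p).
Proof.
by move=> p0; rewrite [in LHS](zerosE p) rootZ ?lead_coef_eq0// root_prod_XsubC.
Qed.

Lemma size_zeros (p : {poly R[i]}) : p != 0 -> (size (zeros p)).+1 = size p.
Proof.
move=> p0; rewrite [in RHS](zerosE p) size_scale ?lead_coef_eq0//.
by rewrite size_prod_XsubC.
Qed.

(** The known roots are distinct and miss the degree by at most one, so they account for the zeros
    with multiplicity up to the single exceptional zero collected in [e]. *)
Lemma zeros_perm_real_roots (c : R[i]) (u : {poly R}) (s : seq R) :
  c *: map_poly toC u != 0 -> uniq s -> all (root u) s ->
  (size u <= (size s).+2)%N ->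
  exists2 e, (size e <= 1)%N & perm_eq (zeros (c *: map_poly toC u)) (map toC s ++ e).
Proof.
set p := _ *: _ => p0 us rs su.
have c0 : c != 0 by apply: contraNneq p0 => c0; rewrite /p c0 scale0r.
have sub x : (count_mem x (map toC s) <= count_mem x (zeros p))%N.
  rewrite count_uniq_mem ?map_inj_uniq//; last exact: (fmorph_inj toC).
  case: (boolP (x \in _)) => // /mapP[y ys ->]; rewrite -has_count has_pred1.
  rewrite -root_zeros// rootZ// /root horner_real_complex.
  by have /allP/(_ _ ys)/eqP-> := rs; rewrite eqxx.
have /count_subseqP[t /perm_to_subseq[e pe] st] := sub.
exists e; last by rewrite (perm_trans pe)// perm_cat2r perm_sym.
have := size_zeros p0.
rewrite (perm_size pe) size_cat -(perm_size st) size_map size_scale//.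
by rewrite size_map_poly => h; move: su; rewrite -h -addnS -addn2 leq_add2l.
Qed.

End zeros.

Section continuous.
Context {R : realType}.

Lemma continuous_real_complex : continuous (fun x : R => x%:C : R[i]^o).
Proof.
move=> x; apply/cvgrPdist_lt => e e0.
move: e e0 => [e e'] /andP[/eqP/= ie e0]; rewrite /= in ie e0.
exists e => //= y xy.
rewrite -rmorphB /= normc_def /= expr0n addr0 sqrtr_sqr.
by rewrite ltcE /= ie eqxx.
Qed.

Lemma compactly_supported_bounded (f : R[i]^o -> R) :
  continuous f -> compactly_supported f -> exists B, forall z, `|f z| <= B.
Proof.
move=> cf cs.
have : compact (f @` closure [set z | f z != 0]).
  by apply: continuous_compact => //; exact: continuous_subspaceT.
move=> /(@compact_bounded R R^o)[M [_ HM]].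
have {}HM := HM (M + 1) (ltac:(by rewrite ltrDl)).
exists (Num.max (M + 1) 0) => z; rewrite le_max; have [->|z0] := eqVneq (f z) 0.
  by rewrite normr0 lexx orbT.
by rewrite HM//; exists z => //; apply: subset_closure.
Qed.

End continuous.

Section weak_convergence.
Context {R : realType} (alpha : R).
Hypothesis alpha01 : 0 < alpha < 1.
Variable p : nat -> {poly R[i]}.
Hypothesis p_extremal : forall n : nat, (2 <= n)%N -> extremal alpha n (p n).

Let toC := (real_complex R).
Let d n : nat := Num.truncn (alpha * n%:R).

Let alphan_ge0 n : 0 <= alpha * n%:R.
Proof. by have /andP[a0 _] := alpha01; rewrite mulr_ge0// (ltW a0). Qed.

Let dE n k : (k%:R <= alpha * n%:R) = (k <= d n)%N.
Proof. by rewrite truncn_ge_nat. Qed.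

Let d_bounds : exists N0, forall n, (N0 <= n)%N ->
  (2 < n)%N /\ (1 < d n < n)%N.
Proof.
have /andP[a0 a1] := alpha01.
have [N HN] := nat_archi (2 / alpha); exists (maxn N 3) => n.
rewrite geq_max => /andP[nN n3]; split => //; rewrite -dE.
have := HN n nN; rewrite ler_pdivrMr// mulrC => -> /=.
rewrite ltnNge -dE -ltNge gtr_pMl// ltr0n.
exact: leq_ltn_trans n3.
Qed.

Let root_average_cvg : exists rs : nat -> seq R,
  (exists N, forall n, (N <= n)%N -> exists2 e, (size e <= 1)%N &
     perm_eq (zeros (p n)) (map toC (rs n) ++ e)) /\
  forall F : R -> R, continuous F ->
    (\sum_(x <- rs n) F x) / n%:R @[n --> \oo] -->
    (\int[lebesgue_measure]_(x in `[(-1)%R, 1%R]) (F x * eq_density alpha x))%R.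
Proof.
have [N0 HN0] := d_bounds.
have /choice[t Ht] : forall n, exists t : {poly R} * R * seq R, (N0 <= n)%N ->
    [/\ exists2 c, c != 0 & p n = c *: map_poly toC t.1.1,
        (size t.1.1 <= (d n).+1)%N /\
          (forall j, (j < n)%N -> `|t.1.1.[grid_point n j]| <= 1),
        t.1.2 ^+ 2 = 1, (forall z (q : {poly R}), 1 <= z -> (size q <= d n)%N ->
           (forall j, (j < n)%N -> `|q.[grid_point n j]| <= 1) ->
           `|q.[t.1.2 * z]| <= `|t.1.1.[t.1.2 * z]|) &
        [/\ size t.2 = (d n).-1, uniq t.2, all (root t.1.1) t.2 &
            all (fun x => -1 < x < 1) t.2]].
  move=> n; have [Nn|nN] := leqP N0 n; last by exists (0, 0, [::]).
  have [n3 dn] := HN0 n Nn.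
  have [c [u [[c0 pE] su u1 [eps e2 ue] [rs Hrs]]]] :=
    extremal_structure n3 dn (dE n) (p_extremal (ltnW n3)).
  by exists (u, eps, rs) => _; split => //; exists c.
exists (fun n => (t n).2); split.
  exists N0 => n Nn; have [[c c0 ->] [su _] _ _ [srs us rs _]] := Ht n Nn.
  have [_ /andP[d1 _]] := HN0 n Nn.
  apply: zeros_perm_real_roots => //.
    have [[]] := p_extremal (ltnW (HN0 n Nn).1).
    by have [[c' c'0 ->] _ _ _ _] := Ht n Nn => + _ _; rewrite !scaler_eq0
      (negPf c0) (negPf c'0).
  by rewrite srs prednK// (ltnW d1).
move=> F cF; apply: (average_cvg alpha01 (N0 := N0)) => //.
- move=> n Nn; have [_ _ _ _ [-> _ _ _]] := Ht n Nn.
  have [_ /andP[_ dn]] := HN0 n Nn.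
  by rewrite (leq_trans (leq_pred _))// ltnW.
- by move=> n Nn; have [_ _ _ _ []] := Ht n Nn.
- apply: (moments_cvg alpha01 (d := d) (u := fun n => (t n).1.1)
    (eps := fun n => (t n).1.2) HN0) => n Nn.
  + by rewrite natr1 truncn_itv.
  + by have [_ []] := Ht n Nn.
  + by have [_ []] := Ht n Nn.
  + by have [_ _ ->] := Ht n Nn.
  + by have [_ _ _] := Ht n Nn.
  + by have [_ _ _ _] := Ht n Nn.
Qed.

(** The exceptional zero contributes at most B / n. Finiteness of the limit is stated as well so
    that two such limits can be subtracted. *)
Lemma integral_cvg_nonneg (f : R[i]^o -> R) (B : R) :
  continuous f -> (forall z, 0 <= f z) -> (forall z, `|f z| <= B) ->
  (\int[zero_counting n (p n)]_z (f z)%:E)%E @[n --> \oo] -->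
    (\int[equilibrium_measureC alpha01]_z (f z)%:E)%E /\
  (\int[equilibrium_measureC alpha01]_z (f z)%:E)%E \is a fin_num.
Proof.
move=> cf f0 fB.
have [rs [[N HN] Hrs]] := root_average_cvg.
have cF : continuous (fun x : R => f x%:C).
  by move=> x; apply: (continuous_comp (continuous_real_complex (x := x))); exact: cf.
have {}Hrs := Hrs _ cF.
rewrite integral_equilibriumC//.
have fin : (\int[lebesgue_measure]_(x in `[(-1)%R, 1%R])
    (f x%:C * eq_density alpha x)%:E)%E \is a fin_num.
  apply: integrable_fin_num => //.
  apply: continuous_compact_integrable; first exact: segment_compact.
  apply: continuous_subspaceT => x; apply: cvgM; first exact: cF.
  exact: continuous_eq_density.
split => //; rewrite -(fineK fin).
under eq_fun do rewrite integral_zero_counting//.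
apply: cvg_EFin; first by near=> n.
apply/cvgrPdist_le => e e0.
have e2 : 0 < e / 2 by rewrite divr_gt0.
move: Hrs => /cvgrPdist_le/(_ _ e2)[N1 _ HN1].
have [N2 HN2] := nat_archi (B / (e / 2)).
exists (maxn N (maxn N1 (maxn N2 1))) => // n /=.
rewrite !geq_max => /and4P[Nn N1n N2n n1].
have n0 : 0 < n%:R :> R by rewrite ltr0n.
have [ex sex pz] := HN n Nn.
have {}HN1 := HN1 n N1n; have {}HN2 := HN2 n N2n.
rewrite (perm_big _ pz) big_cat big_map /= mulrDl opprD addrA.
apply: le_trans (ler_normB _ _) _.
suff : `|(\sum_(z <- ex) f z) / n%:R| <= e / 2 by move: HN1; rewrite /Rintegral; lra.
rewrite normrM normfV (ger0_norm (ltW n0)) ler_pdivrMr//.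
rewrite ler_pdivrMr// mulrC in HN2.
have B0 : 0 <= B by apply: le_trans (fB 0); exact: normr_ge0.
case: (ex) sex => [|z [|//]] _; first by rewrite big_nil normr0 mulr_ge0// ltW.
by rewrite big_seq1 (le_trans (fB z)).
Unshelve. all: by end_near.
Qed.

End weak_convergence.

Theorem mainTheorem2 (R : realType) (alpha : R) (alpha01 : 0 < alpha < 1)
    (p : nat -> {poly R[i]})
    (p_extremal : forall n : nat, (2 <= n)%N -> extremal alpha n (p n)) :
  weak_star_cvg (fun n => zero_counting n (p n)) (equilibrium_measureC alpha01).
Proof.
move=> f cf /(compactly_supported_bounded cf)[B fB].
(* Applied to f and - f, this treats the positive and negative parts of f. Compact support enters
   only through the bound B. *)
have part (g : R[i]^o -> R) : continuous g -> (forall z, `|g z| <= B) ->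
    (\int[zero_counting n (p n)]_z (Num.max (g z) 0)%:E)%E @[n --> \oo] -->
      (\int[equilibrium_measureC alpha01]_z (Num.max (g z) 0)%:E)%E /\
    (\int[equilibrium_measureC alpha01]_z (Num.max (g z) 0)%:E)%E \is a fin_num.
  move=> cg gB; apply: (integral_cvg_nonneg alpha01 p_extremal (B := B)).
  - move=> z; apply: continuous_max; first exact: cg.
    exact: cst_continuous.
  - by move=> z; rewrite le_max lexx orbT.
  - move=> z; apply: le_trans (gB z); rewrite ger0_norm ?le_max ?lexx ?orbT//.
    by rewrite ge_max ler_norm normr_ge0.
have splitE (m : {measure set (@borelC R) -> \bar R}) :
    (\int[m]_z (f z)%:E = \int[m]_z (Num.max (f z) 0)%:E -
      \int[m]_z (Num.max (- f z) 0)%:E)%E.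
  rewrite integralE; congr (_ - _)%E; apply: eq_integral => z _.
    by rewrite funeposE EFin_max.
  by rewrite funenegE EFin_max.
have [c1 f1] := part f cf fB.
have [|z|c2 f2] := part (fun z => - f z).
- by move=> z; exact: (continuousN (cf z)).
- by rewrite normrN.
rewrite splitE; under eq_fun do rewrite splitE.
apply: cvgeB => //; apply: fin_num_adde_defl.
by rewrite fin_numN.
Qed.
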